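(* Let $\Omega\subset\mathbb{R}^n$ ($n\ge2$) be a bounded domain, let $1<p\le q<\infty$, and let $0\le a\in C^1(\Omega)$ with $a\in C^{0,\alpha}(\Omega)$ for some $\alpha\in(0,1]$ and $\frac qp\le1+\frac\alpha n$. Assume that $f:\Omega\times\mathbb{R}\times\mathbb{R}^n\to\mathbb{R}$ is uniformly continuous in $\Omega\times\mathbb{R}\times\mathbb{R}^n$. Let $u$ be a lower semicontinuous weak supersolution in $\Omega$ to $$-\operatorname{div}\left(|Du|^{p-2}Du+a(x)|Du|^{q-2}Du\right)=f(x,u,Du).$$ If $(u,f)$ fulfills the comparison principle property in every subdomain $\Omega'\subset\Omega$, then $u$ is also a viscosity supersolution to this equation in $\Omega$.
   Context: Write $H(x,\xi):=|\xi|^p+a(x)|\xi|^q$. $L^{H(\cdot)}(\Omega)$ is the space of measurable $u$ with $\varrho_H(u):=\int_\Omega H(x,u)\,dx<\infty$, with norm $\inf\{\lambda>0:\varrho_H(u/\lambda)\le1\}$; $W^{1,H(\cdot)}(\Omega)$ is the set of $u\in L^{H(\cdot)}(\Omega)$ with $Du\in L^{H(\cdot)}(\Omega)$, normed by $\|u\|_{L^{H(\cdot)}(\Omega)}+\|Du\|_{L^{H(\cdot)}(\Omega)}$; $W^{1,H(\cdot)}_{\rm loc}(\Omega)$ is the corresponding local space (membership in $W^{1,H(\cdot)}(\Omega')$ for every subdomain $\Omega'\subset\subset\Omega$); $W^{1,H(\cdot)}_0(\Omega)$ is the closure of $C_0^\infty(\Omega)$ in $W^{1,H(\cdot)}(\Omega)$.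 The same definitions apply to subdomains. Weak supersolution in $\Omega$: $u\in W^{1,H(\cdot)}_{\rm loc}(\Omega)$ such that, with $A(x,\xi):=|\xi|^{p-2}\xi+a(x)|\xi|^{q-2}\xi$, $\int_\Omega\langle A(x,Du),D\phi\rangle\,dx\ge\int_\Omega f(x,u,Du)\phi\,dx$ for each nonnegative $\phi\in W^{1,H(\cdot)}_0(\Omega)$; a weak subsolution satisfies the reverse inequality. Comparison principle property: if $u$ is a weak supersolution in $\Omega'\subset\Omega$, then $(u,f)$ fulfills the comparison principle property in $\Omega'$ if for any weak subsolution $v$ of the equation in $\Omega'$ with $v\le u$ a.e. on $\partial\Omega'$ there holds $v\le u$ a.e. in $\Omega'$. Here $v\le u$ on $\partial\Omega'$ is understood in the Sobolev sense $(v-u)_+\in W^{1,H(\cdot)}_0(\Omega')$. Viscosity supersolution: for $x\in\Omega$, $\xi\in\mathbb{R}^n\setminus\{0\}$ and $X$ a symmetric $n\times n$ matrix, set $$F(x,\xi,X)=-|\xi|^{p-2}\left(\mathrm{tr}X+(p-2)\left\langle X\tfrac{\xi}{|\xi|},\tfrac{\xi}{|\xi|}\right\rangle\right)-a(x)|\xi|^{q-2}\left(\mathrm{tr}X+(q-2)\left\langle X\tfrac{\xi}{|\xi|},\tfrac{\xi}{|\xi|}\right\rangle\right)-|\xi|^{q-2}\xi\cdot Da(x).$$ The subjet $J^{2,-}u(x)$ is the set of pairs $(\eta,X)$ with $u(y)\ge u(x)+\eta\cdot(y-x)+\frac12\langle X(y-x),y-x\rangle+o(|y-x|^2)$ as $y\to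 x$. A lower semicontinuous $u:\Omega\to(-\infty,\infty)$ is a viscosity supersolution if $(\eta,X)\in J^{2,-}u(x)$ with $x\in\Omega$, $\eta\ne0$ implies $F(x,\eta,X)\ge f(x,u(x),\eta)$.
   Formalization: The supersolution u is also assumed to equal its essential lower limit at every point of Ω (otherwise lowering u at one point is a counterexample); the weak inequalities are required only for test functions for which both integrals converge. *)

(* Defs.v *)
From HB Require Import structures.
From mathcomp Require Import all_boot all_order all_algebra.
From mathcomp Require Import all_classical all_reals all_analysis.
From mathcomp Require Import ess_sup_inf.

Set Implicit Arguments.
Unset Strict Implicit.
Unset Printing Implicit Defensive.

Import Order.TTheory GRing.Theory Num.Theory.
Import numFieldNormedType.Exports.

Local Open Scope classical_set_scope.
Local Open Scope ring_scope.

Definition rV_display : measure_display.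
Proof. exact. Qed.

Section rV_measurable.
Context (R : realType) (n : nat).

Definition rV_coord (i : 'I_n) (x : 'rV[R]_n) : measurableTypeR R := x 0 i.

(* Product sigma-algebra of the Borel sigma-algebra of R; this is the Borel
   sigma-algebra of 'rV[R]_n, see measurable_rV_open. *)
Definition rV_sigma : set (set 'rV[R]_n) := g_sigma_preimage rV_coord.

Let rV_sigma0 : rV_sigma set0.
Proof. exact: sigma_algebra0. Qed.

Let rV_sigmaC A : rV_sigma A -> rV_sigma (~` A).
Proof. exact: sigma_algebraC. Qed.

Let rV_sigma_bigcup (F : (set 'rV[R]_n)^nat) :
  (forall i, rV_sigma (F i)) -> rV_sigma (\bigcup_i F i).
Proof. exact: sigma_algebra_bigcup. Qed.

HB.instance Definition _ := @isMeasurable.Build rV_display 'rV[R]_n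
  rV_sigma rV_sigma0 rV_sigmaC rV_sigma_bigcup.

Lemma measurable_rV_coord (i : 'I_n) : measurable_fun [set: 'rV[R]_n] (rV_coord i).
Proof.
move=> _ Y mY; rewrite setTI; apply: sub_sigma_algebra => /=.
rewrite -bigcup_seq/=; exists i => /=; first by rewrite mem_index_enum.
by exists Y => //; rewrite setTI.
Qed.

Lemma measurable_fun_rV d (T : measurableType d) (f : T -> 'rV[R]_n) :
  (forall i, measurable_fun [set: T] (rV_coord i \o f)) ->
  measurable_fun [set: T] f.
Proof.
move=> mf; suff: rV_sigma `<=` [set A | measurable (f @^-1` A)].
  by move=> h _ A mA; rewrite setTI; exact: h.
apply: smallest_sub.
  split=> /=.
  - by rewrite preimage_set0.
  - by move=> A mA; rewrite setTD -preimage_setC; exact: measurableC.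
  - by move=> F mF; rewrite preimage_bigcup; exact: bigcup_measurable.
move=> A; rewrite -bigcup_seq/= => -[i _ [B mB <-]] /=.
by rewrite setTI -[X in measurable X]setTI; exact: mf.
Qed.

Lemma measurable_rV_open (A : set 'rV[R]_n) : open A -> measurable A.
Proof.
move=> oA.
pose B (z : 'rV[rat]_n * rat) : set 'rV[R]_n := \bigcap_(i in [set: 'I_n])
  (rV_coord i @^-1` ball (ratr (z.1 0 i) : R) (ratr z.2 : R)).
pose Q z := B z `<=` A.
have -> : A = \bigcup_(z in Q) B z.
  apply/seteqP; split=> [x Ax|x [z Qz] /Qz//].
  have /nbhs_ballP[e /= e0 xeA] : nbhs x A by exact: open_nbhs_nbhs.
  have /rat_in_itvoo[r] : 0 < e / 2 by rewrite divr_gt0.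
  rewrite in_itv/= => /andP[r0 re].
  have /choice[c xc] : forall i : 'I_n, exists c : rat,
      ball (ratr c : R) (ratr r : R) (x 0 i).
    move=> i; have /rat_in_itvoo[c] : x 0 i - ratr r < x 0 i by rewrite ltrBlDr ltrDl.
    rewrite in_itv/= => /andP[xc cx]; exists c; apply/ball_sym.
    by rewrite /ball/= gtr0_norm ?subr_gt0// ltrBlDr addrC -ltrBlDr.
  exists (\row_i c i, r); last by move=> i _ /=; rewrite mxE; exact: xc.
  move=> y By; apply: xeA; split => // i j; rewrite (ord1 i).
  rewrite (splitr e); apply: (@ball_triangle _ _ (ratr (c j) : R)).
    by apply/ball_sym; apply: le_ball (xc j); exact: ltW.
  by have := By j I; rewrite /= mxE; apply: le_ball; exact: ltW.
rewrite bigcup_mkcond; apply: countable_bigcupT_measurable; first exact: countableP.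
move=> z; case: ifPn => // _; apply: fin_bigcap_measurable => // i _.
rewrite -[X in measurable X]setTI; apply: measurable_rV_coord => //.
by rewrite ball_itv; exact: measurable_itv.
Qed.

End rV_measurable.

Section lebesgue_rV.
Context (R : realType).

Definition rV_cons (n : nat) (z : measurableTypeR R * 'rV[R]_n) : 'rV[R]_n.+1 :=
  \row_i (if unlift ord0 i is Some j then z.2 0 j else z.1).

Lemma measurable_rV_cons (n : nat) : measurable_fun setT (@rV_cons n).
Proof.
apply: measurable_fun_rV => i; case: (unliftP ord0 i) => [j|] ->.
  rewrite (_ : _ \o _ = rV_coord j \o snd).
    by apply: measurableT_comp => //; exact: measurable_rV_coord.
  by apply/funext => z /=; rewrite /rV_coord mxE liftK.
rewrite (_ : _ \o _ = fst) //.
by apply/funext => z /=; rewrite /rV_coord mxE unlift_none.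
Qed.

Section step.
Context (n : nat) (m : {sigma_finite_measure set 'rV[R]_n -> \bar R}).

Definition lebesgue_step : set 'rV[R]_n.+1 -> \bar R :=
  pushforward (@lebesgue_measure R \x m)%E (@rV_cons n).

Let lebesgue_step0 : lebesgue_step set0 = 0%E.
Proof. by rewrite /lebesgue_step /pushforward preimage_set0 measure0. Qed.

Let lebesgue_step_ge0 A : (0 <= lebesgue_step A)%E.
Proof. by rewrite /lebesgue_step /pushforward; exact: measure_ge0. Qed.

Let lebesgue_step_sigma_additive : semi_sigma_additive lebesgue_step.
Proof.
move=> F mF tF mUF; rewrite /lebesgue_step /pushforward preimage_bigcup.
apply: measure_semi_sigma_additive => //.
- by move=> k; rewrite -[X in measurable X]setTI; exact: measurable_rV_cons.
- apply/trivIsetP => i j _ _ ij; rewrite -preimage_setI.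
  by move/trivIsetP : tF => -> //; rewrite preimage_set0.
- by apply: bigcup_measurable => k _; rewrite -[X in measurable X]setTI;
    exact: measurable_rV_cons.
Qed.

HB.instance Definition _ := isMeasure.Build _ _ _ lebesgue_step
  lebesgue_step0 lebesgue_step_ge0 lebesgue_step_sigma_additive.

Let rV_uncons (x : 'rV[R]_n.+1) : measurableTypeR R * 'rV[R]_n :=
  (rV_coord ord0 x, \row_j x 0 (lift ord0 j)).

Let measurable_rV_uncons : measurable_fun setT rV_uncons.
Proof.
apply/measurable_fun_pairP; split; first exact: measurable_rV_coord.
apply: measurable_fun_rV => i.
rewrite (_ : _ \o _ = rV_coord (lift ord0 i)); first exact: measurable_rV_coord.
by apply/funext => x /=; rewrite /rV_coord mxE.
Qed.

Let rV_consK : cancel (@rV_cons n) rV_uncons.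
Proof.
move=> [x y]; congr (_, _); rewrite /rV_coord ?mxE ?unlift_none//.
by apply/rowP => j; rewrite !mxE liftK.
Qed.

Let lebesgue_step_sigma_finite : sigma_finite setT lebesgue_step.
Proof.
have /sigma_finiteP[F [TF ndF Foo]] := sigma_finiteT (@lebesgue_measure R).
have /sigma_finiteP[G [TG ndG Goo]] := sigma_finiteT m.
exists (fun k => rV_uncons @^-1` (F k `*` G k)).
  apply/esym/seteqP; split=> // x _.
  have [i _ Fi] : (\bigcup_k F k) (rV_uncons x).1 by rewrite -TF.
  have [j _ Gj] : (\bigcup_k G k) (rV_uncons x).2 by rewrite -TG.
  exists (maxn i j) => //; split.
    by move: Fi; exact/subsetPset/ndF/leq_maxl.
  by move: Gj; exact/subsetPset/ndG/leq_maxr.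
move=> k; have [mF Fk] := Foo k; have [mG Gk] := Goo k; split.
  rewrite -[X in measurable X]setTI; apply: measurable_rV_uncons => //.
  exact: measurableX.
rewrite /lebesgue_step /pushforward -comp_preimage.
rewrite (_ : _ \o _ = id); last by apply/funext => z /=; exact: rV_consK.
by rewrite preimage_id product_measure1E// lte_mul_pinfty// ge0_fin_numE.
Qed.

HB.instance Definition _ := Measure_isSigmaFinite.Build _ _ _ lebesgue_step
  lebesgue_step_sigma_finite.

End step.

(* n-dimensional Lebesgue measure, as the n-fold product of lebesgue_measure. *)
Fixpoint lebesgue_rV (n : nat) : {sigma_finite_measure set 'rV[R]_n -> \bar R} :=
  if n is n'.+1 then lebesgue_step (lebesgue_rV n')
  else dirac (0 : 'rV[R]_0).

Lemma lebesgue_rV_box (n : nat) (a b : 'rV[R]_n) :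
  (forall i, a 0 i <= b 0 i) ->
  lebesgue_rV n
    (\bigcap_(i in [set: 'I_n]) (@rV_coord R n i @^-1` `[a 0 i, b 0 i])) =
  (\prod_i (b 0 i - a 0 i))%:E.
Proof.
elim: n a b => [|n IH] a b ab.
  rewrite big_ord0 /= /dirac indicE mem_set//. by move=> [].
rewrite big_ord_recl [lebesgue_rV n.+1]/= /lebesgue_step /pushforward.
pose a' := \row_(j < n) a 0 (lift ord0 j); pose b' := \row_(j < n) b 0 (lift ord0 j).
transitivity ((@lebesgue_measure R \x lebesgue_rV n)%E (@rV_cons n @^-1` (\bigcap_(i in [set: 'I_n.+1]) (rV_coord i @^-1` `[a 0 i, b 0 i])))); first by [].
rewrite (_ : _ @^-1` _ = (`[a 0 ord0, b 0 ord0]%classic : set (measurableTypeR R)) `*` \bigcap_(i in [set: 'I_n]) (rV_coord i @^-1` `[a' 0 i, b' 0 i])).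
  rewrite product_measure1E//=; last first.
    apply: fin_bigcap_measurable => // i _; rewrite -[X in measurable X]setTI; apply: measurable_rV_coord => //.
  rewrite IH; last by move=> i; rewrite !mxE.
  rewrite lebesgue_measure_itv/= lte_fin.
  have -> : (\prod_i (b' 0 i - a' 0 i) = \prod_(i < n) (b 0 (lift ord0 i) - a 0 (lift ord0 i))) by apply: eq_bigr => i _; rewrite !mxE.
  have := ab ord0; rewrite le_eqVlt => /orP[/eqP->|->]; last by rewrite -EFinD -EFinM.
  by rewrite ltxx subrr !mul0r mul0e.
apply/seteqP; split=> [[x y] h|[x y] [h1 h2] i _] /=.
  split; first by have := h ord0 I; rewrite /= /rV_coord mxE unlift_none.
  by move=> i _; have := h (lift ord0 i) I; rewrite /= /rV_coord !mxE liftK.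
rewrite /rV_coord mxE; case: unliftP => [j|] -> //=.
by have := h2 j I; rewrite /= !mxE.
Qed.

End lebesgue_rV.

Section double_phase.
Context (R : realType) (n : nat).
Local Notation E := 'rV[R]_n.
Local Notation mu := (lebesgue_rV R n).
Implicit Types (Omega : set E) (x y xi eta : E).

(* The norm of the library on 'rV[R]_n is the sup norm; the Euclidean structure
   is defined here. *)
Definition dotv xi eta : R := \sum_(i < n) xi 0 i * eta 0 i.
Definition enorm xi : R := Num.sqrt (dotv xi xi).

Definition domain Omega := [/\ open Omega, connected Omega & Omega !=set0].

Definition cpt_contained (Omega' Omega : set E) :=
  compact (closure Omega') /\ closure Omega' `<=` Omega.

Definition evec (i : 'I_n) : E := delta_mx 0 i.

Definition grad (g : E -> R) x : E := \row_i 'D_(evec i) g x.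

Definition iter_partial (s : seq 'I_n) (g : E -> R) : E -> R :=
  foldr (fun i h => 'D_(evec i) h) g s.

Definition smooth (g : E -> R) :=
  forall (s : seq 'I_n) x, differentiable (iter_partial s g) x.

(* C_0^oo(Omega): smooth functions on the whole space whose support is a compact
   subset of Omega. *)
Definition test_function Omega (g : E -> R) :=
  smooth g /\ cpt_contained [set x | g x != 0] Omega.

Definition C1_on Omega (g : E -> R) := forall x, Omega x ->
  differentiable g x /\ {for x, continuous (grad g)}.

Definition holder_on (alpha : R) Omega (g : E -> R) := exists C : R,
  forall x y, Omega x -> Omega y -> `|g x - g y| <= C * enorm (x - y) `^ alpha.

Definition uniformly_continuous_on Omega (f : E -> R -> E -> R) :=
  forall e : R, 0 < e -> exists2 d : R, 0 < d &
    forall x y (s t : R) xi eta, Omega x -> Omega y ->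
      enorm (x - y) < d -> `|s - t| < d -> enorm (xi - eta) < d ->
      `|f x s xi - f y t eta| < e.

(* Functions on Omega are total functions on 'rV[R]_n whose values outside Omega
   are irrelevant: subspace Omega carries the relative topology at the points of
   Omega and the discrete one elsewhere. *)
Definition lsc_on Omega (u : E -> R) :=
  lower_semicontinuous (EFin \o u : subspace Omega -> \bar R).

(* ess liminf_{y -> x} u(y): the supremum over r > 0 of the essential infimum of
   u on the ball of radius r. A weak supersolution is only defined up to null
   sets; u = ess_liminf u singles out its lower semicontinuous representative.
   Lower semicontinuity alone does not: lowering u at a single point keeps it
   lower semicontinuous and a weak supersolution, but can produce arbitrarily
   large subjets at that point. *)
Definition ess_liminf (u : E -> R) x : \bar R :=
  ereal_sup [set ess_inf mu (patch (cst +oo%E) (ball x r) (EFin \o u))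
            | r in [set r : R | 0 < r]].

Definition locally_integrable_on Omega (g : E -> R) :=
  measurable_fun Omega g /\
  forall K, compact K -> K `<=` Omega -> mu.-integrable K (EFin \o g).

(* Dg is a weak gradient of g in Omega (it is unique up to a null set). *)
Definition weak_gradient Omega (g : E -> R) (Dg : E -> E) :=
  [/\ locally_integrable_on Omega g,
      forall i, locally_integrable_on Omega (fun x => Dg x 0 i) &
      forall phi, test_function Omega phi -> forall i,
        \int[mu]_(x in Omega) (g x * 'D_(evec i) phi x)
        = - \int[mu]_(x in Omega) (Dg x 0 i * phi x)].

Section spaces.
Context (p q : R) (a : E -> R).

Definition phase x (t : R) : R := `|t| `^ p + a x * `|t| `^ q.

Definition modular Omega (g : E -> R) : \bar R :=
  (\int[mu]_(x in Omega) (phase x (g x))%:E)%E.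

Definition LH Omega (g : E -> R) :=
  measurable_fun Omega g /\ (modular Omega g < +oo)%E.

Definition LH_norm Omega (g : E -> R) : \bar R :=
  ereal_inf [set lambda%:E | lambda in
    [set lambda : R | 0 < lambda /\
                      (modular Omega (fun x => g x / lambda)%R <= 1)%E]].

(* g is in W^{1,H}(Omega), with weak gradient Dg *)
Definition W1H_with Omega (g : E -> R) (Dg : E -> E) :=
  [/\ LH Omega g, weak_gradient Omega g Dg & LH Omega (enorm \o Dg)].

Definition W1H Omega (g : E -> R) := exists Dg, W1H_with Omega g Dg.

Definition W1H_norm Omega (g : E -> R) (Dg : E -> E) : \bar R :=
  (LH_norm Omega g + LH_norm Omega (enorm \o Dg))%E.

Definition W1H_loc Omega (g : E -> R) := forall Omega',
  domain Omega' -> cpt_contained Omega' Omega -> W1H Omega' g.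

(* g is in the closure of C_0^oo(Omega) in W^{1,H}(Omega), with weak gradient
   Dg; the weak gradient of g - phi is Dg - grad phi. *)
Definition W1H0_with Omega (g : E -> R) (Dg : E -> E) :=
  W1H_with Omega g Dg /\
  forall e : R, 0 < e -> exists2 phi, test_function Omega phi &
    (W1H_norm Omega (g \- phi)%R (Dg \- grad phi)%R < e%:E)%E.

Definition W1H0 Omega (g : E -> R) := exists Dg, W1H0_with Omega g Dg.

Definition flux x xi : E :=
  enorm xi `^ (p - 2) *: xi + (a x * enorm xi `^ (q - 2)) *: xi.

Section equation.
Context (f : E -> R -> E -> R).

(* ineq compares the left-hand side of the weak formulation with its right-hand
   side. As u is only locally in W^{1,H}, the two integrals need not converge for
   every phi in W^{1,H}_0; the inequality is required whenever they do. *)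
Definition weak_formulation (ineq : R -> R -> Prop) Omega (u : E -> R) :=
  W1H_loc Omega u /\
  exists2 Du, weak_gradient Omega u Du &
    forall phi Dphi, W1H0_with Omega phi Dphi ->
      {ae mu, forall x, Omega x -> 0 <= phi x} ->
      mu.-integrable Omega (fun x => (dotv (flux x (Du x)) (Dphi x))%:E) ->
      mu.-integrable Omega (fun x => (f x (u x) (Du x) * phi x)%:E) ->
      ineq (\int[mu]_(x in Omega) dotv (flux x (Du x)) (Dphi x))
           (\int[mu]_(x in Omega) (f x (u x) (Du x) * phi x)).

Definition weak_supersolution := weak_formulation (fun l r => r <= l).
Definition weak_subsolution := weak_formulation (fun l r => l <= r).

(* Comparison principle property of (u, f) in Omega, for u a weak supersolution
   in Omega *)
Definition comparison_property Omega (u : E -> R) :=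
  forall v, weak_subsolution Omega v ->
    W1H0 Omega (fun x => Num.max (v x - u x) 0) ->
    {ae mu, forall x, Omega x -> v x <= u x}.

(* <X xi, eta>, with xi and eta as row vectors *)
Definition quad (X : 'M[R]_n) xi eta : R := dotv (xi *m X^T) eta.

Definition viscosity_op x xi (X : 'M[R]_n) : R :=
  let e := (enorm xi)^-1 *: xi in
  - enorm xi `^ (p - 2) * (\tr X + (p - 2) * quad X e e)
  - a x * enorm xi `^ (q - 2) * (\tr X + (q - 2) * quad X e e)
  - enorm xi `^ (q - 2) * dotv xi (grad a x).

Definition subjet (u : E -> R) x : set (E * 'M[R]_n) :=
  [set j | j.2^T = j.2 /\
    forall e : R, 0 < e -> \forall y \near x,
      u x + dotv j.1 (y - x) + 2^-1 * quad j.2 (y - x) (y - x)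
        - e * enorm (y - x) ^+ 2 <= u y].

Definition viscosity_supersolution Omega (u : E -> R) :=
  lsc_on Omega u /\
  forall x eta X, Omega x -> eta != 0 -> subjet u x (eta, X) ->
    f x (u x) eta <= viscosity_op x eta X.

End equation.
End spaces.
End double_phase.

(* Main.v *)
From HB Require Import structures.
Require Import Defs.
From mathcomp Require Import all_boot all_order all_algebra.
From mathcomp Require Import all_classical all_reals all_analysis.
From mathcomp Require Import ring lra ess_sup_inf measurable_realfun.

Set Implicit Arguments.
Unset Strict Implicit.
Unset Printing Implicit Defensive.

Import Order.TTheory GRing.Theory Num.Theory.
Import numFieldNormedType.Exports.

Local Open Scope classical_set_scope.
Local Open Scope ring_scope.

(** Suppose a test pair [(eta, X)] with [eta != 0] violates the viscosity
    inequality at [x0]. Lowering the touching paraboloid by [2 e |y - x0|^2] and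
    then raising it by a small constant [m] gives a quadratic [v] with nonzero
    gradient which, on a small cube around [x0], is a strict classical
    subsolution and lies below [u] away from the centre. Integration by parts
    makes [v] a weak subsolution there, and [(v - u)_+] has zero boundary values:
    its mollifications converge in [W^{1,H}], because [q / p <= 1 + 1 / n] and
    the local Lipschitz continuity of [a] (as [a] is [C^1]) bound
    [H(x, D w_e (x))] by the mollified energy. The comparison principle gives
    [v <= u] almost everywhere near [x0], so that
    [u(x0) = ess liminf u >= u(x0) + m / 2], a contradiction. *)

(** * Gradients and smooth functions *)

(** The comparison property asks for [(v - u)_+] in the closure of test functions. For an energy
    depending on x this is delicate: translations are not bounded on L^H, so mollifying a function
    with finite energy may cost infinite energy where [a] is small (Lavrentiev phenomenon). The
    remedy is to freeze [a] at its lower bound on the cube of radius e, apply Jensen there, and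
    absorb the oscillation L e of [a] with the exponent bound. The positive part is taken after
    mollification: w = v - u is mollified first, then composed with a smooth [soft d] that vanishes
    on t <= 0. The result is itself a test function, being nonzero only where w_e > 0. One
    approximation thus yields both the membership and the weak gradient 1_{w > 0} Dw, with no
    separate Sobolev chain rule. The weak inequality is tested with all of W_0^{1,H}, so integration
    by parts for [v] is extended by density, its flux and the divergence of its flux being bounded
    on a compact cube where Dv does not vanish. The coefficient 2 e splits in two: one e pays for
    the error allowed in the subjet, the other leaves room for [m] away from the centre. *)

Section gradients.
Context (R : realType) (n : nat).
Local Notation E := 'rV[R]_n.
Implicit Types (x y v g h : E) (f w : E -> R).

Lemma dotvC x y : dotv x y = dotv y x.
Proof. by apply: eq_bigr => i _; rewrite mulrC. Qed.

Lemma dotvDl x y v : dotv (x + y) v = dotv x v + dotv y v.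
Proof. by rewrite -big_split; apply: eq_bigr => i _; rewrite mxE mulrDl. Qed.

Lemma dotvZl (c : R) x v : dotv (c *: x) v = c * dotv x v.
Proof. by rewrite /dotv mulr_sumr; apply: eq_bigr => i _; rewrite mxE mulrA. Qed.

Lemma dotvDr v x y : dotv v (x + y) = dotv v x + dotv v y.
Proof. by rewrite dotvC dotvDl !(dotvC v). Qed.

Lemma dotvZr (c : R) x v : dotv v (c *: x) = c * dotv v x.
Proof. by rewrite dotvC dotvZl (dotvC v). Qed.

Lemma dotvNr v x : dotv v (- x) = - dotv v x.
Proof. by rewrite -scaleN1r dotvZr mulN1r. Qed.

Lemma dotvBr v x y : dotv v (x - y) = dotv v x - dotv v y.
Proof. by rewrite dotvDr dotvNr. Qed.

Lemma dotv_evec v i : dotv v (evec R i) = v 0 i.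
Proof.
rewrite /dotv (bigD1 i)//= big1 => [|j ji]; rewrite /evec mxE eqxx/=.
  by rewrite eqxx mulr1 addr0.
by rewrite (negbTE ji) mulr0.
Qed.

Lemma dotv_ge0 x : 0 <= dotv x x.
Proof. by apply: sumr_ge0 => i _; rewrite -expr2 sqr_ge0. Qed.

Lemma enorm_ge0 x : 0 <= enorm x.
Proof. exact: sqrtr_ge0. Qed.

Lemma sqr_enorm x : enorm x ^+ 2 = dotv x x.
Proof. by rewrite sqr_sqrtr// dotv_ge0. Qed.

Lemma coord_le_norm x i : `|x 0 i| <= `|x|.
Proof.
rewrite [`|x|]mx_normrE.
exact: (le_bigmax 0 (fun ij : 'I_1 * 'I_n => `|x ij.1 ij.2|) (0, i)).
Qed.

Lemma norm_le_coord x (c : R) : 0 <= c -> (forall i, `|x 0 i| <= c) -> `|x| <= c.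
Proof.
move=> c0 xc; rewrite [`|x|]mx_normrE; apply/bigmax_leP; split => // -[i j] _ /=.
by rewrite (ord1 i).
Qed.

Lemma coord_le_enorm x i : `|x 0 i| <= enorm x.
Proof.
rewrite -sqrtr_sqr /enorm ler_sqrt ?dotv_ge0//.
rewrite /dotv (bigD1 i)//= expr2 lerDl.
by apply: sumr_ge0 => j _; rewrite -expr2 sqr_ge0.
Qed.

Lemma norm_le_enorm x : `|x| <= enorm x.
Proof. by apply: norm_le_coord; [exact: enorm_ge0|exact: coord_le_enorm]. Qed.

Lemma enorm_le_sum x : enorm x <= \sum_i `|x 0 i|.
Proof.
have s0 : 0 <= \sum_i `|x 0 i| by apply: sumr_ge0.
rewrite -(ger0_norm s0) -sqrtr_sqr /enorm ler_sqrt ?sqr_ge0//.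
rewrite expr2 mulr_suml; apply: ler_sum => i _.
rewrite (le_trans (ler_norm _))// normrM ler_wpM2l//.
by rewrite (bigD1 i)//= lerDl sumr_ge0.
Qed.

Lemma enorm_le_norm x : enorm x <= n%:R * `|x|.
Proof.
rewrite (le_trans (enorm_le_sum x))// mulr_natl.
rewrite -[X in _ *+ X]card_ord -sumr_const.
by apply: ler_sum => i _; exact: coord_le_norm.
Qed.

Lemma normr_dotv_le x y : `|dotv x y| <= (\sum_i `|x 0 i|) * `|y|.
Proof.
rewrite (le_trans (ler_norm_sum _ _ _))// mulr_suml.
by apply: ler_sum => i _; rewrite normrM ler_wpM2l// coord_le_norm.
Qed.

Lemma dotv_lin g : linear (dotv g).
Proof. by move=> c x y; rewrite dotvDr dotvZr. Qed.

HB.instance Definition _ g := GRing.isLinear.Build R E R _ (dotv g)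
  (dotv_lin g).

Lemma dotv_continuous g : continuous (dotv g).
Proof.
move=> x; apply/(cvgrPdist_le (FF := nbhs_filter x)) => e e0.
set S := \sum_i `|g 0 i|; have S0 : 0 <= S by exact: sumr_ge0.
have S1 : 0 < 1 + S by rewrite ltr_pwDl.
apply/nbhs_ballP; exists (e / (1 + S)); first exact: divr_gt0.
move=> y; rewrite -ball_normE/= => /ltW; rewrite ler_pdivlMr// => xy.
rewrite -dotvBr (le_trans (normr_dotv_le _ _))// (le_trans _ xy)//.
by rewrite mulrC ler_wpM2l// lerDr.
Qed.

(** Storing the differential as a vector acting through [dotv] lets the rules below compute
    gradients by vector algebra; [hasgradE] then reads off the partial derivatives. *)
Definition hasgrad f x g := differentiable f x /\ forall v, 'd f x v = dotv g v.

Lemma hasgrad_diff f x g : hasgrad f x g -> is_diff x f (dotv g).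
Proof. by move=> [d e]; apply: DiffDef => //; apply/funext. Qed.

Lemma diff_hasgrad f x g : is_diff x f (dotv g) -> hasgrad f x g.
Proof. by move=> d; split; [exact: ex_diff|move=> v; rewrite diff_val]. Qed.

Lemma hasgrad_derive f x g : hasgrad f x g -> forall v, is_derive x v f (dotv g v).
Proof.
move=> [d e] v; apply: DeriveDef; first exact: diff_derivable.
by rewrite deriveE.
Qed.

Lemma hasgradE f x g : hasgrad f x g -> forall i, 'D_(evec R i) f x = g 0 i.
Proof.
by move=> /hasgrad_derive/[swap] i /(_ (evec R i)) d; rewrite derive_val dotv_evec.
Qed.

Lemma hasgrad_grad f x g : hasgrad f x g -> grad f x = g.
Proof. by move=> fg; apply/rowP => i; rewrite mxE (hasgradE fg). Qed.

Lemma rV_sum_evec v : v = \sum_i v 0 i *: evec R i.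
Proof. by rewrite {1}(row_sum_delta v). Qed.

Lemma differentiable_hasgrad f x : differentiable f x -> hasgrad f x (grad f x).
Proof.
move=> d; split=> // v; rewrite {1}(rV_sum_evec v) linear_sum.
by apply: eq_bigr => i _; rewrite linearZ /= -deriveE// mxE mulrC.
Qed.

Lemma hasgrad_continuous f x g : hasgrad f x g -> {for x, continuous f}.
Proof. by move=> [d _]; exact: differentiable_continuous. Qed.

Lemma hasgrad_ext f w x g : f =1 w -> hasgrad f x g -> hasgrad w x g.
Proof. by move=> /funext ->. Qed.

(** The first-order expansion in epsilon form. The converse rests on uniqueness of the differential,
    [dotv g] being linear and continuous. *)
Lemma hasgradP f x g : hasgrad f x g <->
  forall e : R, 0 < e -> \forall y \near x,
    `|f y - f x - dotv g (y - x)| <= e * `|y - x|.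
Proof.
have shiftE (P : set E) :
    (\forall h \near (0 : E), P (h + x)) <-> \forall y \near x, P y.
  by rewrite (near_shift 0 x) subr0.
split=> [[d e] eps eps0|H].
  have /eqaddoP/(_ _ eps0) := diff_locally d.
  have -> : 'd f x = dotv g :> (E -> R) by apply/funext.
  move=> H; apply/shiftE; apply: filterS H => h /=.
  by rewrite !fctE /= addrK opprD addrA.
have fE : f \o shift x = cst (f x) + dotv g +o_ (0 : E) id.
  apply/eqaddoP => e e0; have /shiftE := H e e0.
  by apply: filterS => h; rewrite !fctE /= addrK opprD addrA.
have dfE : 'd f x = dotv g :> (E -> R).
  by apply: diff_unique fE; exact: dotv_continuous.
split; last by move=> v; rewrite dfE.
by apply/diff_locallyP; rewrite dfE; split => //; exact: dotv_continuous.
Qed.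

Lemma hasgrad_near f w x g : {near x, f =1 w} -> hasgrad f x g -> hasgrad w x g.
Proof.
move=> fw /hasgradP fg; have fwx : f x = w x := nbhs_singleton fw.
apply/hasgradP => e /fg; apply: filterS2 fw => y <-.
by rewrite fwx.
Qed.

(** The form in which convolutions are differentiated: their remainder is bounded quadratically,
    with a constant coming from an integral. *)
Lemma hasgrad_quad f x g (C : R) :
  (\forall y \near x, `|f y - f x - dotv g (y - x)| <= C * `|y - x| ^+ 2) ->
  hasgrad f x g.
Proof.
move=> H; apply/hasgradP => e e0; near=> y.
have [->|yx] := eqVneq y x.
  by rewrite !subrr normr0 mulr0 sub0r normrN /dotv big1 ?normr0// => i _; rewrite mxE mulr0.
apply: (@le_trans _ _ (C * `|y - x| ^+ 2)); first by near: y.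
rewrite expr2 mulrA ler_wpM2r//.
have C1 : 0 < 1 + `|C| by rewrite ltr_pwDl.
have : `|y - x| <= e / (1 + `|C|).
  near: y; apply/nbhs_ballP; exists (e / (1 + `|C|)); first exact: divr_gt0.
  by move=> y; rewrite -ball_normE/= distrC => /ltW.
rewrite ler_pdivlMr// => /(le_trans _); apply.
rewrite mulrC ler_wpM2l//; rewrite (le_trans (ler_norm _))// lerDr ler01//.
Unshelve. all: by end_near. Qed.

Lemma hasgrad_cst (c : R) x : hasgrad (cst c) x 0.
Proof.
apply: diff_hasgrad; rewrite (_ : dotv 0 = 0); first exact: is_diff_cst.
by apply/funext => y; rewrite /dotv big1// => i _; rewrite mxE mul0r.
Qed.

Lemma hasgrad_coord i x : hasgrad (fun y => y 0 i) x (evec R i).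
Proof.
apply/hasgradP => e e0; near=> y.
by rewrite dotvC dotv_evec !mxE subrr normr0 mulr_ge0// ltW.
Unshelve. all: by end_near. Qed.

Lemma hasgrad_dotv g x : hasgrad (dotv g) x g.
Proof.
apply/hasgradP => e e0; near=> y.
by rewrite dotvBr subrr normr0 mulr_ge0// ltW.
Unshelve. all: by end_near.
Qed.

Lemma hasgradD f w x g h : hasgrad f x g -> hasgrad w x h ->
  hasgrad (fun y => f y + w y) x (g + h).
Proof.
move=> /hasgrad_diff d1 /hasgrad_diff d2; apply: diff_hasgrad.
rewrite (_ : dotv _ = dotv g + dotv h); first exact: is_diffD.
by apply/funext => y; rewrite dotvDl.
Qed.

Lemma hasgrad_comp f x g (b : R -> R) (db : R) : hasgrad f x g ->
  is_derive (f x) 1 b db -> hasgrad (fun y => b (f y)) x (db *: g).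
Proof.
move=> /hasgrad_diff fg [bd bv].
have {}bd : differentiable b (f x) by exact/derivable1_diffP.
have db' : is_diff (f x) b ( *:%R^~ db : R -> R).
  apply: DiffDef => //; rewrite diff1E//; apply/funext => y /=.
  by rewrite derive1E bv.
have H := is_diff_comp fg db'.
apply: diff_hasgrad; rewrite (_ : dotv _ = (fun y : R => y *: db) \o dotv g) //.
by apply/funext => y /=; rewrite dotvZl mulrC.
Qed.

Lemma hasgradZ f x g (c : R) : hasgrad f x g ->
  hasgrad (fun y => c * f y) x (c *: g).
Proof.
move=> fg; apply: (hasgrad_comp fg).
have := @is_deriveZ _ _ _ (id : R -> R) c (f x) 1 1 (is_derive_id _ _).
by rewrite /GRing.scale /= mulr1.
Qed.

Lemma hasgradM f w x g h : hasgrad f x g -> hasgrad w x h ->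
  hasgrad (fun y => f y * w y) x (f x *: h + w x *: g).
Proof.
move=> /hasgrad_diff d1 /hasgrad_diff d2; apply: diff_hasgrad.
have := is_diffM d1 d2.
rewrite (_ : f x *: dotv h + w x *: dotv g = dotv (f x *: h + w x *: g))//.
by apply/funext => y; rewrite dotvDl !dotvZl.
Qed.

Lemma hasgradN f x g : hasgrad f x g -> hasgrad (fun y => - f y) x (- g).
Proof.
move=> /(hasgradZ (-1)); rewrite scaleN1r; apply: hasgrad_ext => y.
by rewrite mulN1r.
Qed.

Lemma hasgradB f w x g h : hasgrad f x g -> hasgrad w x h ->
  hasgrad (fun y => f y - w y) x (g - h).
Proof. by move=> fg /hasgradN; exact: hasgradD. Qed.

Lemma hasgrad_sum (I : Type) (s : seq I) (F : I -> E -> R) (G : I -> E) x :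
  (forall i, hasgrad (F i) x (G i)) ->
  hasgrad (fun y => \sum_(i <- s) F i y) x (\sum_(i <- s) G i).
Proof.
move=> FG; elim: s => [|i s IH].
  by rewrite big_nil; apply: hasgrad_ext (hasgrad_cst 0 x) => y; rewrite big_nil.
rewrite big_cons; apply: hasgrad_ext (hasgradD (FG i) IH) => y.
by rewrite big_cons.
Qed.

Lemma hasgrad_refl f x v g : hasgrad f (v - x) g ->
  hasgrad (fun y => f (v - y)) x (- g).
Proof.
move=> /hasgradP H; apply/hasgradP => e /H/nbhs_ballP[d /= d0 dH].
apply/nbhs_ballP; exists d => //= y; rewrite -ball_normE /= => xy.
have := dH (v - y); rewrite -ball_normE /=.
have -> : v - y - (v - x) = x - y by rewrite opprB addrC addrA subrK.
have -> : v - x - (v - y) = y - x by rewrite opprB addrC addrA subrK.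
rewrite (distrC y) => /(_ xy).
have -> : dotv (- g) (y - x) = dotv g (x - y).
  by rewrite -[y - x]opprB dotvNr dotvC dotvNr opprK dotvC.
by rewrite -(normrN (x - y)) opprB.
Qed.

Lemma iter_partial_rcons (s : seq 'I_n) i f :
  iter_partial (rcons s i) f = iter_partial s (fun x => 'D_(evec R i) f x).
Proof. by rewrite /iter_partial -cats1 foldr_cat. Qed.

(** [iter_partial] applies the head of the list last, whereas [diffn] peels off the derivative taken
    first. Sums, products and compositions can then be treated by induction on the order, without
    lists of indices. *)
Fixpoint diffn k f : Prop := (forall x, differentiable f x) /\
  if k is k'.+1 then forall i, diffn k' (fun x => 'D_(evec R i) f x) else True.

Lemma diffnS k f : diffn k.+1 f -> diffn k f.
Proof.
elim: k f => [|k IH] f [df Df]; first by split.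
by split=> // i; exact/IH/Df.
Qed.

Lemma smoothP f : smooth f <-> forall k, diffn k f.
Proof.
split=> [sf k|df s].
  elim: k f sf => [|k IH] f sf; split => //.
  - by move=> x; exact: (sf [::]).
  - by move=> x; exact: (sf [::]).
  - by move=> i; apply: IH => s x; rewrite -iter_partial_rcons; exact: sf.
have : forall k s, size s = k -> forall f, diffn k f ->
    forall x, differentiable (iter_partial s f) x.
  elim=> [|k IH] {}s.
    by move/size0nil => -> g [].
  case/lastP: s => // s i; rewrite size_rcons => -[sk] g [_ Dg] x.
  by rewrite iter_partial_rcons; exact: (IH s sk _ (Dg i)).
by move/(_ _ s erefl f (df _)).
Qed.

Lemma diffn_ext k f w : f =1 w -> diffn k f -> diffn k w.
Proof. by move=> /funext ->. Qed.

Lemma diffn_cst k (c : R) : diffn k (cst c : E -> R).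
Proof.
elim: k c => [|k IH] c; split=> // i; apply: diffn_ext (IH 0) => x.
by rewrite (hasgradE (hasgrad_cst c x)) mxE.
Qed.

Lemma diffn_coord k i : diffn k (fun x : E => x 0 i).
Proof.
case: k => [|k]; split=> //; try by move=> x; exact: differentiable_coord.
move=> j; apply: diffn_ext (diffn_cst k (evec R i 0 j)) => x.
by rewrite (hasgradE (hasgrad_coord i x)).
Qed.

Lemma diffnD k f w : diffn k f -> diffn k w -> diffn k (fun x => f x + w x).
Proof.
elim: k f w => [|k IH] f w [df Df] [dw Dw]; split=> //;
  try by move=> x; exact: (hasgradD (differentiable_hasgrad (df x))
    (differentiable_hasgrad (dw x))).1.
move=> i; apply: diffn_ext (IH _ _ (Df i) (Dw i)) => x.
rewrite (hasgradE (hasgradD (differentiable_hasgrad (df x))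
    (differentiable_hasgrad (dw x)))).
by rewrite !mxE.
Qed.

Lemma diffnM k f w : diffn k f -> diffn k w -> diffn k (fun x => f x * w x).
Proof.
elim: k f w => [|k IH] f w.
  by move=> [df _] [dw _]; split=> // x; exact: (hasgradM (differentiable_hasgrad (df x))
    (differentiable_hasgrad (dw x))).1.
move=> Sf Sw; have [df Df] := Sf; have [dw Dw] := Sw.
split=> [x|i].
  exact: (hasgradM (differentiable_hasgrad (df x))
    (differentiable_hasgrad (dw x))).1.
apply: diffn_ext (diffnD (IH _ _ (diffnS Sf) (Dw i)) (IH _ _ (diffnS Sw) (Df i))) => x.
rewrite (hasgradE (hasgradM (differentiable_hasgrad (df x))
    (differentiable_hasgrad (dw x)))).
by rewrite !mxE.
Qed.

Lemma diffn_sum k (I : Type) (s : seq I) (F : I -> E -> R) :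
  (forall i, diffn k (F i)) -> diffn k (fun x => \sum_(i <- s) F i x).
Proof.
move=> dF; elim: s => [|i s IH].
  by apply: diffn_ext (diffn_cst k 0) => x; rewrite big_nil.
by apply: diffn_ext (diffnD (dF i) IH) => x; rewrite big_cons.
Qed.

(** Since D_i (b o f) = (b' o f) D_i f and b' stays in the family [F], the product rule and
    induction suffice; no formula for higher derivatives of a composition is needed. *)
Lemma diffn_comp (F : set (R -> R)) k f :
  (forall b, F b -> exists2 db, F db & forall t, is_derive (t : R) 1 b (db t : R)) ->
  diffn k f -> forall b, F b -> diffn k (b \o f).
Proof.
move=> HF; elim: k f => [|k IH] f.
  move=> [df _] b /HF[db _ bdb]; split=> // x.
  exact: (hasgrad_comp (differentiable_hasgrad (df x)) (bdb _)).1.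
move=> Sf b Fb; have [df Df] := Sf; have [db Fdb bdb] := HF _ Fb.
split=> [x|i].
  exact: (hasgrad_comp (differentiable_hasgrad (df x)) (bdb _)).1.
apply: diffn_ext (diffnM (IH _ (diffnS Sf) _ Fdb) (Df i)) => x.
rewrite (hasgradE (hasgrad_comp (differentiable_hasgrad (df x)) (bdb _))).
by rewrite !mxE.
Qed.

End gradients.

(* The functions t |-> P(1/t) e^(-d/t) (extended by 0 to t <= 0) are stable under
   derivation. *)
Section flat.
Context (R : realType) (d : R) (d0 : 0 < d).
Implicit Types (P : {poly R}) (t : R).

Definition flat P t : R := if 0 < t then P.[t^-1] * expR (- d / t) else 0.

(** With s = 1/t, the chain rule turns P(s) e^(-d s) into -s^2 (P'(s) - d P(s)) e^(-d s). *)
Definition dflat P : {poly R} := - ('X^2 * (P^`() - d *: P)).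

(** From 1 + x^k / k! <= e^x at x = d s. *)
Lemma expn_expR_bound k : exists2 C : R, 0 <= C &
  forall s, 0 < s -> s ^+ k * expR (- d * s) <= C.
Proof.
case: k => [|k].
  exists 1 => // s s0; rewrite expr0 mul1r -expR0 ler_expR mulNr oppr_le0.
  by rewrite mulr_ge0// ltW.
exists (k.+1`!%:R / d ^+ k.+1); first by rewrite divr_ge0// exprn_ge0// ltW.
move=> s s0; rewrite mulNr expRN ler_pdivrMr ?expR_gt0// mulrAC.
rewrite ler_pdivlMr ?exprn_gt0// mulrC -exprMn mulrC.
have ds : 0 <= d * s by rewrite mulr_ge0 ?ltW.
rewrite -ler_pdivrMl ?ltr0n ?fact_gt0// mulrC.
by apply: le_trans (expR_ge1Dxn k ds); rewrite [leLHS]mulrC lerDr ler01.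
Qed.

Lemma poly_expR_bound P : exists2 C : R, 0 <= C &
  forall s, 0 < s -> `|P.[s]| * expR (- d * s) <= C.
Proof.
have /choice[C HC] : forall k : nat, exists C : R, 0 <= C /\
    forall s, 0 < s -> s ^+ k * expR (- d * s) <= C.
  by move=> k; have [C] := expn_expR_bound k; exists C.
exists (\sum_(i < size P) `|P`_i| * C i).
  by apply: sumr_ge0 => i _; rewrite mulr_ge0// (HC i).1.
move=> s s0; rewrite horner_coef.
apply: (@le_trans _ _ ((\sum_(i < size P) `|P`_i| * s ^+ i) * expR (- d * s))).
  rewrite ler_wpM2r ?expR_ge0// (le_trans (ler_norm_sum _ _ _))//.
  by apply: ler_sum => i _; rewrite normrM normrX (gtr0_norm s0).
rewrite mulr_suml; apply: ler_sum => i _.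
by rewrite -mulrA ler_wpM2l// (HC i).2.
Qed.

(** Bounding X^2 P instead of P gains the factor t^2, which forces the derivative at 0 to exist and
    to vanish. *)
Lemma flat_sqr P : exists2 C : R, 0 <= C & forall t, `|flat P t| <= C * t ^+ 2.
Proof.
have [C C0 HC] := poly_expR_bound ('X^2 * P); exists C => // t.
rewrite /flat; case: ifPn => [t0|_]; last by rewrite normr0 mulr_ge0// sqr_ge0.
have ti : 0 < t^-1 by rewrite invr_gt0.
have := HC _ ti; rewrite hornerM hornerXn normrM (ger0_norm (sqr_ge0 _)) exprVn.
rewrite normrM (ger0_norm (expR_ge0 _)) mulNr => H.
by rewrite -ler_pdivrMr ?exprn_gt0// mulrC mulrA.
Qed.

Lemma is_derive_flat P t : is_derive t 1 (flat P) (flat (dflat P) t).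
Proof.
have [t0|] := ltP 0 t.
  have tn0 : t != 0 by rewrite gt_eqF.
  pose e s := P.[s^-1] * expR (- d / s).
  have dV : is_derive t 1 (@GRing.inv R) (- t ^- 2).
    apply: DeriveDef; first exact: (@derivableV R R^o id).
    by rewrite (@deriveV R R^o id)// derive_id /GRing.scale/= mulr1.
  have dP : is_derive t^-1 1 (horner P) (P^`()).[t^-1].
    by apply: DeriveDef; [exact: derivable_horner|rewrite -derive1E -derivE].
  have dPV := @is_derive1_comp R _ _ _ _ _ dP dV.
  have de : is_derive t 1 (fun s : R => - d / s) (- d * - t ^- 2).
    exact: (@is_deriveZ R R^o R^o (@GRing.inv R) (- d) t 1 _ dV).
  have deV := @is_derive1_comp R _ _ _ _ _ (is_derive_expR _) de.
  have de' := @is_deriveM R R^o _ _ _ _ _ _ dPV deV.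
  apply: (@near_eq_is_derive _ _ _ e).
    near=> s; rewrite /e /flat.
    have -> : 0 < s by near: s; exact: lt_nbhsr.
    by [].
  rewrite /flat t0 /dflat !hornerE /GRing.scale/=.
  apply: is_derive_eq de' _; rewrite /= /GRing.scale/= exprVn.
  by rewrite !mulrN mulrBr; ring.
rewrite le_eqVlt => /orP[/eqP ->|t0].
  have [C C0 HC] := flat_sqr P.
  have f0 Q : flat Q 0 = 0 by rewrite /flat ltxx.
  have cv : (fun h : R => h^-1 *: (flat P (h *: 1 + 0) - flat P 0)) @ 0^' --> (0 : R).
    apply/cvgrPdist_le => e e0; near=> h.
    have h0 : 0 < `|h| by rewrite normr_gt0; near: h; exact: nbhs_dnbhs_neq.
    rewrite sub0r normrN f0 subr0 addr0 /GRing.scale/= mulr1 normrM normfV.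
    rewrite ler_pdivrMl// (le_trans (HC h))// -real_normK ?num_real//.
    rewrite expr2 mulrCA ler_wpM2l//.
    have : `|h| <= e / (1 + C).
      near: h; apply: nbhs_dnbhs; apply/nbhs_ballP; exists (e / (1 + C)).
        by rewrite /= divr_gt0// ltr_pwDl.
      by move=> y; rewrite -ball_normE/= sub0r normrN => /ltW.
    rewrite ler_pdivlMr ?ltr_pwDl// => /(le_trans _); apply.
    by rewrite mulrC ler_wpM2l// lerDr.
  rewrite f0; apply: DeriveDef; first by apply/cvg_ex; exists 0.
  exact: cvg_lim cv.
apply: (@near_eq_is_derive _ _ _ (cst 0)).
  near=> s; rewrite /flat ltNge.
  have -> : s <= 0 by apply/ltW; near: s; exact: lt_nbhsl.
  by [].
rewrite /flat ltNge (ltW t0)/=; exact: is_derive_cst.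
Unshelve. all: by end_near. Qed.

End flat.

(** * Mean value and Taylor estimates along segments *)

Section mean_value.
Context (R : realType).

Lemma derive_lipschitz (f df : R -> R) (C : R) :
  (forall t : R, is_derive t 1 f (df t)) -> (forall t, `|df t| <= C) ->
  forall s t, `|f s - f t| <= C * `|s - t|.
Proof.
move=> fdf dfC.
suff H s t : s < t -> `|f s - f t| <= C * `|s - t|.
  move=> s t; have [st|ts|->] := ltgtP s t; [exact: H| |by rewrite !subrr normr0 mulr0].
  by rewrite distrC (distrC s); exact: H.
move=> st; have [|c _] := MVT st (fun x _ => fdf x).
  apply: continuous_subspaceT => x; apply: differentiable_continuous.
  by apply/derivable1_diffP; exact: ex_derive.
  by rewrite distrC => ->; rewrite normrM (distrC s) ler_wpM2r.
Qed.

Context (n : nat).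
Local Notation E := 'rV[R]_n.
Implicit Types (x y v : E) (f : E -> R) (g : E -> E).

Lemma is_derive_line f (g : E) x v (t : R) : hasgrad f (x + t *: v) g ->
  is_derive t 1 (fun s : R => f (x + s *: v)) (dotv g v).
Proof.
move=> fg.
have dl : is_diff t (fun s : R => x + s *: v) ( *:%R^~ v).
  have d1 : is_diff t (cst x) (0 : R -> E) by exact: is_diff_cst.
  have d2 : is_diff t (fun s : R => s *: v) ( *:%R^~ v) by exact: is_diff_scalel.
  have := is_diffD d1 d2; rewrite add0r; exact.
have d := is_diff_comp dl (hasgrad_diff fg).
apply: DeriveDef.
  by apply/derivable1_diffP; exact: ex_diff.
rewrite deriveE; last exact: ex_diff.
by rewrite diff_val /= scale1r.
Qed.

Lemma hasgrad_lipschitz f g (C : R) : (forall y, hasgrad f y (g y)) ->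
  (forall y i, `|g y 0 i| <= C) ->
  forall x y, `|f y - f x| <= n%:R * C * `|y - x|.
Proof.
move=> fg gC x y; have dl t := is_derive_line (v := y - x) (t := t) (fg (x + t *: (y - x))).
have := derive_lipschitz dl (C := n%:R * C * `|y - x|) _ 1 0.
have -> : x + 1 *: (y - x) = y by rewrite scale1r addrC subrK.
rewrite scale0r addr0 subr0 normr1 mulr1; apply=> t.
rewrite (le_trans (normr_dotv_le _ _))// ler_wpM2r//.
rewrite mulr_natl -[X in _ *+ X]card_ord -sumr_const.
by apply: ler_sum => i _; exact: gC.
Qed.

(** The mean value theorem replaces the increment by the gradient at an intermediate point, whose
    distance to [g x] is controlled by the second derivatives. Each factor n comes from pairing an
    l^1 bound on a gradient with the sup norm. *)
Lemma hasgrad_taylor f g (h : E -> 'I_n -> E) (C : R) :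
  (forall y, hasgrad f y (g y)) ->
  (forall i y, hasgrad (fun z => g z 0 i) y (h y i)) ->
  (forall y i j, `|h y i 0 j| <= C) ->
  forall x y, `|f y - f x - dotv (g x) (y - x)| <= n%:R * (n%:R * C) * `|y - x| ^+ 2.
Proof.
move=> fg gh hC x y.
have dl t := is_derive_line (v := y - x) (t := t) (fg (x + t *: (y - x))).
have [|c] := MVT ltr01 (fun t _ => dl t).
  apply: continuous_subspaceT => t; apply: differentiable_continuous.
  by apply/derivable1_diffP; exact: ex_derive.
rewrite in_itv/= => /andP[c0 c1].
have -> : x + 1 *: (y - x) = y by rewrite scale1r addrC subrK.
rewrite scale0r addr0 subr0 mulr1 => ->.
rewrite dotvC (dotvC (g x)) -dotvBr dotvC (le_trans (normr_dotv_le _ _))//.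
rewrite expr2 [leRHS]mulrA ler_wpM2r// -mulrA mulr_natl -[X in _ *+ X]card_ord -sumr_const.
apply: ler_sum => i _; rewrite !mxE.
rewrite (le_trans (hasgrad_lipschitz (gh i) (fun z => hC z i) x _))//.
rewrite ler_wpM2l//.
  by rewrite mulr_ge0// (le_trans (normr_ge0 _) (hC x i i)).
by rewrite addrC addKr normrZ ler_piMl// gtr0_norm ?ltW.
Qed.

End mean_value.

(** * A smooth approximation of the positive part *)

Section soft_plus.
Context (R : realType) (d : R) (d0 : 0 < d).

Lemma flat_bound (P : {poly R}) : exists2 C : R, 0 <= C & forall t, `|flat d P t| <= C.
Proof.
have [C C0 HC] := poly_expR_bound d0 P; exists C => // t.
rewrite /flat; case: ifPn => [t0|]; last by rewrite normr0.
have := HC _ (etrans (invr_gt0 t) t0).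
by rewrite normrM (ger0_norm (expR_ge0 _)).
Qed.

Lemma flat_lipschitz (P : {poly R}) : exists2 C : R, 0 <= C &
  forall s t, `|flat d P s - flat d P t| <= C * `|s - t|.
Proof.
have [C C0 HC] := flat_bound (dflat d P); exists C => //.
exact: derive_lipschitz (is_derive_flat d0 P) HC.
Qed.

(** For t > 0 this is t e^(-d/t), with derivative (1 + d/t) e^(-d/t). It is smooth, within d of
    max(t, 0), has slope in [0, 1] and is exactly 0 on t <= 0; the last property makes compositions
    with it compactly supported. *)
Definition soft t : R := t * flat d 1 t.
Definition dsoft t : R := flat d (1 + d *: 'X) t.

Lemma is_derive_soft (t : R) : is_derive t 1 soft (dsoft t).
Proof.
have := @is_deriveM R R^o id (flat d 1) t 1 _ _ (is_derive_id _ _) (is_derive_flat d0 1 t).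
move/is_derive_eq; apply.
rewrite /GRing.scale /= /dsoft /flat; case: ifPn => [t0|]; last by rewrite mulr0 mul0r addr0.
have -> : (dflat d (1 : {poly R})).[t^-1] = d * t ^- 2.
  by rewrite /dflat (_ : (1 : {poly R})^`() = 0) ?derivC// !hornerE exprVn; ring.
have tn0 : t != 0 by rewrite gt_eqF.
rewrite (hornerC 1) mul1r mulr1 hornerD (hornerC 1) hornerZ hornerX.
rewrite mulrA mulrDl mul1r addrC; congr (_ + _ * _).
by field.
Qed.

Lemma soft_le0 t : t <= 0 -> soft t = 0.
Proof. by move=> t0; rewrite /soft /flat ltNge t0 mulr0. Qed.

Lemma dsoft_le0 t : t <= 0 -> dsoft t = 0.
Proof. by move=> t0; rewrite /dsoft /flat ltNge t0. Qed.

Lemma dsoft_ge0 t : 0 <= dsoft t.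
Proof.
rewrite /dsoft /flat; case: ifPn => // t0; rewrite mulr_ge0 ?expR_ge0//.
by rewrite !hornerE addr_ge0// divr_ge0// ltW.
Qed.

(** This is 1 + d/t <= e^(d/t). *)
Lemma dsoft_le1 t : dsoft t <= 1.
Proof.
rewrite /dsoft /flat; case: ifPn => // t0; rewrite mulNr expRN.
rewrite ler_pdivrMr ?expR_gt0// mul1r !hornerE.
exact: expR_ge1Dx.
Qed.

(** For t > 0 the gap is t (1 - e^(-d/t)), and 1 - e^(-d/t) <= d/t. *)
Lemma soft_max t : `|Num.max t 0 - soft t| <= d.
Proof.
have [t0|t0] := leP t 0.
  by rewrite soft_le0// subrr normr0 ltW.
rewrite /soft /flat t0 (hornerC 1) mul1r -{1}(mulr1 t) -mulrBr normrM gtr0_norm//.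
have e1 : expR (- d / t) <= 1.
  by rewrite -expR0 ler_expR mulNr oppr_le0 divr_ge0// ltW.
rewrite ger0_norm ?subr_ge0//.
have := expR_ge1Dx (- d / t) => H.
apply: (@le_trans _ _ (t * (d / t))).
  by rewrite ler_wpM2l ?(ltW t0)// lerBlDr addrC -lerBlDr -mulNr.
by rewrite mulrCA divff ?gt_eqF// mulr1.
Qed.

Lemma soft_lipschitz s t : `|soft s - soft t| <= `|s - t|.
Proof.
rewrite -[leRHS]mul1r; apply: derive_lipschitz s t; first exact: is_derive_soft.
by move=> t; rewrite ger0_norm ?dsoft_ge0 ?dsoft_le1.
Qed.

(** Gives the pointwise convergence of [dsoft] to the indicator of t > 0 as d tends to 0. *)
Lemma dsoft_near1 t : 0 < t -> 1 - dsoft t <= d / t.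
Proof.
move=> t0; rewrite /dsoft /flat t0 !hornerE.
have := expR_ge1Dx (- d / t) => H.
have dt : 0 <= d / t by rewrite divr_ge0// ltW.
rewrite lerBlDr addrC -lerBlDr.
rewrite (@le_trans _ _ (expR (- d / t)))//; first by rewrite -mulNr.
by rewrite ler_peMl ?expR_ge0// lerDl.
Qed.

Context (n : nat).

Lemma smooth_flat (P : {poly R}) (w : 'rV[R]_n -> R) : smooth w ->
  smooth (fun x => flat d P (w x)).
Proof.
move=> /smoothP sw; apply/smoothP => k.
apply: (@diffn_comp _ _ (range (flat d)) k w _ (sw k) (flat d P)); last by exists P.
move=> _ [Q _ <-]; exists (flat d (dflat d Q)); first by exists (dflat d Q).
exact: is_derive_flat.
Qed.

Lemma smooth_soft (w : 'rV[R]_n -> R) : smooth w -> smooth (fun x => soft (w x)).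
Proof.
move=> sw; have sfw := smooth_flat 1 sw.
by apply/smoothP => k; apply: diffnM; [exact: (smoothP w).1|exact: (smoothP _).1].
Qed.

End soft_plus.

(** * Lebesgue measure on row vectors *)

Section continuity_rV.
Context (R : realType).

Lemma rV_continuous (T : topologicalType) n (F : T -> 'rV[R]_n) :
  (forall i, continuous (fun z => F z 0 i)) -> continuous F.
Proof.
move=> cF z; apply/cvgrPdist_le => e e0; near=> y.
apply: norm_le_coord; first exact: ltW.
near: y; apply: filter_forall => i.
have /cvgrPdist_le/(_ _ e0) := cF i z.
by apply: filterS => y; rewrite !mxE.
Unshelve. all: by end_near. Qed.

Lemma continuous_coord n i : continuous (fun x : 'rV[R]_n => x 0 i).
Proof. by move=> x; exact: coord_continuous. Qed.

Lemma measurable_coord n i : measurable_fun [set: 'rV[R]_n] (fun x : 'rV[R]_n => x 0 i).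
Proof. exact: measurable_rV_coord. Qed.

Lemma rV_measurable_fun d (T : measurableType d) n (F : T -> 'rV[R]_n) :
  (forall i, measurable_fun setT (fun z => F z 0 i)) -> measurable_fun setT F.
Proof. by move=> h; apply: measurable_fun_rV => i; exact: h. Qed.

Lemma continuous_rV_measurable n (D : set 'rV[R]_n) (f : 'rV[R]_n -> R) :
  continuous f -> measurable_fun D f.
Proof.
move=> /continuousP cf; apply: measurable_funTS; apply: (measurability _ (RGenOInfty.measurableE R)).
move=> _ [_ [a ->] <-]; rewrite setTI; apply: measurable_rV_open; apply: cf.
exact: interval_open.
Qed.

Lemma measurable_shift n (c : 'rV[R]_n) : measurable_fun setT (fun x : 'rV[R]_n => x + c).
Proof.
apply: rV_measurable_fun => i.
rewrite (_ : (fun _ => _) = (fun x : 'rV[R]_n => x 0 i + c 0 i)).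
  by apply: measurable_funD => //; exact: measurable_coord.
by apply/funext => x; rewrite mxE.
Qed.

Lemma measurable_oppv n : measurable_fun setT (fun x : 'rV[R]_n => - x).
Proof.
apply: rV_measurable_fun => i.
rewrite (_ : (fun _ => _) = (fun x : 'rV[R]_n => - x 0 i)).
  by apply: measurable_funN; exact: measurable_coord.
by apply/funext => x; rewrite mxE.
Qed.

End continuity_rV.

Section lebesgue_rV_theory.
Context (R : realType).
Local Notation leb := (@lebesgue_measure R).

(** In dimension n + 1 the measure is by construction the image of a product measure, so Tonelli's
    theorem transports; this drives the inductions on the dimension. *)
Lemma ge0_integral_step n (f : 'rV[R]_n.+1 -> \bar R) :
  measurable_fun setT f -> (forall x, 0 <= f x)%E ->
  (\int[lebesgue_rV R n.+1]_x f x =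
   \int[leb]_t \int[lebesgue_rV R n]_y f (rV_cons (t, y)))%E.
Proof.
move=> mf f0.
transitivity (\int[leb \x lebesgue_rV R n]_z (f \o @rV_cons R n) z)%E.
  have := @ge0_integral_pushforward _ _ _ _ R _ (@measurable_rV_cons R n)
    (leb \x lebesgue_rV R n)%E setT f measurableT mf (fun x _ => f0 x).
  by rewrite preimage_setT => <-.
have mfc : measurable_fun setT (f \o @rV_cons R n).
  by apply: measurableT_comp => //; exact: measurable_rV_cons.
exact: (fubini_tonelli1 (f \o @rV_cons R n) mfc (fun z => f0 (rV_cons z))).
Qed.

Lemma measurable_shift1 (c : R) :
  measurable_fun setT (fun x : measurableTypeR R => (x + c : measurableTypeR R)).
Proof.
have : measurable_fun setT (fun x : R => x + c).
  by apply: measurable_funD => //; exact: measurable_id.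
exact.
Qed.

(** Lebesgue measure is determined by its values on half-open intervals, and these are preserved by
    translation. *)
Lemma ge0_integral_shift1 (c : R) (f : R -> \bar R) : measurable_fun setT f ->
  (forall x, 0 <= f x)%E -> (\int[leb]_x f (x + c)%R = \int[leb]_x f x)%E.
Proof.
move=> mf f0.
pose phi : measurableTypeR R -> measurableTypeR R := fun x => x + c.
have mphi : measurable_fun setT phi by exact: measurable_shift1.
pose phi_mixin := isMeasurableFun.Build _ _ _ _ phi mphi.
pose phi_mfun : {mfun measurableTypeR R >-> measurableTypeR R} :=
  HB.pack phi phi_mixin.
have shiftE A : measurable A -> leb A = pushforward leb phi_mfun A.
  apply: lebesgue_measure_unique => //= _ [[a b]] _ <-.
  rewrite /pushforward.
  have -> : phi @^-1` `]a, b]%classic = `]a - c, b - c]%classic.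
    by apply/seteqP; split=> x /=; rewrite !in_itv/= ltrBlDr lerBrDr.
  rewrite !lebesgue_measure_itv/= !lte_fin ltrD2r.
  by rewrite -!EFinB opprB addrA subrK.
have := @ge0_integral_pushforward _ _ _ _ R _ mphi leb setT f measurableT mf (fun x _ => f0 x).
rewrite preimage_setT => <-.
by apply: eq_measure_integral => A mA _; exact/esym/shiftE.
Qed.

Lemma ge0_integral_shift n (c : 'rV[R]_n) (f : 'rV[R]_n -> \bar R) :
  measurable_fun setT f -> (forall x, 0 <= f x)%E ->
  (\int[lebesgue_rV R n]_x f (x + c)%R = \int[lebesgue_rV R n]_x f x)%E.
Proof.
elim: n c f => [|n IH] c f mf f0.
  by apply: eq_integral => x _; congr f; apply/rowP => -[].
have ms : measurable_fun setT (fun x : 'rV[R]_n.+1 => f (x + c)).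
  by apply: measurableT_comp => //; exact: measurable_shift.
rewrite (ge0_integral_step mf f0) (ge0_integral_step ms (fun x => f0 (x + c))).
pose c' : 'rV[R]_n := \row_j c 0 (lift ord0 j).
have mfc : measurable_fun setT (f \o @rV_cons R n).
  by apply: measurableT_comp => //; exact: measurable_rV_cons.
have consD t y : rV_cons (t, y) + c = rV_cons (t + c 0 ord0, y + c').
  apply/rowP => i; rewrite !mxE /=.
  by case: (unliftP ord0 i) => [j|] -> //; rewrite !mxE.
transitivity (\int[leb]_t \int[lebesgue_rV R n]_y f (rV_cons ((t + c 0 ord0)%R, y)))%E.
  apply: eq_integral => t _; under eq_integral do rewrite consD.
  rewrite (IH c' (fun y => f (rV_cons (t + c 0 ord0, y))))//.
  exact: (measurableT_comp mfc (measurable_pair1 _)).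
apply: (@ge0_integral_shift1 (c 0 ord0) (fun t => \int[lebesgue_rV R n]_y f (rV_cons (t, y)))%E).
  exact: (measurable_fun_fubini_tonelli_F (f \o @rV_cons R n) mfc (fun z => f0 _)).
by move=> t; apply: integral_ge0.
Qed.

(** Evenness of f stands in for reflection invariance of the measure: f (c - x) = f (x - c), and a
    translation remains. *)
Lemma ge0_integral_shiftN n (c : 'rV[R]_n) (f : 'rV[R]_n -> \bar R) :
  measurable_fun setT f -> (forall x, 0 <= f x)%E -> (forall x, f (- x) = f x) ->
  (\int[lebesgue_rV R n]_x f (c - x)%R = \int[lebesgue_rV R n]_x f x)%E.
Proof.
move=> mf f0 fN; rewrite -(ge0_integral_shift c)//; last first.
  apply: measurableT_comp => //.
  by have := measurableT_comp (@measurable_shift R n c) (@measurable_oppv R n); under eq_fun do rewrite /= addrC.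
  by apply: eq_integral => x _; rewrite -fN opprB addrK.
Qed.

Lemma compact_rV_measurable n (C : set 'rV[R]_n) : compact C -> measurable C.
Proof.
move=> cC; rewrite -[C]setCK; apply: measurableC; apply: measurable_rV_open.
by rewrite openC; apply: compact_closed => //; exact: norm_hausdorff.
Qed.

Lemma closure_sub_compact n (A C : set 'rV[R]_n) : compact C -> A `<=` C ->
  compact (closure A) /\ closure A `<=` C.
Proof.
move=> cC AC; have clC : closure A `<=` C.
  rewrite [X in _ `<=` X](closure_id _).1; first exact: closureS.
  by apply: compact_closed => //; exact: norm_hausdorff.
by split=> //; apply: subclosed_compact cC clC; exact: closed_closure.
Qed.

(** Continuity is asked in the whole space at the points of K, which is what [C1_on] delivers for a
    function whose values far from K are arbitrary. *)
Lemma continuous_at_bounded n (K : set 'rV[R]_n) (g : 'rV[R]_n -> R) :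
  compact K -> (forall x, K x -> {for x, continuous g}) ->
  exists2 C : R, 0 <= C & forall x, K x -> `|g x| <= C.
Proof.
move=> cK cg.
have wcg : {within K, continuous g} by apply: continuous_in_subspaceT => x /set_mem; exact: cg.
have /compact_bounded[C [Cr HC]] := continuous_compact wcg cK.
exists (`|C| + 1); first by rewrite addr_ge0.
move=> x Kx; apply: HC; last by exists x.
by rewrite (le_lt_trans (ler_norm _))// ltrDl.
Qed.

Lemma cball_box n (x : 'rV[R]_n) (r : R) : 0 <= r ->
  [set y | `|x - y| <= r] =
  \bigcap_(i in [set: 'I_n]) (@rV_coord R n i @^-1` `[x 0 i - r, x 0 i + r]).
Proof.
move=> r0; apply/seteqP; split=> y /=.
  move=> xy i _; rewrite /rV_coord /= in_itv/= -ler_distlC.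
  by apply: le_trans xy; have := coord_le_norm (x - y) i; rewrite !mxE.
move=> H; apply: norm_le_coord => // i; have := H i I.
by rewrite /rV_coord/= in_itv/= !mxE ler_distlC.
Qed.

Lemma lebesgue_cball n (x : 'rV[R]_n) (r : R) : 0 <= r ->
  lebesgue_rV R n [set y | `|x - y| <= r] = ((2 * r) ^+ n)%:E.
Proof.
move=> r0; rewrite cball_box//.
pose a : 'rV[R]_n := \row_i (x 0 i - r); pose b : 'rV[R]_n := \row_i (x 0 i + r).
have aE i : x 0 i - r = a 0 i by rewrite mxE.
have bE i : x 0 i + r = b 0 i by rewrite mxE.
under eq_bigcapr do rewrite aE bE.
rewrite lebesgue_rV_box => [|i]; last by rewrite !mxE; lra.
congr EFin; transitivity (\prod_(i < n) (2 * r)).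
  by apply: eq_bigr => i _; rewrite !mxE; ring.
by rewrite prodr_const card_ord.
Qed.

Lemma measurable_cball n (x : 'rV[R]_n) (r : R) : measurable [set y | `|x - y| <= r].
Proof.
have [r0|r0] := leP 0 r; last first.
  rewrite (_ : mkset _ = set0)//; apply/seteqP; split=> // y /= xy.
  by have := le_lt_trans (le_trans (normr_ge0 _) xy) r0; rewrite ltxx.
rewrite cball_box//; apply: fin_bigcap_measurable => // i _.
by rewrite -[X in measurable X]setTI; apply: measurable_rV_coord => //.
Qed.

Lemma compact_cball n (x : 'rV[R]_n) (r : R) : compact [set y | `|x - y| <= r].
Proof.
have [r0|r0] := leP 0 r; last first.
  rewrite (_ : mkset _ = set0); first exact: compact0.
  apply/seteqP; split=> // y /= xy.
  by have := le_lt_trans (le_trans (normr_ge0 _) xy) r0; rewrite ltxx.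
have -> : [set y : 'rV[R]_n | `|x - y| <= r] =
    [set v | forall i, `[x 0 i - r, x 0 i + r]%classic (v ord0 i)].
  by rewrite cball_box//; apply/seteqP; split=> y h i => [|_]; exact: h.
apply: (@rV_compact R n (fun i => `[x 0 i - r, x 0 i + r]%classic)) => i.
exact: segment_compact.
Qed.

Lemma lebesgue_ball_lty n (x : 'rV[R]_n) (r : R) : (lebesgue_rV R n (ball x r) < +oo)%E.
Proof.
have [r0|r0] := leP 0 r; last first.
  rewrite (_ : ball _ _ = set0) ?measure0 ?ltry//; apply/seteqP; split=> // y.
  by rewrite -ball_normE/= => /(le_lt_trans (normr_ge0 _))/lt_trans/(_ r0); rewrite ltxx.
apply: (@le_lt_trans _ _ (lebesgue_rV R n [set y | `|x - y| <= r])).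
  apply: le_measure; rewrite ?inE.
  - by apply: measurable_rV_open; exact: ball_open.
  - exact: measurable_cball.
  - by move=> y; rewrite -ball_normE/= => /ltW.
by rewrite lebesgue_cball// ltry.
Qed.

Lemma integral_derive0_1 (h dh : R -> R) (M : R) :
  (forall t : R, is_derive t 1 h (dh t)) -> continuous dh ->
  (forall t : R, M <= `|t| -> h t = 0 /\ dh t = 0) ->
  (\int[leb]_t (dh t)%:E = 0)%E.
Proof.
move=> dhh cdh h0.
pose N : R := `|M| + 1; have N0 : 0 < N by rewrite ltr_wpDl.
have NM : M <= N by rewrite (le_trans (ler_norm _))// lerDl.
have hc : continuous h.
  by move=> x; apply: differentiable_continuous; apply/derivable1_diffP; exact: ex_derive.
have -> : (\int[leb]_t (dh t)%:E = \int[leb]_(t in `[(- N)%R, N]) (dh t)%:E)%E.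
  rewrite [in RHS]integral_mkcond; apply: eq_integral => t _.
  rewrite patchE; case: ifPn => //; rewrite notin_setE /= in_itv/= => /negP.
  rewrite -ler_norml -ltNge => /ltW Nt.
  by rewrite (h0 t (le_trans NM Nt)).2.
have NN : - N < N by rewrite (@lt_trans _ _ 0)// oppr_lt0.
rewrite (continuous_FTC2 (F := h) NN).
- have hN t : N <= `|t| -> h t = 0 by move=> Nt; have [] := h0 t (le_trans NM Nt).
  by rewrite !hN ?normrN ?gtr0_norm// subee.
- exact: continuous_subspaceT.
- split => //; last 2 first.
  + by apply: cvg_at_right_filter; exact: hc.
  + by apply: cvg_at_left_filter; exact: hc.
- by move=> t _; rewrite derive1E; exact: derive_val.
Qed.

Lemma rV_cons0 n (z : measurableTypeR R * 'rV[R]_n) : rV_cons z 0 ord0 = z.1.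
Proof. by rewrite mxE unlift_none. Qed.

Lemma rV_consS n (z : measurableTypeR R * 'rV[R]_n) j :
  rV_cons z 0 (lift ord0 j) = z.2 0 j.
Proof. by rewrite mxE liftK. Qed.

Lemma rV_consr_continuous n (t : R) : continuous (fun y : 'rV[R]_n => rV_cons (t, y)).
Proof.
apply: rV_continuous => i.
rewrite (_ : (fun _ => _) = (fun y : 'rV[R]_n => if unlift ord0 i is Some j then y 0 j else t)).
  case: unlift => [j|] /=; first exact: continuous_coord.
  exact: cst_continuous.
by apply/funext => y; rewrite mxE.
Qed.

Lemma rV_consl_continuous n (y : 'rV[R]_n) : continuous (fun t : R => rV_cons (t, y)).
Proof.
apply: rV_continuous => i.
rewrite (_ : (fun _ => _) = (fun t : R => if unlift ord0 i is Some j then y 0 j else t)).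
  by case: unlift => [j|] t; [exact: cvg_cst|exact: cvg_id].
by apply/funext => t; rewrite mxE.
Qed.

Lemma norm_rV_cons_ge n (t : R) (y : 'rV[R]_n) :
  `|t| <= `|rV_cons (t, y)| /\ `|y| <= `|rV_cons (t, y)|.
Proof.
split.
  by have := coord_le_norm (rV_cons (t, y)) ord0; rewrite !mxE unlift_none.
apply: norm_le_coord => // i.
by have := coord_le_norm (rV_cons (t, y)) (lift ord0 i); rewrite !mxE liftK.
Qed.

Lemma compact_supp_integrable n (f : 'rV[R]_n -> R) (M : R) : continuous f ->
  (forall x, M <= `|x| -> f x = 0) ->
  (lebesgue_rV R n).-integrable setT (EFin \o f).
Proof.
move=> cf f0; pose B := [set y : 'rV[R]_n | `|0 - y| <= `|M| + 1].
have mB : measurable B by exact: measurable_cball.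
have fE : f = f \_ B.
  apply/funext => x; rewrite patchE; case: ifPn => //; rewrite notin_setE /B /= sub0r normrN.
  move=> /negP; rewrite -ltNge => /ltW Mx; apply: f0; apply: le_trans Mx.
  by rewrite (le_trans (ler_norm _))// lerDl.
rewrite fE -restrict_EFin; apply/(integrable_mkcond _ mB).
apply: measurable_bounded_integrable => //.
- apply: (@le_lt_trans _ _ ((2 * (`|M| + 1)) ^+ n)%:E); last exact: ltry.
  rewrite le_eqVlt; apply/orP; left; apply/eqP.
  by apply: lebesgue_cball; rewrite addr_ge0.
- exact: continuous_rV_measurable.
- have [N N0 HN] := continuous_at_bounded (@compact_cball n 0 (`|M| + 1)) (fun x _ => cf x).
  by exists N; split; [exact: num_real|move=> y Ny x Bx; exact: le_trans (HN x Bx) (ltW Ny)].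
Qed.

(** By Fubini the variable of differentiation is integrated first. If it is the leading coordinate,
    the fundamental theorem of calculus has no boundary terms; otherwise each slice is covered by
    the induction hypothesis. *)
Lemma integral_derive0 n (i : 'I_n) (h dh : 'rV[R]_n -> R) (M : R) :
  (forall x, is_derive x (evec R i) h (dh x)) -> continuous dh ->
  (forall x, M <= `|x| -> h x = 0 /\ dh x = 0) ->
  (\int[lebesgue_rV R n]_x (dh x)%:E = 0)%E.
Proof.
elim: n i h dh => [|n IH] i h dh dhh cdh h0; first by case: i dhh.
have idh : (lebesgue_rV R n.+1).-integrable setT (EFin \o dh).
  by apply: (@compact_supp_integrable _ _ M) => // x /h0[].
have mcons := @measurable_rV_cons R n.
have mdh : measurable_fun setT (EFin \o dh) by exact: measurable_int idh.
have mdc : measurable_fun setT ((EFin \o dh) \o @rV_cons R n).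
  exact: measurableT_comp.
have idc : (leb \x lebesgue_rV R n)%E.-integrable setT ((EFin \o dh) \o @rV_cons R n).
  apply/integrableP; split => //.
  have /integrableP[_] := idh.
  rewrite ge0_integral_step//; last exact: measurableT_comp.
  rewrite fubini_tonelli1//; last exact: measurableT_comp.
have -> : (\int[lebesgue_rV R n.+1]_x (dh x)%:E =
    \int[leb \x lebesgue_rV R n]_z ((EFin \o dh) \o @rV_cons R n) z)%E.
  have := @integral_pushforward _ _ _ _ R _ mcons (leb \x lebesgue_rV R n)%E setT _ mdh _ measurableT.
  by rewrite preimage_setT => <-.
case: (unliftP ord0 i) dhh => [j|] -> dhh.
  rewrite -integral12_prod_meas1//.
  apply: integral0_eq => t _; rewrite /fubini_F /=.
  apply: (IH j (fun y => h (rV_cons (t, y)))).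
  - move=> y; have E (s : R) : rV_cons (t, s *: evec R j + y) =
        s *: evec R (lift ord0 j) + rV_cons (t, y).
      apply/rowP => k; rewrite [RHS]mxE.
      case: (unliftP ord0 k) => [k'|] ->; rewrite ?rV_consS ?rV_cons0 !mxE eqxx.
        by rewrite (inj_eq lift_inj).
      by rewrite (negbTE (neq_lift _ _)) mulr0 add0r.
    have := dhh (rV_cons (t, y)) => -[H1 H2].
    have DE : (fun s : R => s^-1 *: (((fun y0 => h (rV_cons (t, y0))) \o shift y) (s *: evec R j) - h (rV_cons (t, y)))) =
      (fun s : R => s^-1 *: ((h \o shift (rV_cons (t, y))) (s *: evec R (lift ord0 j)) - h (rV_cons (t, y)))).
      by apply/funext => s /=; rewrite E.
    by apply: DeriveDef; [rewrite /derivable DE|rewrite /derive DE].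
  - move=> y; apply: (@continuous_comp _ _ _ (fun y : 'rV[R]_n => rV_cons (t, y)) dh).
      exact: rV_consr_continuous.
    exact: cdh.
  - by move=> y My; apply: h0; rewrite (le_trans My)// (norm_rV_cons_ge t y).2.
rewrite -integral21_prod_meas1//.
apply: integral0_eq => y _; rewrite /fubini_G /=.
have E (s t : R) : rV_cons (s + t, y) = s *: evec R ord0 + rV_cons (t, y).
  apply/rowP => k; rewrite [RHS]mxE.
  case: (unliftP ord0 k) => [k'|] ->; rewrite ?rV_consS ?rV_cons0 !mxE eqxx.
    by rewrite eq_sym (negbTE (neq_lift _ _)) mulr0 add0r.
  by rewrite mulr1.
apply: (@integral_derive0_1 (fun t => h (rV_cons (t, y))) _ M).
- move=> t; have := dhh (rV_cons (t, y)) => -[H1 H2].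
  have DE : (fun s : R => s^-1 *: (((fun y0 : R => h (rV_cons (y0, y))) \o shift t) (s *: 1) - h (rV_cons (t, y)))) =
      (fun s : R => s^-1 *: ((h \o shift (rV_cons (t, y))) (s *: evec R ord0) - h (rV_cons (t, y)))).
    by apply/funext => s /=; rewrite [s *: 1]mulr1 E.
  by apply: DeriveDef; [rewrite /derivable DE|rewrite /derive DE].
- move=> t; apply: (@continuous_comp _ _ _ (fun t : R => rV_cons (t, y)) dh).
    exact: rV_consl_continuous.
  exact: cdh.
- by move=> t Mt; apply: h0; rewrite (le_trans Mt)// (norm_rV_cons_ge t y).1.
Qed.

End lebesgue_rV_theory.

Section continuous_functions.
Context (R : realType) (n : nat).
Local Notation E := 'rV[R]_n.
Implicit Types (f g : E -> R).

Lemma continuous_fD f g : continuous f -> continuous g ->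
  continuous (fun x => f x + g x).
Proof. by move=> cf cg x; exact: (@cvgD _ _ _ _ (nbhs_filter x) f g _ _ (cf x) (cg x)). Qed.

Lemma continuous_fM f g : continuous f -> continuous g ->
  continuous (fun x => f x * g x).
Proof. by move=> cf cg x; exact: (@cvgM _ _ _ (nbhs_filter x) f g _ _ (cf x) (cg x)). Qed.

Lemma continuous_fcst (c : R) : continuous (fun _ : E => c).
Proof. exact: cst_continuous. Qed.

Lemma continuous_fZ (c : R) f : continuous f -> continuous (fun x => c * f x).
Proof. by move=> cf x; exact: (@cvgM _ _ _ (nbhs_filter x) (fun=> c) f _ _ (cvg_cst c) (cf x)). Qed.

Lemma continuous_fN f : continuous f -> continuous (fun x => - f x).
Proof. by move=> cf x; exact: (@cvgN _ _ _ _ (nbhs_filter x) f _ (cf x)). Qed.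

Lemma continuous_fB f g : continuous f -> continuous g ->
  continuous (fun x => f x - g x).
Proof. by move=> cf cg; exact: (continuous_fD cf (continuous_fN cg)). Qed.

Lemma continuous_comp1 (b : R -> R) f : continuous b -> continuous f ->
  continuous (fun x => b (f x)).
Proof. by move=> cb cf x; exact: (@continuous_comp _ _ _ f b x (cf x) (cb _)). Qed.

Lemma continuous_at_fsum (I : Type) (s : seq I) (F : I -> E -> R) x :
  (forall i, {for x, continuous (F i)}) -> {for x, continuous (fun y => \sum_(i <- s) F i y)}.
Proof.
move=> cF; elim: s => [|i s IH].
  by rewrite (_ : (fun _ => _) = cst 0); [exact: cst_continuous|
    apply/funext => y; rewrite big_nil].
rewrite (_ : (fun _ => _) = (fun y => F i y + \sum_(j <- s) F j y)).
  by apply: continuousD; [exact: cF|exact: IH].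
by apply/funext => y; rewrite big_cons.
Qed.

Lemma continuous_fprod (I : Type) (s : seq I) (F : I -> E -> R) :
  (forall i, continuous (F i)) -> continuous (fun x => \prod_(i <- s) F i x).
Proof.
move=> cF; elim: s => [|i s IH].
  by rewrite (_ : (fun _ => _) = (fun _ => 1)); [exact: continuous_fcst|
    apply/funext => x; rewrite big_nil].
rewrite (_ : (fun _ => _) = (fun x => F i x * \prod_(j <- s) F j x)).
  exact: continuous_fM.
by apply/funext => x; rewrite big_cons.
Qed.

Lemma integrable_bounded (D : set E) f (C : R) : measurable D ->
  (lebesgue_rV R n D < +oo)%E -> measurable_fun D f ->
  (forall x, D x -> `|f x| <= C) -> (lebesgue_rV R n).-integrable D (EFin \o f).
Proof.
move=> mD Doo mf fC; apply: measurable_bounded_integrable => //.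
exists C; split; first exact: num_real.
by move=> M CM x Dx /=; rewrite (le_trans (fC x Dx))// ltW.
Qed.

End continuous_functions.

(** * Density of continuous functions in L^1 *)

Import HBSimple.

Section density.
Context (R : realType) (n : nat).
Local Notation E := 'rV[R]_n.
Local Notation mu := (lebesgue_rV R n).
Context (K : set E) (mK : measurable K) (Koo : (mu K < +oo)%E).
Implicit Types (f g h : E -> R).

Definition L1dist f g : \bar R := (\int[mu]_(x in K) `|f x - g x|%:E)%E.

Lemma measurable_L1dist f g : measurable_fun K f -> measurable_fun K g ->
  measurable_fun K (fun x => `|f x - g x|%:E).
Proof.
move=> mf mg; apply/measurable_EFinP; apply: measurableT_comp => //.
exact: measurable_funB.
Qed.

Lemma L1dist_triangle f g h : measurable_fun K f -> measurable_fun K g ->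
  measurable_fun K h -> (L1dist f h <= L1dist f g + L1dist g h)%E.
Proof.
move=> mf mg mh; rewrite /L1dist -ge0_integralD//; do ?exact: measurable_L1dist.
apply: ge0_le_integral => //; do ?exact: measurable_L1dist.
  by apply: emeasurable_funD; exact: measurable_L1dist.
by move=> x _; rewrite -EFinD lee_fin ler_distD.
Qed.

Lemma L1dist_cvg f (F : nat -> E -> R) : measurable_fun K f ->
  (forall k, measurable_fun K (F k)) -> (forall k x, `|F k x| <= 1) ->
  (forall x, K x -> F^~ x @ \oo --> f x) ->
  (fun k => L1dist f (F k)) @ \oo --> 0%E.
Proof.
move=> mf mF F1 Ff.
have := @dominated_convergence _ _ _ mu K mK (fun k => EFin \o F k) (EFin \o f) (cst 1%E).
case.
- by move=> k; exact/measurable_EFinP.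
- exact/measurable_EFinP.
- by apply/aeW => x Kx /=; apply: cvg_EFin; [exact: nearW|exact: Ff].
- apply: (@integrable_bounded R n K (cst 1) 1) => // x _ /=.
  by rewrite normr1.
- by apply/aeW => x k _; rewrite /= lee_fin.
move=> _ H _.
have E : (fun k => L1dist f (F k)) =
    (fun k => (\int[mu]_(x in K) `|(EFin \o F k) x - (EFin \o f) x|)%E).
  by apply/funext => k; apply: eq_integral => x _; rewrite /= distrC.
by rewrite E.
Qed.

(** The functions approximable in L^1(K) by functions continuous on the whole space. This class is
    linear and closed under L^1 limits, so it is enough to reach indicators of measurable sets. *)
Definition capx f := measurable_fun K f /\
  forall e : R, 0 < e -> exists2 g, continuous g & (L1dist f g < e%:E)%E.

Lemma cont_measurable g : continuous g -> measurable_fun K g.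
Proof. exact: continuous_rV_measurable. Qed.

Lemma capx_lim f : measurable_fun K f ->
  (forall e : R, 0 < e -> exists2 h, capx h & (L1dist f h < e%:E)%E) -> capx f.
Proof.
move=> mf H; split=> // e e0; have e20 : 0 < e / 2 by rewrite divr_gt0.
have [h [mh /(_ _ e20)[g cg hg]] fh] := H _ e20.
exists g => //; apply: le_lt_trans (L1dist_triangle mf mh (cont_measurable cg)) _.
by rewrite (splitr e) EFinD lteD.
Qed.

Lemma capx_cvg f (F : nat -> E -> R) : measurable_fun K f ->
  (forall k, capx (F k)) -> (fun k => L1dist f (F k)) @ \oo --> 0%E -> capx f.
Proof.
move=> mf cF FL; apply: capx_lim => // e e0.
have /fine_cvgP[fin] := FL.
move=> /cvgrPdist_lt/(_ _ e0) H.
near \oo => k; exists (F k) => //.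
have fk : L1dist f (F k) \is a fin_num by near: k.
rewrite -(fineK fk) lte_fin.
have : `|0 - fine (L1dist f (F k))| < e by near: k.
by rewrite sub0r normrN; apply: le_lt_trans; exact: ler_norm.
Unshelve. all: by end_near. Qed.

Lemma capx_cont f : continuous f -> capx f.
Proof.
move=> cf; split; first exact: cont_measurable.
move=> e e0; exists f => //; rewrite /L1dist integral0_eq ?lte_fin// => x _.
by rewrite subrr normr0.
Qed.

Lemma capxZ f (c : R) : capx f -> capx (fun x => c * f x).
Proof.
move=> [mf cf]; split; first exact: measurable_funM.
move=> e e0; have c0 : 0 < 1 + `|c| by rewrite ltr_pwDl.
have [g cg fg] := cf (e / (1 + `|c|)) (divr_gt0 e0 c0).
exists (fun x => c * g x); first exact: continuous_fZ.
have mfg := measurable_L1dist mf (cont_measurable cg).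
apply: (@le_lt_trans _ _ (\int[mu]_(x in K) ((1 + `|c|)%:E * `|f x - g x|%:E))%E).
  apply: ge0_le_integral => //.
  - apply: measurable_L1dist; apply: measurable_funM => //.
    exact: cont_measurable.
  - by apply: emeasurable_funM.
  - move=> x _; rewrite -EFinM lee_fin -mulrBr normrM ler_wpM2r//.
    by rewrite lerDr.
rewrite ge0_integralZl//.
apply: (@lt_le_trans _ _ ((1 + `|c|)%:E * (e / (1 + `|c|))%:E)%E).
  by rewrite lte_pmul2l.
by rewrite -EFinM mulrCA divff ?mulr1// gt_eqF.
Qed.

Lemma capxD f h : capx f -> capx h -> capx (fun x => f x + h x).
Proof.
move=> [mf cf] [mh ch]; split; first exact: measurable_funD.
move=> e e0; have e20 : 0 < e / 2 by rewrite divr_gt0.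
have [f' cf' ff'] := cf _ e20; have [h' ch' hh'] := ch _ e20.
have mf' := cont_measurable cf'; have mh' := cont_measurable ch'.
exists (fun x => f' x + h' x); first exact: continuous_fD.
apply: (@le_lt_trans _ _ (L1dist f f' + L1dist h h')%E).
  rewrite /L1dist -ge0_integralD//; do ?exact: measurable_L1dist.
  apply: ge0_le_integral => //.
  - by apply: measurable_L1dist; exact: measurable_funD.
  - by apply: emeasurable_funD; exact: measurable_L1dist.
  - by move=> x _; rewrite -EFinD lee_fin opprD addrACA ler_normD.
by rewrite (splitr e) EFinD lteD.
Qed.

Lemma capx_ext f h : f =1 h -> capx f -> capx h.
Proof. by move=> /funext ->. Qed.

Lemma capx_sum (I : Type) (s : seq I) (F : I -> E -> R) :
  (forall i, capx (F i)) -> capx (fun x => \sum_(i <- s) F i x).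
Proof.
move=> cF; elim: s => [|i s IH].
  apply: capx_ext (capx_cont (@cst_continuous _ _ (0 : R))) => x.
  by rewrite big_nil.
by apply: capx_ext (capxD (cF i) IH) => x; rewrite big_cons.
Qed.

(** A system of generators that is stable under intersection, as Dynkin's theorem requires, and
    whose indicators are products of one-variable indicators. *)
Definition orthants : set (set E) :=
  [set A | exists a : E, A = [set x : E | forall i, a 0 i < x 0 i]].

Lemma orthants_open : orthants `<=` open.
Proof.
move=> _ [a ->]; rewrite openE => x ax.
have H i : \forall y \near (x : E), a 0 i < (y : E) 0 i.
  by have := @continuous_coord R n i x; move=> /(_ _ (lt_nbhsr (ax i))).
have := @filter_forall _ _ _ _ (nbhs_filter (x : E)) H.
by [].
Qed.

Lemma orthants_setI : setI_closed orthants.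
Proof.
move=> _ _ [a ->] [b ->]; exists (\row_i Num.max (a 0 i) (b 0 i)).
apply/seteqP; split=> x /=; first by move=> [ax bx] i; rewrite mxE gt_max ax bx.
by move=> abx; split=> i; have := abx i; rewrite mxE gt_max => /andP[].
Qed.

Lemma measurable_orthants : @measurable _ E = <<s orthants >>.
Proof.
apply/seteqP; split; last first.
  apply: smallest_sub; first exact: sigma_algebra_measurable.
  by move=> A /orthants_open; exact: measurable_rV_open.
pose T := g_sigma_algebraType orthants.
have : measurable_fun [set: T] (fun x : T => (x : E)).
  apply: measurable_fun_rV => i; apply: (measurability _ (RGenOInfty.measurableE R)).
  move=> _ [_ [a ->] <-]; rewrite setTI.
  (* A half space in one coordinate is the union of the orthants whose other corner coordinates
     equal -m. *)
  rewrite (_ : _ @^-1` _ = \bigcup_(m : nat) [set x : E | forall j,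
      (\row_j (if j == i then a else - m%:R)) 0 j < x 0 j]).
    apply: bigcupT_measurable => m; apply: sub_sigma_algebra.
    by exists (\row_j (if j == i then a else - m%:R)).
  apply/seteqP; split=> x /=.
    rewrite /rV_coord /= in_itv/= andbT => ax.
    have [m Hm] : exists m : nat, `|x| < m%:R.
      by exists (Num.truncn `|x|).+1; exact: truncnS_gt.
    exists m => // j /=; rewrite mxE; case: eqP => [->//|_].
    have := le_lt_trans (coord_le_norm x j) Hm.
    by rewrite ltr_norml => /andP[].
  move=> [m _ /(_ i)]; rewrite mxE eqxx /rV_coord /= in_itv/= andbT//.
by move=> mid A mA; have := mid measurableT A mA; rewrite setTI.
Qed.

(** The ramps min(1, max(0, k t)) tend to the indicator of t > 0; their products over the
    coordinates are continuous, bounded by 1 and tend to the indicator of the orthant. *)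
Lemma capx_orthant A : orthants A -> capx (\1_A).
Proof.
move=> oA; have mA : measurable A by apply: measurable_rV_open; exact: orthants_open.
have [a Aa] := oA.
pose c (k : nat) (t : R) : R := Num.min 1 (Num.max 0 (k%:R * t)).
pose F (k : nat) (x : E) : R := \prod_i c k (x 0 i - a 0 i).
have c01 k t : 0 <= c k t <= 1.
  by rewrite /c le_min ler01 le_max lexx ge_min lexx.
have F01 k x : `|F k x| <= 1.
  rewrite /F normr_prod; apply: prodr_ile1 => i _.
  by rewrite normr_ge0/=; have /andP[? ?] := c01 k (x 0 i - a 0 i); rewrite ger0_norm.
have cF k : continuous (F k).
  apply: continuous_fprod => i.
  apply: (@continuous_comp1 _ _ (c k)); last first.
    by apply: continuous_fB; [exact: continuous_coord|exact: continuous_fcst].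
  move=> t; apply: (@continuous_min _ _ (fun=> 1) (fun t : R => Num.max 0 (k%:R * t))).
    exact: cvg_cst.
  apply: (@continuous_max _ _ (fun=> 0) (fun t : R => k%:R * t)); first exact: cvg_cst.
  by apply: cvgM; [exact: cvg_cst|exact: cvg_id].
apply: (@capx_cvg _ F).
- by apply: measurable_funTS; exact/measurable_indicP.
- by move=> k; exact: capx_cont.
- apply: L1dist_cvg => //.
  + by move=> k; exact: cont_measurable.
move=> x _; rewrite indicE; case: (boolP (x \in A)).
  rewrite inE Aa /= => ax; apply: cvg_near_cst; near=> k.
  rewrite /F big1// => i _; rewrite /c; apply/min_idPl.
  rewrite le_max; apply/orP; right; rewrite -ler_pdivrMr ?subr_gt0// div1r.
  by move: (i); near: k; apply: filter_forall => j; exact: nbhs_infty_ger.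
rewrite notin_setE Aa /= => /existsNP[i /negP]; rewrite -leNgt => xa.
apply: cvg_near_cst; apply: nearW => k; rewrite /F (bigD1 i)//= /c.
have -> : Num.max 0 (k%:R * (x 0 i - a 0 i)) = 0.
  by apply/max_idPl; rewrite mulr_ge0_le0// subr_le0.
by rewrite min_r ?ler01// mul0r.
Unshelve. all: by end_near. Qed.

Lemma capx_indic A : measurable A -> capx (\1_A).
Proof.
rewrite measurable_orthants; apply: (@dynkin_induction _ E orthants (fun A => capx (\1_A))).
- exact: measurable_orthants.
- exact: orthants_setI.
- apply: capx_ext (capx_cont (@cst_continuous _ _ (1 : R))) => x.
  by rewrite indicE in_setT.
- by move=> B; exact: capx_orthant.
- move=> B mB cB.
  apply: capx_ext (capxD (capx_cont (@cst_continuous _ _ (1 : R))) (capxZ (-1) cB)) => x.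
  rewrite !indicE in_setC; case: (x \in B) => /=; lra.
- move=> F mF tF cF.
  have mU : measurable_fun K (\1_(\bigcup_k F k) : E -> R).
    by apply: measurable_funTS; apply/measurable_indicP; exact: bigcupT_measurable.
  have cS N : capx (fun x => \sum_(k < N) \1_(F k) x) by apply: capx_sum => k; exact: cF.
  have inF x j k : F j x -> (\1_(F k) x : R) = (k == j)%:R.
    move=> Fjx; rewrite indicE; case: eqP => [->|/eqP kj]; first by rewrite mem_set.
    rewrite memNset// => Fkx; move/trivIsetP : tF => /(_ k j I I kj) FF.
    by have : (F k `&` F j) x by []; rewrite FF.
  (* By disjointness, at a point of [F j] the partial sum is 1 as soon as j < N and 0 before, so the
     partial sums are bounded by 1 and converge pointwise. *)
  have SE N x j : F j x -> \sum_(k < N) \1_(F k) x = ((j < N)%N%:R : R).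
    move=> Fjx; under eq_bigr do rewrite (inF _ j)//.
    have [jN|Nj] := ltnP j N; last first.
      by rewrite big1// => k _; case: eqP => // kj; move: (ltn_ord k); rewrite kj ltnNge Nj.
    rewrite (bigD1 (Ordinal jN))//= eqxx big1 ?addr0// => k kj.
    by rewrite (_ : (k == j :> nat) = false)//; apply/negbTE.
  have S0 N x : ~ (\bigcup_k F k) x -> \sum_(k < N) \1_(F k) x = (0 : R).
    move=> nx; rewrite big1// => k _; rewrite indicE memNset// => Fk; apply: nx.
    by exists k.
  apply: (@capx_cvg _ (fun N x => \sum_(k < N) \1_(F k) x)) => //.
  apply: L1dist_cvg => //.
  + by move=> N; have [] := cS N.
  + move=> N x; have [[j _ Fjx]|nx] := pselect ((\bigcup_k F k) x).
      by rewrite (SE _ _ _ Fjx); case: (j < N)%N; rewrite ?normr1 ?normr0.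
    by rewrite S0// normr0.
  + move=> x _; have [[j _ Fjx]|nx] := pselect ((\bigcup_k F k) x).
      apply: cvg_near_cst; near=> N; rewrite (SE _ _ _ Fjx) indicE mem_set; last by exists j.
      suff -> : (j < N)%N by [].
      by near: N; exact: nbhs_infty_gt.
    by apply: cvg_near_cst; apply: nearW => N; rewrite S0// indicE memNset.
Unshelve. all: by end_near. Qed.

Lemma capx_integrable f : mu.-integrable K (EFin \o f) -> capx f.
Proof.
move=> intf; have [g [intg _ gf]] := approximation_sfun_integrable mK intf.
have mf : measurable_fun K f by apply/measurable_EFinP; exact: measurable_int intf.
refine (@capx_cvg f (fun k => g k) mf _ gf) => k.
have gE x : g k x = \sum_(y <- finmap.enum_fset (fset_set (range (g k)))) y * \1_(g k @^-1` [set y]) x.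
  by rewrite {1}(fimfunE (g k) x) fsbig_finite.
apply: capx_ext (fun x => esym (gE x)) _.
apply: capx_sum => y; apply: capxZ; apply: capx_indic.
exact: measurable_sfunP.
Qed.

End density.

Lemma le_sum_term (R : numDomainType) (I : finType) (F : I -> R) i :
  (forall j, 0 <= F j) -> F i <= \sum_j F j.
Proof. by move=> F0; rewrite (bigD1 i)//= lerDl; exact: sumr_ge0. Qed.

Section compactly_supported.
Context (R : realType) (n : nat).
Local Notation E := 'rV[R]_n.
Implicit Types (f g rho : E -> R) (x y : E).

Definition bsupp f := exists M : R, forall x, M <= `|x| -> f x = 0.

Lemma smooth_diff f : smooth f -> forall x, differentiable f x.
Proof. by move=> sf x; exact: (sf [::]). Qed.

Lemma smooth_partial f i : smooth f -> smooth (fun x => 'D_(evec R i) f x).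
Proof. by move=> sf s x; rewrite -iter_partial_rcons; exact: sf. Qed.

Lemma smooth_continuous f : smooth f -> continuous f.
Proof. by move=> sf x; apply: differentiable_continuous; exact: smooth_diff. Qed.

Lemma smooth_measurable (D : set E) f : smooth f -> measurable_fun D f.
Proof. by move=> /smooth_continuous; exact: continuous_rV_measurable. Qed.

Lemma derive_eq0_near f x i : {near x, f =1 cst 0} -> 'D_(evec R i) f x = 0.
Proof.
move=> f0; have fc : {near x, cst (0 : R) =1 f} by apply: filterS f0 => y ->.
by rewrite (hasgradE (hasgrad_near fc (hasgrad_cst 0 x))) mxE.
Qed.

Lemma bsupp_partial f i : bsupp f -> bsupp (fun x => 'D_(evec R i) f x).
Proof.
move=> [M fM]; exists (M + 1) => x Mx; apply: derive_eq0_near.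
apply/nbhs_ballP; exists 1 => //= y; rewrite -ball_normE/= => xy; apply: fM.
rewrite -(lerD2r 1) (le_trans Mx)//.
have := ler_normD (x - y) y; rewrite subrK => /le_trans; apply.
by rewrite addrC lerD2l ltW.
Qed.

Lemma bsupp_bounded f : continuous f -> bsupp f ->
  exists2 C : R, 0 <= C & forall x, `|f x| <= C.
Proof.
move=> cf [M fM].
have [C C0 HC] := continuous_at_bounded (@compact_cball R n 0 `|M|) (fun x _ => cf x).
exists C => // x; have [xM|Mx] := leP `|x| `|M|; first by apply: HC; rewrite /= sub0r normrN.
by rewrite fM ?normr0// (le_trans (ler_norm _))// ltW.
Qed.

(** All second derivatives are continuous with bounded support, hence bounded by one constant.
    Uniformity in x is what allows integrating the expansion against a kernel. *)
Lemma bsupp_taylor f : smooth f -> bsupp f ->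
  exists2 C : R, 0 <= C & forall x y,
    `|f y - f x - dotv (grad f x) (y - x)| <= C * `|y - x| ^+ 2.
Proof.
move=> sf bf.
have H (i j : 'I_n) : exists C : R, 0 <= C /\ forall x,
    `|'D_(evec R j) (fun z => 'D_(evec R i) f z) x| <= C.
  have [C C0 HC] := bsupp_bounded
    (smooth_continuous (smooth_partial j (smooth_partial i sf)))
    (bsupp_partial j (bsupp_partial i bf)).
  by exists C.
pose c (i j : 'I_n) : R := sval (cid (H i j)).
have c0 i j : 0 <= c i j by have [] := svalP (cid (H i j)).
have cC i j x : `|'D_(evec R j) (fun z => 'D_(evec R i) f z) x| <= c i j.
  by have [_] := svalP (cid (H i j)); exact.
pose C := \sum_i \sum_j c i j.
have C0 : 0 <= C by apply: sumr_ge0 => i _; apply: sumr_ge0 => j _.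
exists (n%:R * (n%:R * C)); first by rewrite !mulr_ge0.
apply: (@hasgrad_taylor R n f (grad f)
  (fun y i => grad (fun z => 'D_(evec R i) f z) y) C).
- by move=> y; apply: differentiable_hasgrad; exact: smooth_diff.
- move=> i y; apply: hasgrad_ext (differentiable_hasgrad (smooth_diff (smooth_partial i sf) y)).
  by move=> z; rewrite mxE.
- move=> y i j; rewrite mxE (le_trans (cC i j y))//.
  apply: (@le_trans _ _ (\sum_k c i k)); first exact: (le_sum_term _ (c0 i)).
  apply: (@le_sum_term _ _ (fun l => \sum_k c l k)) => l.
  by apply: sumr_ge0 => k _; exact: c0.
Qed.

End compactly_supported.

Section integrable_real.
Context d (T : measurableType d) (R : realType) (mu : {measure set T -> \bar R}).
Context (D : set T) (mD : measurable D).
Implicit Types (f g : T -> R) (c : R).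

Lemma integrable_Zr f c : mu.-integrable D (EFin \o f) ->
  mu.-integrable D (EFin \o (fun x => f x * c)).
Proof. by move=> H; exact: (integrableZr mD c H). Qed.

Lemma integrable_Zl f c : mu.-integrable D (EFin \o f) ->
  mu.-integrable D (EFin \o (fun x => c * f x)).
Proof. by move=> H; exact: (integrableZl mD c H). Qed.

Lemma integrable_rD f g : mu.-integrable D (EFin \o f) -> mu.-integrable D (EFin \o g) ->
  mu.-integrable D (EFin \o (fun x => f x + g x)).
Proof. by move=> Hf Hg; exact: (integrableD mD Hf Hg). Qed.

Lemma integrable_rB f g : mu.-integrable D (EFin \o f) -> mu.-integrable D (EFin \o g) ->
  mu.-integrable D (EFin \o (fun x => f x - g x)).
Proof. by move=> Hf Hg; exact: (integrableB mD Hf Hg). Qed.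

Lemma integrable_mul_bounded f g c : mu.-integrable D (EFin \o f) ->
  measurable_fun D g -> (forall x, D x -> `|g x| <= c) ->
  mu.-integrable D (EFin \o (fun x => f x * g x)).
Proof.
move=> jf mg gC; have := @integrableMl _ _ _ mu D mD (EFin \o f) g jf mg _.
apply; exists c; split; first exact: num_real.
by move=> M CM y Dy /=; rewrite (le_trans (gC _ Dy))// ltW.
Qed.

Lemma integrable_fsum (I : Type) (s : seq I) (F : I -> T -> R) :
  (forall i, mu.-integrable D (EFin \o F i)) ->
  mu.-integrable D (EFin \o (fun x => \sum_(i <- s) F i x)).
Proof.
move=> iF; rewrite (_ : EFin \o _ = (fun x => \sum_(i <- s) (EFin \o F i) x)%E).
  exact: integrable_sum.
by apply/funext => x; rewrite /= sumEFin.
Qed.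

Lemma Rintegral_sum (I : Type) (s : seq I) (F : I -> T -> R) :
  (forall i, mu.-integrable D (EFin \o F i)) ->
  \int[mu]_(x in D) (\sum_(i <- s) F i x) = \sum_(i <- s) \int[mu]_(x in D) F i x.
Proof.
move=> iF; elim: s => [|i s IH].
  rewrite big_nil; under eq_Rintegral do rewrite big_nil.
  by rewrite /Rintegral integral0.
rewrite big_cons -IH -RintegralD//; last exact: integrable_fsum.
by apply: eq_Rintegral => x _; rewrite big_cons.
Qed.

End integrable_real.

(** * Mollification *)

Section convolution.
Context (R : realType) (n : nat).
Local Notation E := 'rV[R]_n.
Local Notation mu := (lebesgue_rV R n).
Context (K : set E) (mK : measurable K).
Implicit Types (w rho : E -> R) (x y : E).

(** The integral runs over K because w is integrable only there. At points whose e-neighbourhood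
    lies in K, and for a kernel supported in that radius, it is the usual convolution. *)
Definition convol w rho x : R := \int[mu]_(y in K) (w y * rho (x - y)).

Lemma measurable_refl rho x : continuous rho -> measurable_fun K (fun y => rho (x - y)).
Proof.
move=> crho; apply: measurable_funTS; apply: (measurableT_comp (continuous_rV_measurable (D := setT) crho)).
have := measurableT_comp (@measurable_shift R n x) (@measurable_oppv R n).
by apply: eq_measurable_fun => y _ /=; rewrite addrC.
Qed.

Lemma integrable_conv w rho x : mu.-integrable K (EFin \o w) ->
  continuous rho -> bsupp rho ->
  mu.-integrable K (EFin \o (fun y => w y * rho (x - y))).
Proof.
move=> iw crho brho; have [C C0 HC] := bsupp_bounded crho brho.
exact: (integrable_mul_bounded mK iw (measurable_refl x crho) (fun y _ => HC (x - y))).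
Qed.

(** Differentiation under the integral without dominated convergence: the uniform Taylor remainder C
    |z - x|^2 of [rho] is integrated against |w|. *)
Lemma conv_hasgrad w rho x : mu.-integrable K (EFin \o w) ->
  smooth rho -> bsupp rho ->
  hasgrad (convol w rho) x (\row_i convol w (fun z => 'D_(evec R i) rho z) x).
Proof.
move=> iw srho brho; have [C C0 HC] := bsupp_taylor srho brho.
have irho z := integrable_conv z iw (smooth_continuous srho) brho.
have idrho i z := integrable_conv z iw (smooth_continuous (smooth_partial i srho))
  (bsupp_partial i brho).
apply: (@hasgrad_quad _ _ _ _ _ ((\int[mu]_(y in K) `|w y|) * C)).
near=> z; pose v : E := z - x.
have iZ i : mu.-integrable K (EFin \o (fun y => v 0 i * (w y * 'D_(evec R i) rho (x - y)))).
  exact: (integrableZl mK (v 0 i) (idrho i x)).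
have dotvE : dotv (\row_i convol w (fun z0 => 'D_(evec R i) rho z0) x) v =
    \int[mu]_(y in K) (\sum_i v 0 i * (w y * 'D_(evec R i) rho (x - y))).
  rewrite Rintegral_sum//; apply: eq_bigr => i _.
  by rewrite mxE RintegralZl// mulrC.
have isum := integrable_fsum mK (index_enum 'I_n) iZ.
have iB : mu.-integrable K (EFin \o (fun y => w y * rho (z - y) - w y * rho (x - y))).
  exact: (integrableB mK (irho z) (irho x)).
rewrite -/v dotvE /convol -RintegralB// -RintegralB//.
set F := (fun y => _ - _ - _).
have iF : mu.-integrable K (EFin \o F) by exact: (integrableB mK iB isum).
rewrite (le_trans (le_normr_Rintegral mK iF))// -mulrA -RintegralZr//; last first.
  exact: integrable_norm.
apply: le_Rintegral => //.
- exact: integrable_norm.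
- by apply: (integrable_Zr mK); exact: integrable_norm.
move=> y Ky.
have -> : F y = w y * (rho (z - y) - rho (x - y) - dotv (grad rho (x - y)) v).
  rewrite /F !mulrBr; congr (_ - _).
  rewrite /dotv mulr_sumr; apply: eq_bigr => i _.
  by rewrite [grad _ _ 0 i]mxE mulrCA; congr (_ * _); rewrite mulrC.
rewrite normrM ler_wpM2l//.
have := HC (x - y) (z - y).
by rewrite (_ : z - y - (x - y) = v)// opprB addrA subrK.
Unshelve. all: by end_near. Qed.

Lemma conv_partial w rho : mu.-integrable K (EFin \o w) ->
  smooth rho -> bsupp rho ->
  forall i x, 'D_(evec R i) (convol w rho) x = convol w (fun z => 'D_(evec R i) rho z) x.
Proof.
by move=> iw srho brho i x; rewrite (hasgradE (conv_hasgrad x iw srho brho)) mxE.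
Qed.

Lemma smooth_conv w rho : mu.-integrable K (EFin \o w) ->
  smooth rho -> bsupp rho -> smooth (convol w rho).
Proof.
move=> iw srho brho; apply/smoothP => k.
elim: k rho srho brho => [|k IH] rho srho brho; split => //;
  try by move=> x; exact: (conv_hasgrad x iw srho brho).1.
move=> i; apply: diffn_ext (IH _ (smooth_partial i srho) (bsupp_partial i brho)) => x.
by rewrite conv_partial.
Qed.

End convolution.

Section uniform_continuity.
Context (R : realType) (n : nat).
Local Notation E := 'rV[R]_n.

(** Only x is confined to K; y may leave it by less than d. The covering argument therefore runs on
    K with continuity in the ambient space. *)
Lemma compact_uniform_continuous (K : set E) (g : E -> R) (e : R) :
  compact K -> continuous g -> 0 < e ->
  exists2 d : R, 0 < d & forall x y, K x -> `|x - y| < d -> `|g x - g y| <= e.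
Proof.
move=> /compact_near_coveringP cK cg e0.
pose P (d : R) (x : E) := forall y, `|x - y| < d -> `|g x - g y| <= e.
have : \forall d \near (0 : R)^'+, K `<=` P d.
  apply: cK => x Kx.
  have e20 : 0 < e / 2 by rewrite divr_gt0.
  have := cg x; move=> /(cvgrPdist_le (FF := nbhs_filter x))/(_ _ e20).
  move=> /nbhs_ballP[d /= d0 dH]; have d20 : 0 < d / 2 by rewrite divr_gt0.
  exists (ball x (d / 2), [set t | t < d / 2]).
    split => /=; first exact: nbhsx_ballx.
    exact: nbhs_right_lt.
  move=> [x' t] /= [xx' td] y x'y.
  rewrite (splitr e) (le_trans (ler_distD (g x) _ _))// lerD//.
    rewrite distrC; apply: dH; apply: le_ball xx'.
    by rewrite ler_pdivrMr// ler_pMr// ler1n.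
  apply: dH; rewrite (splitr d); apply: ball_triangle xx' _.
  by rewrite -ball_normE /=; exact: lt_trans td.
move=> H; near (0 : R)^'+ => d; exists d; first by [].
by move=> x y Kx; apply: (near H d).
Unshelve. all: by end_near. Qed.

End uniform_continuity.

Section powR_theory.
Context (R : realType).
Implicit Types (s t m p : R).

(** The graph of s^p lies above its tangent at m. By homogeneity m = 1 suffices, and that case is
    Young's inequality for the product t * 1. *)
Lemma powR_tangent s m p : 1 <= p -> 0 <= s -> 0 < m ->
  m `^ p + p * m `^ (p - 1) * (s - m) <= s `^ p.
Proof.
move=> p1 s0 m0; have p0 : 0 < p by rewrite (lt_le_trans ltr01).
suff H t : 0 <= t -> 1 + p * (t - 1) <= t `^ p.
  have sE : s = m * (s / m) by rewrite mulrCA divff ?mulr1// gt_eqF.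
  have mE : m `^ p = m * m `^ (p - 1).
    have -> : m `^ p = m `^ (1 + (p - 1)) by rewrite addrC subrK.
    rewrite [LHS]powRD; last by rewrite (gt_eqF m0) implybT.
    by rewrite powRr1// ltW.
  rewrite [in leRHS]sE powRM ?divr_ge0 ?(ltW m0)//.
  have : m `^ p * (1 + p * (s / m - 1)) <= m `^ p * (s / m) `^ p.
    by apply: ler_wpM2l; [exact: powR_ge0|apply: H; rewrite divr_ge0// ltW].
  apply: le_trans; rewrite le_eqVlt; apply/orP; left; apply/eqP.
  rewrite mE; have mn0 : m != 0 by rewrite gt_eqF.
  by field.
move=> t0; move: p1; rewrite le_eqVlt => /orP[/eqP <-|p1].
  by rewrite powRr1// mul1r addrC subrK.
have q0 : 0 < p / (p - 1) by rewrite divr_gt0// subr_gt0.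
have pq : p^-1 + (p / (p - 1))^-1 = 1.
  by rewrite invf_div; field; rewrite gt_eqF//=.
have := conjugate_powR t0 ler01 p0 q0 pq.
rewrite mulr1 powR1 mul1r => H.
have Q : (p / (p - 1))^-1 = 1 - p^-1 by move: pq => /eqP; rewrite eq_sym -subr_eq => /eqP <-; ring.
rewrite Q in H.
have := ler_wpM2l (ltW p0) H.
rewrite mulrDr mulrCA divff ?gt_eqF// mulr1 mulrBr mulr1 divff ?gt_eqF//.
by move=> H'; lra.
Qed.

End powR_theory.

(** * The mollifier, Jensen's inequality and L^1 convergence *)

Section mollifier.
Context (R : realType) (n : nat) (n_gt0 : (0 < n)%N).
Local Notation E := 'rV[R]_n.
Local Notation mu := (lebesgue_rV R n).
Implicit Types (x y : E) (e : R).

(** The classical exp(-1 / (1 - |x|^2 / e^2)). The Euclidean norm makes it smooth; since the sup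
    norm is smaller, it still vanishes outside the cube of radius e. *)
Definition bump e x : R := flat 1 1 (1 - e ^- 2 * dotv x x).

Lemma smooth_bump e : smooth (bump e).
Proof.
apply: smooth_flat => //; apply/smoothP => k.
have H : diffn k (fun x : E => 1 + (- e ^- 2) * dotv x x).
  apply: diffnD; first exact: diffn_cst.
  apply: diffnM; first exact: diffn_cst.
  by apply: diffn_sum => i; apply: diffnM; exact: diffn_coord.
by apply: diffn_ext H => x; rewrite mulNr.
Qed.

Lemma bump_ge0 e x : 0 <= bump e x.
Proof.
rewrite /bump /flat; case: ifPn => // _.
by rewrite (hornerC 1) mul1r expR_ge0.
Qed.

Lemma bump_le1 e x : bump e x <= 1.
Proof.
rewrite /bump /flat; case: ifPn => // t0.
by rewrite (hornerC 1) mul1r -[leRHS]expR0 ler_expR ler_pdivrMr// mul0r lerN10.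
Qed.

Lemma bumpN e x : bump e (- x) = bump e x.
Proof. have dotN : dotv (- x) (- x) = dotv x x by rewrite dotvNr dotvC dotvNr opprK.
by rewrite /bump dotN. Qed.

Lemma bump_supp e x : 0 < e -> e <= `|x| -> bump e x = 0.
Proof.
move=> e0 ex; rewrite /bump /flat ifF//; apply/negbTE; rewrite -leNgt subr_le0.
rewrite mulrC ler_pdivlMr ?exprn_gt0// mul1r -sqr_enorm.
apply: lerXn2r; rewrite ?nnegrE ?enorm_ge0 ?(ltW e0)//.
exact: le_trans ex (norm_le_enorm x).
Qed.

Lemma dotv_le_norm x : dotv x x <= n%:R * `|x| ^+ 2.
Proof.
rewrite mulr_natl -[X in _ *+ X]card_ord -sumr_const; apply: ler_sum => i _.
by rewrite -expr2 -real_normK ?num_real// lerXn2r ?nnegrE// coord_le_norm.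
Qed.

(** On this cube |x|^2 <= n (e / (2 n))^2 <= e^2 / 4 in the Euclidean norm, so the argument of
    [flat] is at least 3/4, and 1 / (3/4) = 4/3. *)
Lemma bump_low e x : 0 < e -> `|x| <= e / (2 * n%:R) -> expR (- (4 / 3)) <= bump e x.
Proof.
move=> e0 xe; have n0 : 0 < n%:R :> R by rewrite ltr0n.
have n1 : 1 <= n%:R :> R by rewrite ler1n.
have H : e ^- 2 * dotv x x <= 4^-1.
  rewrite mulrC ler_pdivrMr ?exprn_gt0// (le_trans (dotv_le_norm x))//.
  apply: (@le_trans _ _ (n%:R * (e / (2 * n%:R)) ^+ 2)).
    apply: ler_wpM2l; first exact: ltW.
    by apply: lerXn2r; rewrite ?nnegrE// divr_ge0 ?mulr_ge0 ?(ltW e0) ?(ltW n0).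
  have -> : n%:R * (e / (2 * n%:R)) ^+ 2 = 4^-1 * e ^+ 2 * n%:R^-1.
    by field; rewrite gt_eqF.
  apply: ler_piMr; first by rewrite mulr_ge0 ?invr_ge0 ?sqr_ge0.
  by rewrite invf_le1.
have t0 : 3 / 4 <= 1 - e ^- 2 * dotv x x by lra.
have t1 : 0 < 1 - e ^- 2 * dotv x x by lra.
rewrite /bump /flat t1 (hornerC 1) mul1r ler_expR mulNr lerN2 mul1r.
by rewrite -[leRHS]invf_div lef_pV2 ?posrE.
Qed.

Lemma bump_integrable e : 0 < e -> mu.-integrable setT (EFin \o bump e).
Proof.
move=> e0; apply: (@compact_supp_integrable _ _ _ e).
  exact: smooth_continuous (smooth_bump e).
by move=> x; exact: bump_supp.
Qed.

Definition bump_mass e : R := \int[mu]_x bump e x.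

Lemma bump_mass_ge e : 0 < e -> expR (- (4 / 3)) * (e / n%:R) ^+ n <= bump_mass e.
Proof.
move=> e0; have ib := bump_integrable e0.
have n0 : 0 < n%:R :> R by rewrite ltr0n.
have e2 : 0 <= e / (2 * n%:R) by rewrite divr_ge0 ?mulr_ge0 ?ltW.
pose C := [set y : E | `|0 - y| <= e / (2 * n%:R)].
have mC : measurable C by exact: measurable_cball.
rewrite -lee_fin /bump_mass /Rintegral fineK; last exact: integrable_fin_num ib.
have mb : measurable_fun setT (EFin \o bump e) by exact: measurable_int ib.
apply: (@le_trans _ _ (\int[mu]_(x in C) (bump e x)%:E)%E); last first.
  apply: ge0_subset_integral => //.
  by move=> x _; rewrite lee_fin bump_ge0.
apply: (@le_trans _ _ (\int[mu]_(x in C) (cst (expR (- (4 / 3)))%:E x))%E); last first.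
  apply: ge0_le_integral => //.
  - by move=> x _; rewrite lee_fin expR_ge0.
  - exact: measurable_funTS.
  - by move=> x; rewrite /C /= sub0r normrN lee_fin; exact: bump_low.
rewrite integral_cst// [X in (_ * X)%E](_ : _ = ((2 * (e / (2 * n%:R))) ^+ n)%:E); last first.
  exact: lebesgue_cball.
rewrite -EFinM lee_fin.
have -> : 2 * (e / (2 * n%:R)) = e / n%:R by field; rewrite gt_eqF.
by [].
Qed.

Lemma bump_mass_gt0 e : 0 < e -> 0 < bump_mass e.
Proof.
move=> e0; apply: lt_le_trans (bump_mass_ge e0).
by rewrite mulr_gt0 ?expR_gt0// exprn_gt0// divr_gt0// ltr0n.
Qed.

Definition moll e x : R := bump e x / bump_mass e.

Lemma smooth_moll e : smooth (moll e).
Proof.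
apply/smoothP => k; apply: (@diffn_ext _ _ _ (fun x => bump e x * (bump_mass e)^-1)) => //.
by apply: diffnM; [exact: (smoothP _).1 (smooth_bump e) k|exact: diffn_cst].
Qed.

Lemma moll_ge0 e x : 0 < e -> 0 <= moll e x.
Proof. by move=> e0; rewrite divr_ge0 ?bump_ge0// ltW// bump_mass_gt0. Qed.

Lemma mollN e x : moll e (- x) = moll e x.
Proof. by rewrite /moll bumpN. Qed.

Lemma moll_supp e x : 0 < e -> e <= `|x| -> moll e x = 0.
Proof. by move=> e0 ex; rewrite /moll bump_supp// mul0r. Qed.

Lemma bsupp_moll e : 0 < e -> bsupp (moll e).
Proof. by move=> e0; exists e => x; exact: moll_supp. Qed.

Lemma moll_continuous e : continuous (moll e).
Proof. exact: smooth_continuous (smooth_moll e). Qed.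

(** The kernel is at most of order e^(-n), because [bump] is at most 1 and its mass is at least a
    multiple of e^n. This is the quantitative input that meets the bound on q / p. *)
Lemma moll_bound : exists2 C : R, 0 <= C &
  forall e x, 0 < e -> moll e x <= C / e ^+ n.
Proof.
have n0 : 0 < n%:R :> R by rewrite ltr0n.
exists (n%:R ^+ n / expR (- (4 / 3))).
  by rewrite divr_ge0 ?expR_ge0// exprn_ge0.
move=> e x e0; rewrite /moll ler_pdivrMr ?bump_mass_gt0//.
apply: (le_trans (bump_le1 e x)).
apply: (@le_trans _ _ (n%:R ^+ n / expR (- (4 / 3)) / e ^+ n *
    (expR (- (4 / 3)) * (e / n%:R) ^+ n))).
  rewrite exprMn exprVn le_eqVlt; apply/orP; left; apply/eqP.
  by field; rewrite !expf_eq0 !gt_eqF ?andbF ?expR_gt0.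
apply: ler_wpM2l; last exact: bump_mass_ge.
by rewrite !divr_ge0 ?expR_ge0 ?exprn_ge0 ?ltW.
Qed.

Lemma measurable_moll e : measurable_fun setT (EFin \o moll e).
Proof. by apply/measurable_EFinP; exact: continuous_rV_measurable (@moll_continuous e). Qed.

Lemma integral_moll e : 0 < e -> (\int[mu]_x (moll e x)%:E = 1)%E.
Proof.
move=> e0; have ib := bump_integrable e0.
under eq_integral do rewrite EFinM.
rewrite integralZr//.
have -> : (\int[mu]_x (bump e x)%:E)%E = (bump_mass e)%:E.
  by rewrite /bump_mass /Rintegral fineK//; exact: integrable_fin_num ib.
by rewrite -EFinM divff// gt_eqF// bump_mass_gt0.
Qed.

Lemma integral_mollBr e x : 0 < e -> (\int[mu]_y (moll e (x - y))%:E = 1)%E.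
Proof.
move=> e0; rewrite (@ge0_integral_shiftN _ _ x (EFin \o moll e)) ?integral_moll//.
- exact: measurable_moll.
- by move=> y; rewrite lee_fin moll_ge0.
- by move=> y; rewrite /= mollN.
Qed.

Lemma integral_mollBl e y : 0 < e -> (\int[mu]_x (moll e (x - y))%:E = 1)%E.
Proof.
move=> e0; rewrite (@ge0_integral_shift _ _ (- y) (EFin \o moll e)) ?integral_moll//.
- exact: measurable_moll.
- by move=> x; rewrite lee_fin moll_ge0.
Qed.

Context (K : set E) (mK : measurable K).

Lemma measurable_moll_prod e : measurable_fun [set: E * E]
  (fun z => (moll e (z.1 - z.2))%:E).
Proof.
apply: (measurableT_comp (measurable_moll e)).
apply: rV_measurable_fun => i.
rewrite (_ : (fun _ => _) = (fun z : E * E => z.1 0 i - z.2 0 i)); last first.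
  by apply/funext => z; rewrite !mxE.
apply: measurable_funB; apply: (measurableT_comp (@measurable_coord R n i)).
  exact: measurable_fst.
exact: measurable_snd.
Qed.

(** Enlarging B to the whole space and exchanging the integrals leaves the total mass 1 of the
    kernel; only an inequality survives, since mass may be spread outside B. *)
Lemma tonelli_moll e (F : E -> R) (B : set E) : 0 < e -> measurable B ->
  measurable_fun K F -> (forall y, K y -> 0 <= F y) ->
  (\int[mu]_(x in B) \int[mu]_(y in K) (F y * moll e (x - y))%:E <=
   \int[mu]_(y in K) (F y)%:E)%E.
Proof.
move=> e0 mB mF F0.
pose G y := (F \_ K) y.
have G0 y : 0 <= G y by rewrite /G patchE; case: ifPn => // /set_mem; exact: F0.
have mG : measurable_fun setT G by exact/(measurable_restrictT _ mK).
pose H (z : E * E) := (G z.2 * moll e (z.1 - z.2))%:E.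
have mH : measurable_fun setT H.
  rewrite (_ : H = (fun z => (G z.2)%:E * (moll e (z.1 - z.2))%:E)%E)//.
  apply: emeasurable_funM; last exact: measurable_moll_prod.
  by apply/measurable_EFinP; apply: (measurableT_comp mG); exact: measurable_snd.
have H0 z : (0 <= H z)%E by rewrite lee_fin mulr_ge0// moll_ge0.
have inner x : (\int[mu]_(y in K) (F y * moll e (x - y))%:E = \int[mu]_y H (x, y))%E.
  rewrite integral_mkcond; apply: eq_integral => y _.
  by rewrite patchE /H /G patchE /=; case: ifPn => //; rewrite mul0r.
under eq_integral do rewrite inner.
apply: (@le_trans _ _ (\int[mu]_x \int[mu]_y H (x, y))%E).
  apply: ge0_subset_integral => //.
  - exact: (measurable_fun_fubini_tonelli_F H mH H0).
  - by move=> x _; apply: integral_ge0.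
rewrite (fubini_tonelli H mH H0).
rewrite [leRHS]integral_mkcond le_eqVlt; apply/orP; left; apply/eqP.
apply: eq_integral => y _; rewrite /H /=.
under eq_integral do rewrite EFinM.
rewrite ge0_integralZl//.
- by rewrite integral_mollBl// mule1 /G !patchE; case: ifPn.
- exact: (measurableT_comp (measurable_moll e) (measurable_shift (- y))).
- by move=> x _; rewrite lee_fin moll_ge0.
- by rewrite lee_fin.
Qed.

Lemma integrable_moll e (w : E -> R) x : 0 < e -> mu.-integrable K (EFin \o w) ->
  mu.-integrable K (EFin \o (fun y => w y * moll e (x - y))).
Proof.
move=> e0 iw; apply: integrable_conv => //; first exact: moll_continuous.
exact: bsupp_moll.
Qed.

Lemma EFin_conv e (w : E -> R) x : 0 < e -> mu.-integrable K (EFin \o w) ->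
  ((convol K w (moll e) x)%:E = \int[mu]_(y in K) (w y * moll e (x - y))%:E)%E.
Proof.
move=> e0 iw; rewrite /convol /Rintegral fineK//.
exact: (integrable_fin_num _ (integrable_moll x e0 iw)).
Qed.

Lemma smooth_conv_moll e (w : E -> R) : 0 < e -> mu.-integrable K (EFin \o w) ->
  smooth (convol K w (moll e)).
Proof.
by move=> e0 iw; apply: smooth_conv => //; [exact: smooth_moll|exact: bsupp_moll].
Qed.

Lemma measurable_conv_moll e (w : E -> R) (B : set E) : 0 < e -> mu.-integrable K (EFin \o w) ->
  measurable_fun B (convol K w (moll e)).
Proof. by move=> e0 iw; apply: smooth_measurable; exact: smooth_conv_moll. Qed.

Lemma conv_contract e (w : E -> R) (B : set E) : 0 < e -> measurable B ->
  mu.-integrable K (EFin \o w) ->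
  (\int[mu]_(x in B) `|convol K w (moll e) x|%:E <= \int[mu]_(y in K) `|w y|%:E)%E.
Proof.
move=> e0 mB iw; have iaw := integrable_norm iw.
have maw : measurable_fun K (fun y => `|w y|).
  by apply/measurable_EFinP; exact: measurable_int iaw.
apply: le_trans (tonelli_moll e0 mB maw (fun _ _ => normr_ge0 _)).
have E1 x : (\int[mu]_(y in K) (`|w y| * moll e (x - y))%:E =
    (convol K (fun y => `|w y|) (moll e) x)%:E)%E by rewrite EFin_conv.
under [leRHS]eq_integral do rewrite E1.
apply: ge0_le_integral => //.
- by apply/measurable_EFinP; apply: measurableT_comp => //; exact: measurable_conv_moll.
- by apply/measurable_EFinP; exact: measurable_conv_moll.
- move=> x _; rewrite lee_fin /convol (le_trans (le_normr_Rintegral mK (integrable_moll x e0 iw)))//.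
  apply: le_Rintegral => //.
  + exact: (integrable_norm (integrable_moll x e0 iw)).
  + exact: integrable_moll.
  + by move=> y _; rewrite normrM (ger0_norm (moll_ge0 _ e0)).
Qed.

Lemma conv_cst e x : 0 < e -> (forall y, `|x - y| < e -> K y) ->
  \int[mu]_(y in K) moll e (x - y) = 1.
Proof.
move=> e0 xK; rewrite /Rintegral.
rewrite (_ : (\int[mu]_(y in K) (moll e (x - y))%:E = 1)%E)//.
rewrite -(integral_mollBr x e0) integral_mkcond; apply: eq_integral => y _.
rewrite patchE; case: ifPn => //; rewrite notin_setE => nK.
rewrite moll_supp// leNgt; apply/negP => /xK; exact: nK.
Qed.

Lemma integrable_mollBr e x : 0 < e -> mu.-integrable K (EFin \o (fun y => moll e (x - y))).
Proof.
move=> e0; apply/integrableP; split.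
  by apply/measurable_EFinP; apply: measurable_refl; exact: moll_continuous.
apply: (@le_lt_trans _ _ (\int[mu]_y (moll e (x - y))%:E)%E); last by rewrite integral_mollBr// ltry.
under eq_integral => y _ do rewrite /= (ger0_norm (moll_ge0 _ e0)).
apply: ge0_subset_integral => //.
  apply/measurable_EFinP; apply: (@measurable_refl _ _ setT).
  exact: moll_continuous.
by move=> y _; rewrite lee_fin moll_ge0.
Qed.

(** Jensen's inequality for the probability density y -> [moll e (x - y)]: the tangent inequality at
    the mean m is integrated. The case m = 0 is trivial and is split off because the tangent
    inequality needs m > 0. *)
Lemma conv_jensen e (h : E -> R) (p : R) x : 0 < e -> 1 <= p ->
  (forall y, `|x - y| < e -> K y) -> (forall y, K y -> 0 <= h y) ->
  mu.-integrable K (EFin \o h) ->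
  mu.-integrable K (EFin \o (fun y => h y `^ p)) ->
  convol K h (moll e) x `^ p <= convol K (fun y => h y `^ p) (moll e) x.
Proof.
move=> e0 p1 xK h0 ih ihp.
have p0 : 0 < p by rewrite (lt_le_trans ltr01).
set m := convol K h (moll e) x.
have m0 : 0 <= m by apply: Rintegral_ge0 => y Ky; rewrite mulr_ge0 ?moll_ge0// h0.
have c0 : 0 <= convol K (fun y => h y `^ p) (moll e) x.
  by apply: Rintegral_ge0 => y Ky; rewrite mulr_ge0 ?moll_ge0 ?powR_ge0.
move: m0; rewrite le_eqVlt => /orP[/eqP <-|m0]; first by rewrite powR0// gt_eqF.
pose c := p * m `^ (p - 1).
have ir := integrable_mollBr x e0.
have ihr := integrable_moll x e0 ih.
(* The part of the tangent linear in h - m integrates to zero, as m is the mean of h and the kernel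
   has mass 1. *)
have E1 : \int[mu]_(y in K) ((m `^ p - c * m) * moll e (x - y) + c * (h y * moll e (x - y))) = m `^ p.
  rewrite RintegralD//; [|exact: integrable_Zl|exact: integrable_Zl].
  by rewrite !RintegralZl// conv_cst// mulr1 -/(convol K h (moll e) x) -/m subrK.
rewrite -[leLHS]E1; apply: le_Rintegral => //.
- by apply: integrable_rD => //; exact: integrable_Zl.
- exact: integrable_moll.
- move=> y Ky; have := powR_tangent p1 (h0 y Ky) m0.
  have r0 := moll_ge0 (x - y) e0.
  by move=> /(ler_wpM2r r0); apply: le_trans; rewrite /c le_eqVlt; apply/orP; left; apply/eqP; ring.
Qed.

Lemma conv_approx (g : E -> R) (B : set E) (d0 eta : R) : compact K ->
  mu.-integrable K (EFin \o g) ->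
  continuous g -> B `<=` K -> 0 < d0 -> (forall x y, B x -> `|x - y| < d0 -> K y) ->
  0 < eta -> exists2 d : R, 0 < d & forall e, 0 < e -> e < d ->
    forall x, B x -> `|convol K g (moll e) x - g x| <= eta.
Proof.
move=> cK ig cg BK d00 BdK eta0.
have [d d_0 dH] := compact_uniform_continuous cK cg eta0.
exists (Num.min d d0); first by rewrite lt_min d_0.
move=> e e0; rewrite lt_min => /andP[ed ed0] x Bx.
have xK y : `|x - y| < e -> K y by move=> /lt_trans/(_ ed0); exact: BdK.
have ir := integrable_mollBr x e0.
have ihr := integrable_moll x e0 ig.
have -> : convol K g (moll e) x - g x = \int[mu]_(y in K) (g y * moll e (x - y) - g x * moll e (x - y)).
  rewrite RintegralB//; last exact: integrable_Zl.
  by rewrite RintegralZl// conv_cst// mulr1.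
have iD : mu.-integrable K (EFin \o (fun y => g y * moll e (x - y) - g x * moll e (x - y))).
  by apply: integrable_rB => //; exact: integrable_Zl.
rewrite (le_trans (le_normr_Rintegral mK iD))//.
rewrite -[leRHS]mulr1 -(conv_cst e0 xK) -RintegralZl//.
apply: le_Rintegral => //.
- exact: integrable_norm.
- exact: integrable_Zl.
- move=> y Ky; rewrite -mulrBl normrM (ger0_norm (moll_ge0 _ e0)).
  have [xy|xy] := ltP `|x - y| e; last by rewrite moll_supp// !mulr0.
  rewrite ler_wpM2r ?moll_ge0// distrC; apply: dH; first exact: BK.
  exact: lt_trans ed.
Qed.

(** A continuous g close to w in L^1(K) converts the claim into uniform convergence for g. The two
    remaining errors are controlled by the L^1 contraction property and by the choice of g. *)
Lemma conv_L1 (w : E -> R) (B : set E) (d0 eta : R) : compact K ->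
  measurable B -> B `<=` K -> (mu K < +oo)%E ->
  mu.-integrable K (EFin \o w) ->
  0 < d0 -> (forall x y, B x -> `|x - y| < d0 -> K y) ->
  0 < eta -> exists2 d : R, 0 < d & forall e, 0 < e -> e < d ->
    (\int[mu]_(x in B) `|convol K w (moll e) x - w x|%:E < eta%:E)%E.
Proof.
move=> cK mB BK Koo iw d00 BdK eta0.
have eta4 : 0 < eta / 4 by rewrite divr_gt0.
have [mw /(_ _ eta4)[g cg wg]] := capx_integrable mK Koo iw.
have ig : mu.-integrable K (EFin \o g).
  have [N N0 HN] := continuous_at_bounded cK (fun x _ => cg x).
  apply: (@integrable_bounded _ _ _ _ N) => //.
  exact: continuous_rV_measurable.
have Bfin : (mu B < +oo)%E.
  by apply: le_lt_trans Koo; apply: le_measure => //; rewrite inE.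
pose b := fine (mu B); have b0 : 0 <= b by rewrite fine_ge0// measure_ge0.
have bE : mu B = b%:E by rewrite fineK// ge0_fin_numE ?measure_ge0.
(* A uniform error on B costs a factor b, the measure of B, in L^1. *)
have eta' : 0 < eta / 4 / (1 + b) by rewrite divr_gt0// ltr_pwDl.
have [d d_0 dH] := conv_approx cK ig cg BK d00 BdK eta'.
exists d => // e e0 ed.
have iwg : mu.-integrable K (EFin \o (fun y => w y - g y)) by exact: integrable_rB.
have mc w' : mu.-integrable K (EFin \o w') -> measurable_fun B (convol K w' (moll e)).
  exact: measurable_conv_moll.
have mwB : measurable_fun B w by exact: measurable_funS mw.
have mgB : measurable_fun B g by exact: continuous_rV_measurable.
have mD (f1 f2 : E -> R) : measurable_fun B f1 -> measurable_fun B f2 ->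
    measurable_fun B (fun x => `|f1 x - f2 x|%:E).
  exact: measurable_L1dist.
have convB x : convol K w (moll e) x - convol K g (moll e) x = convol K (fun y => w y - g y) (moll e) x.
  rewrite /convol -RintegralB//; [|exact: integrable_moll|exact: integrable_moll].
  by apply: eq_Rintegral => y _; rewrite mulrBl.
have T1 := @L1dist_triangle R n B mB (convol K w (moll e)) (convol K g (moll e)) w (mc _ iw) (mc _ ig) mwB.
have T2 := @L1dist_triangle R n B mB (convol K g (moll e)) g w (mc _ ig) mgB mwB.
apply: le_lt_trans T1 _.
have S1 : (L1dist B (convol K w (moll e)) (convol K g (moll e)) <= (eta / 4)%:E)%E.
  apply: le_trans (ltW wg); rewrite /L1dist.
  by under eq_integral do rewrite convB; exact: conv_contract.
have S2 : (L1dist B (convol K g (moll e)) g <= (eta / 4)%:E)%E.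
  apply: (@le_trans _ _ (\int[mu]_(x in B) (cst (eta / 4 / (1 + b))%:E x))%E).
    apply: ge0_le_integral => //; first exact: mD (mc _ ig) mgB.
    by move=> x Bx; rewrite lee_fin; exact: dH.
  rewrite integral_cst// [X in (_ * X)%E](_ : _ = b%:E)// -EFinM lee_fin.
  by rewrite mulrAC ler_pdivrMr ?ltr_pwDl// ler_wpM2l ?(ltW eta4)// lerDr.
have S3 : (L1dist B g w <= (eta / 4)%:E)%E.
  apply: le_trans (ltW wg); rewrite /L1dist.
  under eq_integral do rewrite distrC.
  apply: ge0_subset_integral => //.
  by apply: measurable_L1dist => //; exact: continuous_rV_measurable.
apply: (@le_lt_trans _ _ ((eta / 4)%:E + ((eta / 4)%:E + (eta / 4)%:E))%E).
  by apply: leeD => //; apply: le_trans T2 _; exact: leeD.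
by rewrite -!EFinD lte_fin; lra.
Qed.

End mollifier.

(** * The double phase energy *)

Section phase.
Context (R : realType) (n : nat).
Local Notation E := 'rV[R]_n.
Local Notation mu := (lebesgue_rV R n).
Context (p q : R) (p_gt1 : 1 < p) (p_le_q : p <= q).
Context (a : E -> R).
Local Notation ph := (phase p q a).
Implicit Types (x y : E) (s t c : R).

Let p_gt0 : 0 < p. Proof. exact: lt_trans p_gt1. Qed.
Let q_gt0 : 0 < q. Proof. exact: lt_le_trans p_le_q. Qed.

Lemma phase0 x : ph x 0 = 0.
Proof. by rewrite /phase normr0 !powR0 ?gt_eqF// mulr0 addr0. Qed.

Lemma phaseN x t : ph x (- t) = ph x t.
Proof. by rewrite /phase normrN. Qed.

Lemma powR_le_phase x t : 0 <= a x -> `|t| `^ p <= ph x t.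
Proof. by move=> ax; rewrite /phase lerDl mulr_ge0// powR_ge0. Qed.

Lemma phase_ge0 x t : 0 <= a x -> 0 <= ph x t.
Proof. by move=> ax; rewrite /phase addr_ge0 ?mulr_ge0 ?powR_ge0. Qed.

Lemma phase_le x s t : 0 <= a x -> `|s| <= `|t| -> ph x s <= ph x t.
Proof.
move=> ax st; rewrite /phase lerD//.
  by apply: ge0_ler_powR; rewrite ?nnegrE// ltW.
by rewrite ler_wpM2l//; apply: ge0_ler_powR; rewrite ?nnegrE// ltW.
Qed.

(** As c >= 1, the power c^p is at most c^q, so the larger exponent serves both phases. *)
Lemma phaseM x c t : 0 <= a x -> 1 <= c -> ph x (c * t) <= c `^ q * ph x t.
Proof.
move=> ax c1; have c0 : 0 <= c by rewrite (le_trans ler01).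
rewrite /phase normrM (ger0_norm c0) !powRM// mulrDr lerD//.
  by rewrite ler_wpM2r ?powR_ge0// ler_powR.
by rewrite mulrCA.
Qed.

Lemma phaseD x s t : 0 <= a x -> ph x (s + t) <= 2 `^ q * (ph x s + ph x t).
Proof.
move=> ax.
wlog st : s t / `|s| <= `|t|.
  move=> H; have [st|/ltW ts] := leP `|s| `|t|; first exact: H.
  by rewrite addrC [ph x s + _]addrC; exact: H.
apply: (@le_trans _ _ (ph x (2 * t))).
  apply: phase_le => //; rewrite (le_trans (ler_normD _ _))// normrM.
  by rewrite (ger0_norm (ler0n _ 2)) mulr_natl mulr2n lerD2r.
rewrite (le_trans (phaseM _ ax _))//; first by rewrite ler1n.
by rewrite ler_wpM2l ?powR_ge0// lerDr phase_ge0.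
Qed.

(** On bounded values H is dominated by a linear function, which turns L^1 convergence of bounded
    functions into convergence in modular. *)
Lemma phase_bounded x t (A M : R) : 0 <= a x <= A -> `|t| <= M ->
  ph x t <= (M `^ (p - 1) + A * M `^ (q - 1)) * `|t|.
Proof.
move=> /andP[ax xA] tM; have M0 : 0 <= M by rewrite (le_trans _ tM).
have H r : 1 < r -> `|t| `^ r <= M `^ (r - 1) * `|t|.
  move=> r1; have [->|t0] := eqVneq `|t| 0.
    by rewrite powR0 ?mulr0// gt_eqF// (lt_trans ltr01).
  have -> : `|t| `^ r = `|t| `^ (1 + (r - 1)) by rewrite addrC subrK.
  rewrite [leLHS]powRD ?t0 ?implybT// powRr1// mulrC ler_wpM2r//.
  by apply: ge0_ler_powR; rewrite ?nnegrE// subr_ge0 ltW.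
rewrite /phase mulrDl lerD ?H// -mulrA.
by apply: ler_pM; rewrite ?powR_ge0//; apply: H; exact: lt_le_trans p_le_q.
Qed.

Lemma le_phase1 x t : 0 <= a x -> `|t| <= 1 + ph x t.
Proof.
move=> ax; have [t1|/ltW t1] := leP `|t| 1.
  by rewrite (le_trans t1)// lerDl phase_ge0.
apply: le_trans (_ : `|t| `^ p <= _); last first.
  by rewrite (le_trans (powR_le_phase t ax))// lerDr.
by rewrite -[leLHS]powRr1//; apply: ler_powR => //; exact: ltW.
Qed.

Lemma phase_enorm x (xi : E) : 0 <= a x -> (0 < n)%N ->
  ph x (enorm xi) <= n%:R `^ q * \sum_i ph x (xi 0 i).
Proof.
move=> ax n0.
have [->|xi0] := eqVneq xi 0.
  rewrite (_ : enorm 0 = 0) ?phase0.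
    by rewrite mulr_ge0 ?powR_ge0// sumr_ge0// => i _; exact: phase_ge0.
  by rewrite /enorm (_ : dotv 0 0 = 0) ?sqrtr0// /dotv big1// => i _; rewrite mxE mul0r.
have [[i0 i] /= xii] : exists i, `|xi| = `|xi i.1 i.2|.
  by have : `|xi| != 0 by [rewrite normr_eq0]; exact: mx_norm_neq0.
rewrite (ord1 i0) in xii.
apply: (@le_trans _ _ (ph x (n%:R * xi 0 i))).
  apply: phase_le => //; rewrite ger0_norm ?enorm_ge0// normrM -xii.
  by rewrite (ger0_norm (ler0n _ n)) enorm_le_norm.
rewrite (le_trans (phaseM _ ax _)) ?ler1n//.
rewrite ler_wpM2l ?powR_ge0//.
by apply: (@le_sum_term _ _ (fun i => ph x (xi 0 i))) => j; exact: phase_ge0.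
Qed.

Context (K : set E) (mK : measurable K) (ma : measurable_fun K a).
Hypothesis a_ge0 : forall x, K x -> 0 <= a x.

Lemma measurable_phase (B : set E) (f : E -> R) : measurable B -> B `<=` K -> measurable_fun B f ->
  measurable_fun B (fun x => ph x (f x)).
Proof.
move=> mB BK mf.
have mn : measurable_fun B (fun x => `|f x|) by exact: measurableT_comp.
apply: measurable_funD.
  exact: (measurableT_comp (@measurable_powR R p) mn).
apply: measurable_funM; first exact: measurable_funS ma.
exact: (measurableT_comp (@measurable_powR R q) mn).
Qed.

Lemma measurable_phaseE (B : set E) (f : E -> R) : measurable B -> B `<=` K -> measurable_fun B f ->
  measurable_fun B (fun x => (ph x (f x))%:E).
Proof. by move=> mB BK mf; apply/measurable_EFinP; exact: measurable_phase. Qed.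

Section subset.
Context (B : set E) (mB : measurable B) (BK : B `<=` K).

Lemma modular_le (f g : E -> R) : measurable_fun B f -> measurable_fun B g ->
  (forall x, B x -> `|f x| <= `|g x|) -> (modular p q a B f <= modular p q a B g)%E.
Proof.
move=> mf mg fg; apply: ge0_le_integral => //.
- by move=> x Bx; rewrite lee_fin phase_ge0// a_ge0//; exact: BK.
- exact: measurable_phaseE.
- exact: measurable_phaseE.
- by move=> x Bx; rewrite lee_fin phase_le ?fg// a_ge0//; exact: BK.
Qed.

Lemma modularD (f g : E -> R) : measurable_fun B f -> measurable_fun B g ->
  (modular p q a B (fun x => (f x + g x)%R) <=
   (2 `^ q)%:E * (modular p q a B f + modular p q a B g))%E.
Proof.
move=> mf mg.
have mfB := measurable_phaseE mB BK mf.
have mgB := measurable_phaseE mB BK mg.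
have p0 (h : E -> R) x : B x -> (0 <= (ph x (h x))%:E)%E.
  by move=> Bx; rewrite lee_fin phase_ge0// a_ge0//; exact: BK.
rewrite /modular -ge0_integralD//; do ?exact: p0.
rewrite -ge0_integralZl//; last 2 first.
- exact: emeasurable_funD.
- by move=> x Bx; apply: adde_ge0; exact: p0.
apply: ge0_le_integral => //.
- by move=> x; exact: (p0 (fun x => f x + g x)).
- by apply: measurable_phaseE => //; exact: measurable_funD.
- by apply: measurable_funeM; exact: emeasurable_funD.
- move=> x Bx; rewrite -EFinD -EFinM lee_fin phaseD// a_ge0//; exact: BK.
Qed.

Lemma modularM (f : E -> R) (c : R) : 1 <= c -> measurable_fun B f ->
  (modular p q a B (fun x => (c * f x)%R) <= (c `^ q)%:E * modular p q a B f)%E.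
Proof.
move=> c1 mf; have mfB := measurable_phaseE mB BK mf.
have p0 (h : E -> R) x : B x -> (0 <= (ph x (h x))%:E)%E.
  by move=> Bx; rewrite lee_fin phase_ge0// a_ge0//; exact: BK.
rewrite /modular -ge0_integralZl//; last 2 first.
- by move=> x; exact: p0.
- by rewrite lee_fin powR_ge0.
apply: ge0_le_integral => //.
- by move=> x; exact: (p0 (fun x => c * f x)).
- by apply: measurable_phaseE => //; exact: measurable_funM.
- by apply: measurable_funeM.
- by move=> x Bx; rewrite -EFinM lee_fin phaseM// a_ge0//; exact: BK.
Qed.

Lemma modular_bounded (f : E -> R) (A M : R) : (forall x, B x -> a x <= A) ->
  measurable_fun B f -> (forall x, B x -> `|f x| <= M) -> 0 <= M -> 0 <= A ->
  (modular p q a B f <=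
   (M `^ (p - 1) + A * M `^ (q - 1))%:E * \int[mu]_(x in B) `|f x|%:E)%E.
Proof.
move=> aA mf fM M0 A0; rewrite /modular.
have mn : measurable_fun B (fun x => `|f x|%:E).
  by apply/measurable_EFinP; exact: measurableT_comp.
rewrite -ge0_integralZl//; last first.
  by rewrite lee_fin addr_ge0 ?mulr_ge0 ?powR_ge0.
apply: ge0_le_integral => //.
- by move=> x Bx; rewrite lee_fin phase_ge0// a_ge0//; exact: BK.
- exact: measurable_phaseE.
- exact: measurable_funeM.
- move=> x Bx; rewrite -EFinM lee_fin; apply: phase_bounded; last exact: fM.
  by rewrite aA// a_ge0//; exact: BK.
Qed.

Lemma modular_integrable (f : E -> R) : measurable_fun B f ->
  (modular p q a B f < +oo)%E <-> mu.-integrable B (fun x => (ph x (f x))%:E).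
Proof.
move=> mf; have mfB := measurable_phaseE mB BK mf.
have E1 : (\int[mu]_(x in B) `|(ph x (f x))%:E| = modular p q a B f)%E.
  apply: eq_integral => x /set_mem Bx; rewrite gee0_abs// lee_fin phase_ge0// a_ge0//.
  exact: BK.
split=> [H|/integrableP[_]]; last by rewrite E1.
by apply/integrableP; split=> //; rewrite E1.
Qed.

Lemma modular_integrable1 (f : E -> R) : (mu B < +oo)%E -> measurable_fun B f ->
  (modular p q a B f < +oo)%E -> mu.-integrable B (EFin \o f).
Proof.
move=> Boo mf /(modular_integrable mf) H.
have i1 : mu.-integrable B (EFin \o (cst 1 : E -> R)).
  by apply: (@integrable_bounded _ _ _ _ 1) => // x _ /=; rewrite normr1.
apply: le_integrable (integrable_rD mB i1 H) => //; first exact/measurable_EFinP.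
move=> x Bx; have ax : 0 <= a x by apply: a_ge0; exact: BK.
rewrite /= lee_fin (le_trans (le_phase1 (f x) ax))// ger0_norm//.
by rewrite addr_ge0// phase_ge0.
Qed.

(** Both exponents are at least 1, so c^p and c^q are at most c on [0, 1]; pointwise convergence of
    a cut-off factor then passes to the energy density. *)
Lemma phase_shrink x c t : 0 <= a x -> 0 <= c <= 1 -> ph x (c * t) <= c * ph x t.
Proof.
move=> ax /andP[c0 c1].
have cr r : 1 <= r -> c `^ r <= c.
  move=> r1; have [->|c_0] := eqVneq c 0; first by rewrite powR0// gt_eqF// (lt_le_trans ltr01).
  rewrite -[leRHS]powRr1//; have cp : 0 < c by rewrite lt_neqAle eq_sym c_0.
  by apply: ger_powR => //; rewrite cp.
rewrite /phase normrM (ger0_norm c0) !powRM// mulrDr lerD//.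
  by rewrite ler_wpM2r ?powR_ge0// cr// ltW.
rewrite [leRHS]mulrCA ler_wpM2l// ler_wpM2r ?powR_ge0// cr//.
by rewrite (le_trans (ltW p_gt1)).
Qed.

(** Dominated convergence with the dominating function H(x, h), integrable because h has finite
    modular. *)
Lemma modular_dct (h : E -> R) (c : nat -> E -> R) (eta : R) : measurable_fun B h ->
  (modular p q a B h < +oo)%E -> (forall k, measurable_fun B (c k)) ->
  (forall k x, B x -> 0 <= c k x <= 1) ->
  (forall x, B x -> c ^~ x @ \oo --> (0 : R)) -> 0 < eta ->
  exists k, (modular p q a B (fun x => (c k x * h x)%R) < eta%:E)%E.
Proof.
move=> mh /(modular_integrable mh) ih mc c01 c0 eta0.
have a0 x : B x -> 0 <= a x by move=> Bx; apply: a_ge0; exact: BK.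
pose F k x := (ph x (c k x * h x))%:E.
have mF k : measurable_fun B (F k).
  by apply: measurable_phaseE => //; exact: measurable_funM.
have : (\int[mu]_(x in B) F k x)%E @[k --> \oo] --> (\int[mu]_(x in B) (0 : \bar R))%E.
  apply: (@dominated_cvg _ _ _ mu B mB F (cst 0%E) (fun x => (ph x (h x))%:E)) => //.
  - move=> x Bx; apply: cvg_EFin; first by apply: nearW => k.
    have cph : c k x * ph x (h x) @[k --> \oo] --> (0 : R).
      by rewrite -(mul0r (ph x (h x))); apply: cvgMl; exact: c0.
    apply: squeeze_cvgr cph; last exact: cvg_cst.
    apply: nearW => k; rewrite /= phase_ge0 ?a0//= phase_shrink ?a0//; exact: c01.
  - move=> k x Bx; rewrite /F gee0_abs ?lee_fin ?phase_ge0 ?a0//.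
    apply: phase_le; rewrite ?a0// normrM; have /andP[ck0 ck1] := c01 k x Bx.
    by rewrite (ger0_norm ck0) ler_piMl.
rewrite integral0 => /fine_cvgP[_] Fc.
have /= [k _ Hk] : \forall k \near \oo, `|0 - fine (\int[mu]_(x in B) F k x)%E| < eta.
  by move/cvgrPdist_lt : Fc; exact.
exists k; have := Hk k (leqnn k); rewrite /= sub0r normrN => Hk'.
have iF : mu.-integrable B (F k).
  apply: le_integrable ih => // x Bx.
  rewrite /F /= lee_fin !ger0_norm ?phase_ge0 ?a0//.
  apply: phase_le; rewrite ?a0// normrM; have /andP[ck0 ck1] := c01 k x Bx.
  by rewrite (ger0_norm ck0) ler_piMl.
rewrite /modular -[ltLHS]fineK; last exact: integrable_fin_num iF.
by rewrite lte_fin (le_lt_trans (ler_norm _)).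
Qed.

(** The tail [t] is h on the set |h| > k and 0 elsewhere, for a large k; what remains is bounded by
    k. Later estimates treat the bounded part in L^1 and the tail by its small energy. *)
Lemma modular_truncate (h : E -> R) (s : R) : measurable_fun B h ->
  (modular p q a B h < +oo)%E -> 0 < s ->
  exists M (t : E -> R), [/\ 0 <= M, measurable_fun B t, forall x, `|t x| <= `|h x|,
    forall x, `|h x - t x| <= M & (modular p q a B t < s%:E)%E].
Proof.
move=> mh hoo s0.
pose c (k : nat) x : R := if `|h x| <= k%:R then 0 else 1.
have c01 k x : 0 <= c k x <= 1 by rewrite /c; case: ifP; rewrite !lexx ler01.
have mc k : measurable_fun B (c k).
  apply: (@measurable_fun_if _ _ _ _ (cst (0 : R)) (cst (1 : R)) B mB (fun x => `|h x| <= k%:R)) => //.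
  by apply: measurable_fun_ler => //; exact: measurableT_comp.
have c0 x : B x -> c ^~ x @ \oo --> (0 : R).
  move=> _; apply/cvgrPdist_lt => e e0.
  near=> k; rewrite sub0r normrN /c ifT ?normr0//.
  by near: k; exact: nbhs_infty_ger.
have [k Hk] := modular_dct mh hoo mc (fun k x _ => c01 k x) c0 s0.
exists k%:R, (fun x => c k x * h x); split => //.
- exact: measurable_funM.
- by move=> x; have /andP[ck0 ck1] := c01 k x; rewrite normrM (ger0_norm ck0) ler_piMl.
- move=> x; rewrite /c; case: ifPn => [|_]; first by rewrite mul0r subr0.
  by rewrite mul1r subrr normr0.
Unshelve. all: by end_near. Qed.

End subset.

End phase.

Section double_phase_mollification.
Context (R : realType) (n : nat) (n_gt0 : (0 < n)%N).
Local Notation E := 'rV[R]_n.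
Local Notation mu := (lebesgue_rV R n).
Context (p q : R) (p_gt1 : 1 < p) (p_le_q : p <= q).
Hypothesis pq_bound : q / p <= 1 + n%:R^-1.
Context (a : E -> R).
Local Notation ph := (phase p q a).
Context (K : set E) (mK : measurable K) (ma : measurable_fun K a).
Hypothesis a_ge0 : forall x, K x -> 0 <= a x.
Context (L : R) (L_ge0 : 0 <= L).
Hypothesis a_lip : forall x y, K x -> K y -> `|a x - a y| <= L * `|x - y|.
Implicit Types (x y : E) (e : R).

Let p_gt0 : 0 < p. Proof. exact: lt_trans p_gt1. Qed.
Let q_gt0 : 0 < q. Proof. exact: lt_le_trans p_le_q. Qed.

(* This is where [q / p <= 1 + 1 / n] is used: [|D w_e|^p] is at most of order
   [e^(-n)], so that [e |D w_e|^(q - p)] stays bounded. *)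
Lemma exponent_gap e (C t : R) : 0 < e -> e <= 1 -> 1 <= C -> 0 <= t ->
  t `^ p <= C / e ^+ n -> e * t `^ q <= C * t `^ p.
Proof.
move=> e0 e1 C1 t0 tC.
have [->|tn0] := eqVneq t 0.
  by rewrite !powR0 ?gt_eqF// !mulr0.
(* Writing t^q = t^p (t^p)^th with th = q/p - 1 <= 1/n, the factor e (e^(-n))^th = e^(1 - n th) is
   at most 1. *)
pose th := (q - p) / p.
have th0 : 0 <= th by rewrite divr_ge0 ?subr_ge0// ltW.
have n0 : 0 < n%:R :> R by rewrite ltr0n.
have thn : th * n%:R <= 1.
  rewrite -ler_pdivlMr// div1r /th mulrBl divff ?gt_eqF//.
  by rewrite lerBlDr addrC.
have th1 : th <= 1.
  by apply: le_trans thn; rewrite ler_peMr// ler1n.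
have -> : t `^ q = t `^ p * (t `^ p) `^ th.
  rewrite -powRrM /th mulrCA divff ?gt_eqF// mulr1.
  have -> : t `^ q = t `^ (p + (q - p)) by rewrite addrC subrK.
  by rewrite [LHS]powRD// tn0 implybT.
rewrite mulrCA mulrC ler_wpM2r ?powR_ge0//.
have en : 0 < e ^+ n by rewrite exprn_gt0.
apply: (@le_trans _ _ (e * (C / e ^+ n) `^ th)).
  rewrite ler_wpM2l ?(ltW e0)//; apply: ge0_ler_powR; rewrite ?nnegrE ?powR_ge0//.
  by rewrite divr_ge0 ?(ltW en)// (le_trans ler01).
have C0 : 0 <= C by rewrite (le_trans ler01).
rewrite powRM ?invr_ge0 ?(ltW en)//.
have Cth : C `^ th <= C by rewrite -[leRHS]powRr1// ler_powR.
have eth : e * (e ^+ n)^-1 `^ th <= 1.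
  rewrite -exprVn -powR_mulrn ?invr_ge0 ?(ltW e0)// -powRrM.
  rewrite -ler_pdivlMl// mulr1; apply: ler1_powR; last by rewrite mulrC.
  by rewrite invf_ge1.
rewrite mulrCA -[leRHS]mulr1; apply: ler_pM => //; first exact: powR_ge0.
by rewrite mulr_ge0 ?(ltW e0)// powR_ge0.
Qed.

(** A pointwise Jensen inequality for the x-dependent energy. The p-phase is Jensen itself. In the
    q-phase [a x] is split into a lower bound [al] of [a] on the e-cube, handled by Jensen, and an
    error L e m^q, handled by [exponent_gap]. Energy at most 1 is the normalisation that gives m^p
    <= C / e^n. *)
Lemma phase_convol : exists2 C : R, 0 <= C & forall e x (h : E -> R),
  0 < e -> e <= 1 -> (forall y, `|x - y| < e -> K y) ->
  mu.-integrable K (EFin \o h) ->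
  mu.-integrable K (EFin \o (fun y => ph y (h y))) ->
  (\int[mu]_(y in K) (ph y (h y))%:E <= 1)%E ->
  ph x (convol K h (moll e) x) <= C * convol K (fun y => ph y (h y)) (moll e) x.
Proof.
(* Adding 1 gives C >= 1, required by [exponent_gap]. *)
have [C' C'0 HC'] := @moll_bound R n n_gt0; pose C := 1 + C'.
have C1 : 1 <= C by rewrite lerDl.
have HC e x : 0 < e -> moll e x <= C / e ^+ n.
  move=> e0; apply: le_trans (HC' e x e0) _.
  by rewrite ler_wpM2r ?invr_ge0 ?exprn_ge0 ?(ltW e0)// lerDr.
exists (1 + L * C); first by rewrite addr_ge0// mulr_ge0// (le_trans ler01).
move=> e x h e0 e1 xK ih iph ph1.
have Kx : K x by apply: xK; rewrite subrr normr0.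
have ax := a_ge0 Kx.
have mh : measurable_fun K h by apply/measurable_EFinP; exact: measurable_int ih.
pose g y := `|h y|.
have ig : mu.-integrable K (EFin \o g) by exact: integrable_norm.
have mg : measurable_fun K g by exact: measurableT_comp.
have g0 y : 0 <= g y by exact: normr_ge0.
have igp : mu.-integrable K (EFin \o (fun y => g y `^ p)).
  apply: le_integrable iph => //.
    by apply/measurable_EFinP; exact: (measurableT_comp (@measurable_powR R p) mg).
  move=> y Ky; rewrite /= lee_fin ger0_norm ?powR_ge0// ger0_norm ?phase_ge0 ?a_ge0//.
  by apply: powR_le_phase; exact: a_ge0.
have iagq : mu.-integrable K (EFin \o (fun y => a y * g y `^ q)).
  apply: eq_integrable (integrable_rB mK iph igp) => // y _ /=.
  by rewrite /phase addrC addKr.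
set m := convol K g (moll e) x.
have m0 : 0 <= m by apply: Rintegral_ge0 => y Ky; rewrite mulr_ge0 ?moll_ge0.
have hm : `|convol K h (moll e) x| <= m.
  rewrite (le_trans (le_normr_Rintegral mK (integrable_moll mK x e0 ih)))//.
  apply: le_Rintegral => //.
  - exact: (integrable_norm (integrable_moll mK x e0 ih)).
  - exact: integrable_moll.
  - by move=> y _; rewrite normrM (ger0_norm (moll_ge0 n_gt0 _ e0)).
set P := convol K (fun y => g y `^ p) (moll e) x.
set Q := convol K (fun y => a y * g y `^ q) (moll e) x.
have PQ : convol K (fun y => ph y (h y)) (moll e) x = P + Q.
  rewrite /P /Q /convol -RintegralD//; [|exact: integrable_moll|exact: integrable_moll].
  by apply: eq_Rintegral => y _; rewrite -mulrDl.
have mP : m `^ p <= P by apply: conv_jensen => //; exact: ltW.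
have PC : P <= C / e ^+ n.
  apply: (@le_trans _ _ (\int[mu]_(y in K) (g y `^ p * (C / e ^+ n)))).
    apply: le_Rintegral => //; [exact: integrable_moll|exact: integrable_Zr|].
    by move=> y _; rewrite ler_wpM2l ?powR_ge0// HC.
  rewrite RintegralZr// -[leRHS]mul1r ler_wpM2r//.
    by rewrite divr_ge0 ?exprn_ge0 ?(ltW e0)// (le_trans ler01).
  rewrite -lee_fin /Rintegral fineK; last exact: integrable_fin_num igp.
  apply: le_trans ph1; apply: ge0_le_integral => //.
  - by move=> y _; rewrite lee_fin powR_ge0.
  - exact: measurable_int igp.
  - exact: measurable_int iph.
  - by move=> y Ky; rewrite lee_fin powR_le_phase// a_ge0.
have mC : m `^ p <= C / e ^+ n by exact: le_trans PC.
have gap := exponent_gap e0 e1 C1 m0 mC.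
pose al := Num.max 0 (a x - L * e).
have al0 : 0 <= al by rewrite le_max lexx.
have aal : a x <= al + L * e.
  by rewrite -lerBlDr le_max lexx orbT.
have ala y : `|x - y| < e -> al <= a y.
  move=> xy; have Ky := xK y xy; rewrite ge_max a_ge0//=.
  have := a_lip Kx Ky; rewrite ler_norml => /andP[_].
  have : L * `|x - y| <= L * e by rewrite ler_wpM2l// ltW.
  by move=> H1 H2; lra.
have alQ : al * m `^ q <= Q.
  have [->|aln0] := eqVneq al 0.
    rewrite mul0r; apply: Rintegral_ge0 => y Ky.
    apply: mulr_ge0; last exact: moll_ge0.
    by apply: mulr_ge0; [exact: a_ge0|exact: powR_ge0].
  have al_gt0 : 0 < al by rewrite lt_neqAle eq_sym aln0.
  (* [g] need not be q-integrable over K, since [a] may vanish. On the e-cube [a] is at least al >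
     0, so g^q is bounded there by a g^q / al; the kernel does not see the cut. *)
  pose D : set E := ball x e; have mD : measurable D by apply: measurable_rV_open; exact: ball_open.
  have DE y : (y \in D) = (`|x - y| < e) by apply/idP/idP; rewrite inE /D -ball_normE.
  pose g' : E -> R := g \_ D.
  have g'E y : g' y = if `|x - y| < e then g y else 0 by rewrite /g' patchE DE.
  have mg' : measurable_fun K g'.
    by apply/(measurable_restrict _ mD mK); apply: measurable_funS mg => // y [].
  have g'0 y : 0 <= g' y by rewrite g'E; case: ifP.
  have ig' : mu.-integrable K (EFin \o g').
    apply: le_integrable ig => //; first exact/measurable_EFinP.
    by move=> y _; rewrite /= lee_fin g'E; case: ifP => // _; rewrite normr0.
  have g'q y : K y -> g' y `^ q <= al^-1 * (a y * g y `^ q).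
    move=> Ky; rewrite g'E; case: ifPn => [xy|_]; last first.
      rewrite powR0 ?gt_eqF//; apply: mulr_ge0; first by rewrite invr_ge0.
      by apply: mulr_ge0; [exact: a_ge0|exact: powR_ge0].
    rewrite mulrA ler_peMl ?powR_ge0// mulrC ler_pdivlMr// mul1r.
    exact: ala.
  have ig'q : mu.-integrable K (EFin \o (fun y => g' y `^ q)).
    apply: le_integrable (integrable_Zl mK al^-1 iagq) => //.
      by apply/measurable_EFinP; exact: (measurableT_comp (@measurable_powR R q) mg').
    move=> y Ky; rewrite /= lee_fin ger0_norm ?powR_ge0// (le_trans (g'q _ Ky))//.
    exact: ler_norm.
  have mE : m = convol K g' (moll e) x.
    apply: eq_Rintegral => y _; rewrite g'E; case: ifPn => //.
    by rewrite -leNgt => xy; rewrite moll_supp// !mulr0.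
  have := conv_jensen n_gt0 mK e0 (ltW (lt_le_trans p_gt1 p_le_q)) xK (fun y _ => g'0 y) ig' ig'q.
  rewrite -mE => /(ler_wpM2l al0); move/le_trans; apply.
  rewrite /Q /convol -RintegralZl//; last exact: integrable_moll.
  apply: le_Rintegral => //.
  - by apply: integrable_Zl => //; exact: integrable_moll.
  - exact: integrable_moll.
  - move=> y Ky; rewrite mulrA ler_wpM2r ?moll_ge0//.
    by rewrite -ler_pdivlMl//; exact: g'q.
have P0 : 0 <= P by apply: le_trans mP; exact: powR_ge0.
have Q0 : 0 <= Q by apply: le_trans alQ; rewrite mulr_ge0 ?powR_ge0.
apply: (@le_trans _ _ (ph x m)).
  by apply: phase_le => //; rewrite (ger0_norm m0).
rewrite PQ /phase (ger0_norm m0).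
(* The error L e m^q is at most L C m^p, hence paid for by the p-phase. *)
have S1 : a x * m `^ q <= Q + L * C * P.
  apply: (@le_trans _ _ ((al + L * e) * m `^ q)); first by rewrite ler_wpM2r ?powR_ge0.
  rewrite mulrDl lerD// -!mulrA ler_wpM2l//; apply: le_trans gap _.
  by rewrite ler_wpM2l// (le_trans ler01).
have LC : 0 <= L * C by rewrite mulr_ge0// (le_trans ler01).
have LCQ : 0 <= L * C * Q by rewrite mulr_ge0.
have -> : (1 + L * C) * (P + Q) = P + (Q + L * C * P) + L * C * Q by ring.
by rewrite -[leLHS]addr0; apply: lerD => //; exact: lerD.
Qed.

(** The function is split into a bounded part and a tail of energy below s. For the tail,
    [phase_convol] bounds the energy of its mollification by C s; the bounded part converges in L^1
    and hence in modular. *)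
Lemma conv_LH (A d0 : R) (B : set E) (h : E -> R) (eta : R) : compact K -> (mu K < +oo)%E ->
  0 <= A -> (forall x, K x -> a x <= A) ->
  measurable B -> B `<=` K -> 0 < d0 -> (forall x y, B x -> `|x - y| < d0 -> K y) ->
  measurable_fun K h -> (modular p q a K h < +oo)%E -> 0 < eta ->
  exists2 d : R, 0 < d & forall e, 0 < e -> e < d ->
    (modular p q a B (fun x => convol K h (moll e) x - h x)%R < eta%:E)%E.
Proof.
move=> cK Koo A0 aA mB BK d00 BdK mh hoo eta0.
have [C C0 HC] := phase_convol.
pose T := 2 `^ q; have T0 : 0 < T by rewrite powR_gt0.
(* s <= 1 meets the normalisation of [phase_convol]; the denominator dominates the total T (C s + T
   (s + s)) produced by two uses of [modularD]. *)
pose s := Num.min 1 (eta / (4 * T * (1 + T) * (1 + C))).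
have D0 : 0 < 4 * T * (1 + T) * (1 + C).
  by rewrite !mulr_gt0// ltr_pwDl// ltW.
have s0 : 0 < s by rewrite lt_min ltr01 divr_gt0.
have s1 : s <= 1 by rewrite ge_min lexx.
have sD : s * (4 * T * (1 + T) * (1 + C)) <= eta.
  by rewrite -ler_pdivlMr// ge_min lexx orbT.
have [M [t [M0 mt _ bM ts]]] :=
  modular_truncate p_gt1 p_le_q mK ma a_ge0 mK (@subset_refl _ K) mh hoo s0.
pose b x := h x - t x.
have {}bM x : `|b x| <= M by exact: bM.
have mb : measurable_fun K b by exact: measurable_funB.
have too : (modular p q a K t < +oo)%E by rewrite (lt_le_trans ts)// leey.
have it : mu.-integrable K (EFin \o t).
  exact: (modular_integrable1 p_gt1 mK ma a_ge0 mK (@subset_refl _ K) Koo mt too).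
have ih : mu.-integrable K (EFin \o h).
  exact: (modular_integrable1 p_gt1 mK ma a_ge0 mK (@subset_refl _ K) Koo mh hoo).
have ib : mu.-integrable K (EFin \o b) by exact: integrable_rB.
have ipt : mu.-integrable K (EFin \o (fun y => ph y (t y))).
  exact: ((modular_integrable p q mK ma a_ge0 mK (@subset_refl _ K) mt).1 too).
(* The difference between b and its mollification is bounded by 2 M, so N is the constant of
   [modular_bounded] for it. *)
pose N := (2 * M) `^ (p - 1) + A * (2 * M) `^ (q - 1).
have N0 : 0 <= N by rewrite addr_ge0 ?mulr_ge0 ?powR_ge0.
have s' : 0 < s / (1 + N) by rewrite divr_gt0// ltr_pwDl.
have [d d_0 Hd] := conv_L1 n_gt0 mK cK mB BK Koo ib d00 BdK s'.
exists (Num.min d (Num.min d0 1)); first by rewrite !lt_min d_0 d00 ltr01.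
move=> e e0; rewrite !lt_min => /and3P[ed ed0 /ltW e1].
have BeK x : B x -> forall y, `|x - y| < e -> K y.
  by move=> Bx y xy; apply: BdK Bx _; exact: lt_trans ed0.
have mcv w : mu.-integrable K (EFin \o w) -> measurable_fun B (convol K w (moll e)).
  exact: measurable_conv_moll.
have mtB : measurable_fun B t by exact: measurable_funS mt.
have mbB : measurable_fun B b by exact: measurable_funS mb.
have mtN : measurable_fun B (fun x => - t x) by exact: measurableT_comp.
have split x : convol K h (moll e) x - h x =
    convol K t (moll e) x + (- t x + (convol K b (moll e) x - b x)).
  have -> : convol K h (moll e) x = convol K t (moll e) x + convol K b (moll e) x.
    rewrite /convol -RintegralD//; [|exact: integrable_moll|exact: integrable_moll].
    by apply: eq_Rintegral => y _; rewrite -mulrDl /b [t y + _]addrC subrK.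
  by rewrite /b; ring.
have P1 : (modular p q a B (convol K t (moll e)) <= (C * s)%:E)%E.
  have -> : ((C * s)%:E = C%:E * s%:E)%E by [].
  apply: (@le_trans _ _ (C%:E * modular p q a K t)%E); last first.
    by apply: lee_wpmul2l; rewrite ?lee_fin// ltW.
  have mE : measurable_fun B (fun x => (convol K (fun y => ph y (t y)) (moll e) x)%:E).
    by apply/measurable_EFinP; exact: mcv.
  have cp x : 0 <= convol K (fun y => ph y (t y)) (moll e) x.
    apply: Rintegral_ge0 => y Ky; apply: mulr_ge0; last exact: moll_ge0.
    by apply: phase_ge0; exact: a_ge0.
  apply: (@le_trans _ _ (C%:E * \int[mu]_(x in B) (convol K (fun y => ph y (t y)) (moll e) x)%:E)%E).
    rewrite -ge0_integralZl//; last by move=> x _; rewrite lee_fin.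
    apply: ge0_le_integral => //.
    - by move=> x Bx; rewrite lee_fin phase_ge0// a_ge0//; exact: BK.
    - exact: (measurable_phaseE p q mK ma mB BK (mcv _ it)).
    - exact: measurable_funeM.
    - move=> x Bx; rewrite -EFinM lee_fin; apply: HC => //; first exact: BeK.
      by rewrite (le_trans (ltW ts))// lee_fin.
  apply: lee_wpmul2l; first by rewrite lee_fin.
  under eq_integral do rewrite (EFin_conv mK _ e0 ipt).
  apply: tonelli_moll => //; first exact: (measurable_phase p q mK ma mK (@subset_refl _ K) mt).
  by move=> y Ky; apply: phase_ge0; exact: a_ge0.
have P2 : (modular p q a B (fun x => (- t x)%R) <= s%:E)%E.
  apply: le_trans (ltW ts); rewrite /modular.
  under eq_integral do rewrite phaseN.
  apply: ge0_subset_integral => //; first exact: (measurable_phaseE p q mK ma mK (@subset_refl _ K) mt).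
  by move=> y Ky; rewrite lee_fin; apply: phase_ge0; exact: a_ge0.
have mbb : measurable_fun B (fun x => convol K b (moll e) x - b x).
  by apply: measurable_funB => //; exact: mcv.
have cbM x : B x -> `|convol K b (moll e) x| <= M.
  move=> Bx; rewrite (le_trans (le_normr_Rintegral mK (integrable_moll mK x e0 ib)))//.
  rewrite -[leRHS]mulr1 -(conv_cst n_gt0 e0 (BeK x Bx)) -RintegralZl//; last exact: integrable_mollBr.
  apply: le_Rintegral => //.
  - exact: (integrable_norm (integrable_moll mK x e0 ib)).
  - by apply: integrable_Zl => //; exact: integrable_mollBr.
  - by move=> y _; rewrite normrM (ger0_norm (moll_ge0 n_gt0 _ e0)) ler_wpM2r ?moll_ge0.
have P3 : (modular p q a B (fun x => (convol K b (moll e) x - b x)%R) <= s%:E)%E.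
  apply: le_trans (modular_bounded p_gt1 p_le_q mK ma a_ge0 mB BK (A := A) (M := 2 * M) _ mbb _ _ A0) _.
  - by move=> x /BK; exact: aA.
  - by move=> x Bx; rewrite (le_trans (ler_normB _ _))// mulr_natl mulr2n lerD ?cbM.
  - by rewrite mulr_ge0.
  rewrite -/N; apply: (@le_trans _ _ (N%:E * (s / (1 + N))%:E)%E).
    by apply: lee_wpmul2l; [rewrite lee_fin|exact: ltW (Hd e e0 ed)].
  by rewrite -EFinM lee_fin mulrCA ler_piMr ?(ltW s0)// ler_pdivrMr ?ltr_pwDl// mul1r lerDr.
have Q2 : (modular p q a B (fun x => (- t x + (convol K b (moll e) x - b x))%R) <= (T * (s + s))%:E)%E.
  apply: le_trans (modularD p_gt1 p_le_q mK ma a_ge0 mB BK mtN mbb) _.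
  by rewrite (EFinM T) EFinD; apply: lee_wpmul2l; [rewrite lee_fin ltW|exact: leeD P2 P3].
have mtb : measurable_fun B (fun x => - t x + (convol K b (moll e) x - b x)) by exact: measurable_funD.
rewrite (_ : (fun x => convol K h (moll e) x - h x) = (fun x => convol K t (moll e) x + (- t x + (convol K b (moll e) x - b x)))); last exact/funext.
apply: le_lt_trans (modularD p_gt1 p_le_q mK ma a_ge0 mB BK (mcv _ it) mtb) _.
apply: (@le_lt_trans _ _ (T%:E * (C * s + T * (s + s))%:E)%E).
  by rewrite EFinD; apply: lee_wpmul2l; [rewrite lee_fin ltW|exact: leeD P1 Q2].
rewrite -EFinM lte_fin; apply: lt_le_trans sD.
have Ts : 0 < T * s by rewrite mulr_gt0.
have TTs : 0 < T * (T * s) by rewrite mulr_gt0.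
have CTs : 0 <= C * (T * s) by rewrite mulr_ge0// ltW.
have CTTs : 0 <= C * (T * (T * s)) by rewrite mulr_ge0// ltW.
have -> : T * (C * s + T * (s + s)) = C * (T * s) + 2 * (T * (T * s)) by ring.
have -> : s * (4 * T * (1 + T) * (1 + C)) = 4 * (T * s + T * (T * s) + C * (T * s) + C * (T * (T * s))) by ring.
lra.
Qed.

End double_phase_mollification.

(** * Test functions and weak gradients *)

Section test_functions.
Context (R : realType) (n : nat).
Local Notation E := 'rV[R]_n.
Local Notation mu := (lebesgue_rV R n).
Implicit Types (f g phi : E -> R) (x y : E).

Lemma smooth_refl f x : smooth f -> smooth (fun y => f (x - y)).
Proof.
move=> sf; apply/smoothP => k; elim: k f sf => [|k IH] f sf.
  split=> // y; exact: (hasgrad_refl (differentiable_hasgrad (smooth_diff sf _))).1.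
split=> [y|i]; first exact: (hasgrad_refl (differentiable_hasgrad (smooth_diff sf _))).1.
have := diffnM (@diffn_cst R n k (-1)) (IH _ (smooth_partial i sf)).
apply: diffn_ext => y; rewrite (hasgradE (hasgrad_refl (differentiable_hasgrad (smooth_diff sf (x - y))))).
by rewrite !mxE mulN1r.
Qed.

Lemma smooth_grad f x : smooth f -> hasgrad f x (grad f x).
Proof. by move=> /smooth_diff df; exact: differentiable_hasgrad. Qed.

Lemma out_support_near phi x : ~ closure [set z | phi z != 0] x -> {near x, phi =1 cst 0}.
Proof.
move=> nS; have : nbhs x (~` closure [set z | phi z != 0]).
  apply: open_nbhs_nbhs; split=> //; rewrite openC; exact: closed_closure.
apply: filterS => y nSy; apply/eqP; apply: contrapT => /negP phiy.
by apply: nSy; exact: subset_closure.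
Qed.

Lemma test_function_out (Om : set E) phi x : test_function Om phi -> ~ Om x ->
  {near x, phi =1 cst 0}.
Proof. by move=> [_ [_ S]] nx; apply: out_support_near => /S. Qed.

Lemma test_function_bounded_supp (Om : set E) phi : test_function Om phi ->
  exists M : R, forall x, M <= `|x| -> {near x, phi =1 cst 0}.
Proof.
move=> [sphi [cS SOm]].
have [M [Mr HM]] := compact_bounded cS.
exists (M + 2) => x Mx; apply: out_support_near => Sx.
have := HM (M + 1); rewrite ltrDl ltr01 => /(_ isT _ Sx) /=.
by apply/negP; rewrite -ltNge; lra.
Qed.

Lemma test_function_continuous (Om : set E) phi : test_function Om phi -> continuous phi.
Proof. by move=> [sphi _]; exact: smooth_continuous. Qed.

Lemma test_function_measurable (Om D : set E) phi : test_function Om phi -> measurable_fun D phi.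
Proof. by move=> [sphi _]; exact: smooth_measurable. Qed.

Lemma test_function_bounded (Om : set E) phi : test_function Om phi ->
  exists2 C : R, 0 <= C & forall x, `|phi x| <= C.
Proof.
move=> tphi; have [M HM] := test_function_bounded_supp tphi.
apply: bsupp_bounded; first exact: test_function_continuous tphi.
by exists M => x /HM /nbhs_singleton.
Qed.

Lemma test_function_integrable (Om D : set E) phi : measurable D -> test_function Om phi ->
  mu.-integrable D (EFin \o phi).
Proof.
move=> mD tphi; have [M HM] := test_function_bounded_supp tphi.
apply: (@integrableS _ _ _ _ setT) => //.
apply: (@compact_supp_integrable _ _ _ M); first exact: test_function_continuous tphi.
by move=> x /HM /nbhs_singleton.
Qed.

Lemma near_cst0_derive phi x i : {near x, phi =1 cst 0} -> phi x = 0 /\ 'D_(evec R i) phi x = 0.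
Proof. by move=> h; split; [exact: nbhs_singleton h|exact: derive_eq0_near]. Qed.

Lemma test_function_partial (Om : set E) phi j : test_function Om phi ->
  test_function Om (fun x => 'D_(evec R j) phi x).
Proof.
move=> [sphi [cS SOm]]; split; first exact: smooth_partial.
have [] := @closure_sub_compact _ _ [set x | 'D_(evec R j) phi x != 0] _ cS.
  move=> y /= /eqP Dy; apply: contrapT => nS; apply: Dy.
  exact: (near_cst0_derive j (out_support_near nS)).2.
by move=> cD sD; split=> //; exact: subset_trans SOm.
Qed.

Section by_parts.
Context (Om : set E) (mOm : measurable Om) (i : 'I_n).
Context (f df : E -> R).
Hypothesis f_der : forall x, Om x -> hasgrad f x (grad f x).
Hypothesis df_der : forall x, Om x -> 'D_(evec R i) f x = df x.
Hypothesis df_cont : forall x, Om x -> {for x, continuous df}.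

Let oob phi g x : test_function Om phi -> ~ Om x -> {near x, (fun y => g y * phi y) =1 cst 0}.
Proof.
move=> tphi nx; have := test_function_out tphi nx.
by apply: filterS => y /= ->; rewrite mulr0.
Qed.

Lemma test_mul_continuous phi g : test_function Om phi ->
  (forall x, Om x -> {for x, continuous g}) -> continuous (fun x => g x * phi x).
Proof.
move=> tphi cg x; have [Ox|nOx] := pselect (Om x).
  apply: continuousM; first exact: cg.
  by have := smooth_continuous tphi.1; exact.
have nx := oob g tphi nOx; have g0 := nbhs_singleton nx.
have : (cst 0 : E -> R) y @[y --> x] --> (g x * phi x).
  have -> : g x * phi x = 0 by exact: g0.
  exact: (@cst_continuous E R 0 x).
apply: cvg_trans; apply: (@near_eq_cvg _ _ (nbhs x) (nbhs_filter x)).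
by apply: (filterS _ nx) => y ->.
Qed.

Lemma test_mul_integrable phi g : test_function Om phi ->
  (forall x, Om x -> {for x, continuous g}) ->
  mu.-integrable Om (EFin \o (fun x => g x * phi x)).
Proof.
move=> tphi cg; have [M HM] := test_function_bounded_supp tphi.
have : mu.-integrable setT (EFin \o (fun x => g x * phi x)).
  apply: (@compact_supp_integrable _ _ _ M); first exact: test_mul_continuous.
  by move=> x /HM /nbhs_singleton ->; rewrite mulr0.
by apply: integrableS.
Qed.

(** f phi extends by zero across the boundary of [Om], because phi vanishes near each point outside
    [Om]; the integral of its i-th derivative over the whole space is therefore zero, whatever the
    values of f out there. *)
Lemma test_function_by_parts phi : test_function Om phi ->
  \int[mu]_(x in Om) (f x * 'D_(evec R i) phi x) = - \int[mu]_(x in Om) (df x * phi x).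
Proof.
move=> tphi; have [sphi [cS SOm]] := tphi.
have cf x : Om x -> {for x, continuous f}.
  by move=> Ox; apply: hasgrad_continuous; exact: f_der.
have tDphi := test_function_partial i tphi.
have i1 := test_mul_integrable tDphi cf.
have i2 := test_mul_integrable tphi df_cont.
have [M HM] := test_function_bounded_supp tphi.
pose dh x := f x * 'D_(evec R i) phi x + df x * phi x.
have D0 : (\int[mu]_x (dh x)%:E = 0)%E.
  apply: (@integral_derive0 _ _ i (fun x => f x * phi x) dh M).
  - move=> x; have [Ox|nOx] := pselect (Om x).
      have := hasgrad_derive (hasgradM (f_der Ox) (smooth_grad x sphi)) (evec R i).
      rewrite dotv_evec !mxE -/(evec R i) df_der// [phi x * _]mulrC.
      exact.
    have nx := oob f tphi nOx.
    have [p0 Dp0] := near_cst0_derive i (test_function_out tphi nOx).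
    rewrite /dh p0 Dp0 !mulr0 addr0.
    have := hasgrad_derive (hasgrad_near _ (hasgrad_cst 0 x)) (evec R i).
    rewrite (_ : dotv 0 _ = 0); last by rewrite /dotv big1// => j _; rewrite mxE mul0r.
    by apply; apply: filterS nx => y ->.
  - apply: continuous_fD; exact: test_mul_continuous.
  - move=> x /HM /(near_cst0_derive i)[p0 Dp0]; rewrite /dh p0 Dp0.
    by rewrite !mulr0 addr0.
have : \int[mu]_(x in Om) dh x = 0.
  rewrite /Rintegral (_ : (\int[mu]_(x in Om) (dh x)%:E = 0)%E)//.
  rewrite -D0 integral_mkcond; apply: eq_integral => x _; rewrite patchE.
  case: ifPn => //; rewrite notin_setE => nOx.
  by have [p0 Dp0] := near_cst0_derive i (test_function_out tphi nOx); rewrite /dh p0 Dp0 !mulr0 addr0.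
by rewrite RintegralD// => /eqP; rewrite addr_eq0 => /eqP.
Qed.

End by_parts.
End test_functions.

(** * From the modular to the norm and to L^1 *)

Section modular_norm.
Context (R : realType) (n : nat).
Local Notation E := 'rV[R]_n.
Local Notation mu := (lebesgue_rV R n).
Context (p q : R) (p_gt1 : 1 < p) (p_le_q : p <= q) (a : E -> R).
Context (K : set E) (mK : measurable K) (ma : measurable_fun K a).
Hypothesis a_ge0 : forall x, K x -> 0 <= a x.
Context (B : set E) (mB : measurable B) (BK : B `<=` K) (Boo : (mu B < +oo)%E).
Implicit Types (f : E -> R) (F : E -> E).

(** Division by lam <= 1 inflates H by at most lam^(-q). A modular of size lam^q is thus the right
    target for a norm of size lam. *)
Lemma modular_scale f (lam : R) : 0 < lam -> lam <= 1 -> measurable_fun B f ->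
  (modular p q a B f <= (lam `^ q)%:E)%E ->
  (modular p q a B (fun x => f x / lam)%R <= 1)%E.
Proof.
move=> l0 l1 mf fl.
have l1' : 1 <= lam^-1 by rewrite invf_ge1.
rewrite (_ : (fun x => f x / lam) = (fun x => lam^-1 * f x)); last first.
  by apply/funext => x; rewrite mulrC.
apply: le_trans (modularM p_le_q mK ma a_ge0 mB BK l1' mf) _.
apply: (@le_trans _ _ ((lam^-1 `^ q)%:E * (lam `^ q)%:E)%E).
  by apply: lee_wpmul2l => //; rewrite lee_fin powR_ge0.
rewrite -EFinM lee_fin -powRM ?invr_ge0 ?(ltW l0)//.
by rewrite mulVf ?gt_eqF// powR1.
Qed.

Lemma LH_norm_le f (lam : R) : 0 < lam -> lam <= 1 -> measurable_fun B f ->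
  (modular p q a B f <= (lam `^ q)%:E)%E -> (LH_norm p q a B f <= lam%:E)%E.
Proof.
move=> l0 l1 mf fl; apply: ereal_inf_lbound => /=; exists lam => //; split=> //.
exact: modular_scale.
Qed.

Lemma measurable_enorm F : (forall i, measurable_fun B (fun x => F x 0 i)) ->
  measurable_fun B (fun x => enorm (F x)).
Proof.
move=> mF; have ms : measurable_fun B (fun x => dotv (F x) (F x)).
  apply: measurable_sum => i; exact: measurable_funM.
apply: (measurableT_comp _ ms); apply: continuous_measurable_fun.
exact: sqrt_continuous.
Qed.

Lemma modular_coord F i : (forall i, measurable_fun B (fun x => F x 0 i)) ->
  (modular p q a B (fun x => F x 0%R i) <= modular p q a B (fun x => enorm (F x)))%E.
Proof.
move=> mF; apply: (modular_le p_gt1 p_le_q mK ma a_ge0 mB BK (mF i) (measurable_enorm mF)).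
by move=> x _; rewrite (ger0_norm (enorm_ge0 _)) coord_le_enorm.
Qed.

Lemma integrable_coord F i : (forall i, measurable_fun B (fun x => F x 0 i)) ->
  (modular p q a B (fun x => enorm (F x)) < +oo)%E ->
  mu.-integrable B (EFin \o (fun x => F x 0 i)).
Proof.
move=> mF Foo; apply: (modular_integrable1 p_gt1 mK ma a_ge0 mB BK Boo (mF i)).
exact: le_lt_trans (modular_coord i mF) Foo.
Qed.

Lemma modular_enorm F (s : R) : (0 < n)%N -> (forall i, measurable_fun B (fun x => F x 0 i)) ->
  (forall i, (modular p q a B (fun x => F x 0 i)%R <= s%:E)%E) ->
  (modular p q a B (fun x => enorm (F x)) <= (n%:R `^ q * (n%:R * s))%:E)%E.
Proof.
move=> n0 mF Fs.
have mp i := measurable_phaseE p q mK ma mB BK (mF i).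
have p0 i x : B x -> (0 <= (phase p q a x (F x 0 i))%:E)%E.
  by move=> /BK Kx; rewrite lee_fin phase_ge0// a_ge0.
apply: (@le_trans _ _ ((n%:R `^ q)%:E * \sum_(i < n) modular p q a B (fun x => F x 0 i)%R)%E).
  rewrite /modular -ge0_integral_sum// -ge0_integralZl//; last 2 first.
  - exact: emeasurable_sum.
  - by move=> x Bx; apply: sume_ge0 => i _; exact: p0.
  apply: ge0_le_integral => //.
  - by move=> x /BK Kx; rewrite lee_fin phase_ge0// a_ge0.
  - exact: (measurable_phaseE p q mK ma mB BK (measurable_enorm mF)).
  - by apply: measurable_funeM; exact: emeasurable_sum.
  - by move=> x /BK Kx; rewrite sumEFin -EFinM lee_fin phase_enorm// a_ge0.
rewrite EFinM; apply: lee_wpmul2l; first by rewrite lee_fin powR_ge0.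
apply: (@le_trans _ _ (\sum_(i < n) s%:E)%E); first exact: lee_sum.
by rewrite sumEFin lee_fin sumr_const card_ord mulr_natl.
Qed.

(** Integrate |t| <= 1 + H(x, t) at t = f / lam. *)
Lemma L1_le_modular f (lam : R) : 0 < lam -> measurable_fun B f ->
  (modular p q a B (fun x => f x / lam)%R <= 1)%E ->
  (\int[mu]_(x in B) `|f x|%:E <= (lam * (fine (mu B) + 1))%:E)%E.
Proof.
move=> l0 mf fl.
have mfl : measurable_fun B (fun x => f x / lam) by exact: measurable_funM.
have mp := measurable_phaseE p q mK ma mB BK mfl.
have bE : (mu B = (fine (mu B))%:E)%E by rewrite fineK// ge0_fin_numE ?measure_ge0.
have p0 x : B x -> 0 <= phase p q a x (f x / lam).
  by move=> /BK Kx; rewrite phase_ge0// a_ge0.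
apply: (@le_trans _ _ (lam%:E * \int[mu]_(x in B) (1 + (phase p q a x (f x / lam)%R)%:E))%E).
  rewrite -ge0_integralZl//; last 3 first.
  - exact: emeasurable_funD.
  - by move=> x Bx; rewrite -EFinD lee_fin addr_ge0// p0.
  - by rewrite lee_fin ltW.
  apply: ge0_le_integral => //.
  - by apply/measurable_EFinP; exact: measurableT_comp.
  - by apply: measurable_funeM; exact: emeasurable_funD.
  - move=> x /BK Kx; rewrite -EFinD -EFinM lee_fin mulrC -ler_pdivrMr//.
    by rewrite -[X in _ / X](gtr0_norm l0) -normf_div le_phase1// a_ge0.
rewrite ge0_integralD//.
rewrite integral_cst// mul1e [X in (_ * (X + _))%E](_ : _ = (fine (mu B))%:E)//.
by rewrite EFinM EFinD; apply: lee_wpmul2l; [rewrite lee_fin ltW|exact: leeD2l].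
Qed.

Lemma LH_norm_lt f (e : R) : (LH_norm p q a B f < e%:E)%E ->
  exists lam : R, [/\ 0 < lam, lam < e & (modular p q a B (fun x => f x / lam)%R <= 1)%E].
Proof.
move=> /ereal_inf_lt[_ [lam [l0 lm] <-]]; rewrite lte_fin => le.
by exists lam.
Qed.

Lemma LH_norm_ge0 f : (0 <= LH_norm p q a B f)%E.
Proof. by apply: le_ereal_inf_tmp => _ [lam [/ltW l0 _] <-]; rewrite lee_fin. Qed.

Lemma integrable_locally_on f : mu.-integrable B (EFin \o f) -> locally_integrable_on B f.
Proof.
move=> jf; split; first by apply/measurable_EFinP; exact: measurable_int jf.
by move=> C cC CB; apply: integrableS jf => //; exact: compact_rV_measurable.
Qed.

End modular_norm.

Lemma common_radius (R : realType) (n : nat) (P : 'I_n -> R -> Prop) :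
  (forall i, exists2 d : R, 0 < d & forall e, 0 < e -> e < d -> P i e) ->
  exists2 d : R, 0 < d & forall e, 0 < e -> e < d -> forall i, P i e.
Proof.
move=> H; pose d i := s2val (cid2 (H i)); exists (\big[Num.min/1]_i d i).
  by apply: lt_bigmin => // i _; exact: (s2valP (cid2 (H i))).
move=> e e0 ed i; apply: (s2valP' (cid2 (H i))) => //.
by apply: lt_le_trans ed _; exact: bigmin_le.
Qed.

Lemma Rintegral_support (R : realType) d (T : measurableType d) (mu : {measure set T -> \bar R})
  (A B : set T) (f : T -> R) : A `<=` B -> (forall x, ~ A x -> f x = 0) ->
  \int[mu]_(x in B) f x = \int[mu]_(x in A) f x.
Proof.
move=> AB f0; rewrite /Rintegral integral_mkcond [in RHS]integral_mkcond; congr fine.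
apply: eq_integral => x _; rewrite !patchE.
have [Ax|nA] := pselect (A x); first by rewrite !mem_set//; exact: AB.
by rewrite (memNset nA) f0//; case: ifP.
Qed.

(** Identities are passed to the limit below in this form: their defect is at most a constant times
    the approximation parameter. *)
Lemma eq_small0 (R : realType) (x C : R) :
  (forall e, 0 < e -> e <= 1 -> `|x| <= C * e) -> x = 0.
Proof.
move=> H; apply/eqP; rewrite -normr_le0; apply/ler_addgt0Pr => e e0; rewrite add0r.
have C0 : 0 <= C by have := H 1 ltr01 (lexx _); rewrite mulr1; apply: le_trans.
pose d := Num.min 1 (e / (1 + C)).
have d0 : 0 < d by rewrite lt_min ltr01 divr_gt0// ltr_pwDl.
rewrite (le_trans (H d d0 _)) ?ge_min ?lexx//.
apply: (@le_trans _ _ (C * (e / (1 + C)))).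
  by rewrite ler_wpM2l// ge_min lexx orbT.
by rewrite mulrCA ler_piMr ?(ltW e0)// ler_pdivrMr ?ltr_pwDl// mul1r lerDr.
Qed.

Section Rintegral_bounds.
Context d (T : measurableType d) (R : realType) (mu : {measure set T -> \bar R}).
Context (B : set T) (mB : measurable B).
Implicit Types (f g : T -> R).

Lemma Rintegral_mul_le f g (C M : R) : mu.-integrable B (EFin \o f) ->
  measurable_fun B g -> (forall x, B x -> `|g x| <= C) -> 0 <= C ->
  (\int[mu]_(x in B) `|f x|%:E <= M%:E)%E ->
  `|\int[mu]_(x in B) (f x * g x)| <= C * M.
Proof.
move=> jf mg gC C0 fM.
have jfg := integrable_mul_bounded mB jf mg gC.
have jnf := integrable_norm jf.
rewrite (le_trans (le_normr_Rintegral mB jfg))//.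
apply: (@le_trans _ _ (\int[mu]_(x in B) (C * `|f x|))).
  apply: le_Rintegral => //.
  - exact: integrable_norm jfg.
  - exact: integrable_Zl.
  - by move=> x Bx; rewrite normrM mulrC ler_wpM2r// gC.
rewrite RintegralZl// ler_wpM2l// -lee_fin /Rintegral fineK//.
exact: integrable_fin_num jnf.
Qed.

End Rintegral_bounds.

(** * The positive part as a limit of test functions *)

Section positive_part.
Context (R : realType) (n : nat) (n_gt0 : (0 < n)%N).
Local Notation E := 'rV[R]_n.
Local Notation mu := (lebesgue_rV R n).
Context (p q : R) (p_gt1 : 1 < p) (p_le_q : p <= q).
Hypothesis pq_bound : q / p <= 1 + n%:R^-1.
Context (a : E -> R) (K : set E) (mK : measurable K) (ma : measurable_fun K a).
Hypothesis a_ge0 : forall x, K x -> 0 <= a x.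
Context (L : R) (L_ge0 : 0 <= L).
Hypothesis a_lip : forall x y, K x -> K y -> `|a x - a y| <= L * `|x - y|.
Context (cK : compact K) (Koo : (mu K < +oo)%E).
Context (A : R) (A0 : 0 <= A) (aA : forall x, K x -> a x <= A).
Context (B : set E) (oB : open B) (BK : B `<=` K) (d0 : R) (d00 : 0 < d0).
Hypothesis BdK : forall x y, B x -> `|x - y| < d0 -> K y.
Context (N : set E) (cN : compact N) (NB : N `<=` B).
Context (w : E -> R) (Dw : E -> E) (Om : set E) (KOm : K `<=` Om).
Hypothesis w_weak : weak_gradient Om w Dw.
Hypothesis mw : measurable_fun K w.
Hypothesis mDw : forall i, measurable_fun K (fun x => Dw x 0 i).
Hypothesis w_LH : (modular p q a K w < +oo)%E.
Hypothesis Dw_LH : (modular p q a K (fun x => enorm (Dw x)) < +oo)%E.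
Hypothesis w_le0 : forall x y, ~ N x -> K y -> `|x - y| < d0 -> w y <= 0.
Implicit Types (x y : E) (e : R).

Let mB : measurable B. Proof. exact: measurable_rV_open. Qed.

Let KK := @subset_refl _ K.

Let iw : mu.-integrable K (EFin \o w).
Proof. exact: (modular_integrable1 p_gt1 mK ma a_ge0 mK KK Koo mw w_LH). Qed.

Let mDwn : measurable_fun K (fun x => enorm (Dw x)).
Proof. exact: measurable_enorm. Qed.

Let Dw_LHi i : (modular p q a K (fun x => Dw x 0 i)%R < +oo)%E.
Proof.
by apply: le_lt_trans Dw_LH; exact: (modular_coord p_gt1 p_le_q mK ma a_ge0 mK KK).
Qed.

Let iDw i : mu.-integrable K (EFin \o (fun x => Dw x 0 i)).
Proof. exact: (modular_integrable1 p_gt1 mK ma a_ge0 mK KK Koo (mDw i) (Dw_LHi i)). Qed.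

Let smooth_we e : 0 < e -> smooth (convol K w (moll e)).
Proof.
by move=> e0; exact: smooth_conv_moll.
Qed.

(** The kernel y -> [moll e (x - y)] is itself a test function, supported in the closed e-cube about
    x and so inside K. Testing the weak gradient with it gives the formula, the minus signs of
    integration by parts and of the reflection cancelling. *)
Lemma conv_weak e x i : 0 < e -> e < d0 -> B x ->
  'D_(evec R i) (convol K w (moll e)) x = convol K (fun y => Dw y 0 i) (moll e) x.
Proof.
move=> e0 ed Bx; rewrite conv_partial//; last 2 first.
- exact: smooth_moll.
- exact: bsupp_moll.
pose C := [set y | `|x - y| <= e].
have CK : C `<=` K by move=> y Cy; apply: BdK Bx _; exact: le_lt_trans ed.
have [|csC sC] := @closure_sub_compact _ _ [set y | moll e (x - y) != 0] C (@compact_cball _ _ x e).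
  move=> y /= /eqP my; rewrite /C /= leNgt; apply/negP => xy.
  by apply: my; rewrite moll_supp// ltW.
have tphi : test_function Om (fun y => moll e (x - y)).
  split; first by apply: smooth_refl; exact: smooth_moll.
  by split=> //; exact: subset_trans (subset_trans sC CK) KOm.
have nK y : ~ K y -> {near y, (fun y => moll e (x - y)) =1 cst 0}.
  by move=> nK; apply: out_support_near => /sC /CK.
have [_ _ /(_ _ tphi i)] := w_weak.
rewrite (@Rintegral_support _ _ _ _ K)//; last first.
  by move=> y /nK /(near_cst0_derive i)[_ ->]; rewrite mulr0.
rewrite (@Rintegral_support _ _ _ _ K Om (fun y => Dw y 0 i * _))//; last first.
  by move=> y /nK /(near_cst0_derive i)[-> _]; rewrite mulr0.
move=> H; apply: oppr_inj; rewrite -[RHS]H /convol -mulN1r -RintegralZl//; last first.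
  apply: (@integrable_conv _ _ _ mK w ('D_(evec R i) (moll e)) x) => //.
    by apply: smooth_continuous; apply: smooth_partial; exact: smooth_moll.
  by apply: bsupp_partial; exact: bsupp_moll.
apply: eq_Rintegral => y _.
rewrite (hasgradE (hasgrad_refl (smooth_grad (x - y) (smooth_moll e)))) !mxE.
by rewrite mulrN mulN1r.
Qed.

Let conv_le0 e x : 0 < e -> e < d0 -> ~ N x -> convol K w (moll e) x <= 0.
Proof.
move=> e0 ed nN; rewrite -[leRHS](_ : \int[mu]_(y in K) (cst 0 y) = 0); last first.
  by rewrite /Rintegral integral0.
apply: le_Rintegral => //; [exact: integrable_moll| |].
  by apply: (@integrable_bounded _ _ _ _ 0) => // y _; rewrite normr0.
move=> y Ky; have [xy|xy] := ltP `|x - y| e; last by rewrite moll_supp ?mulr0.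
by rewrite mulr_le0_ge0 ?moll_ge0// (w_le0 nN)// (lt_trans xy).
Qed.

(** Outside N, w is nonpositive throughout the e-neighbourhood, so its mollification is too and
    [soft d] sends it to exactly 0. The support is contained in the compact N. *)
Lemma test_function_soft d e : 0 < d -> 0 < e -> e < d0 ->
  test_function B (fun x => soft d (convol K w (moll e) x)).
Proof.
move=> d_0 e0 ed; split; first by apply: smooth_soft => //; exact: smooth_we.
have [|csN sN] := @closure_sub_compact _ _ [set x | soft d (convol K w (moll e) x) != 0] N cN.
  move=> x /= /eqP sx; apply: contrapT => nN; apply: sx.
  by apply: soft_le0 => //; exact: conv_le0.
by split=> //; exact: subset_trans sN NB.
Qed.

Let BdKe e x : e < d0 -> B x -> forall y, `|x - y| < e -> K y.
Proof. by move=> ed Bx y xy; apply: BdK Bx _; exact: lt_trans ed. Qed.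

Let mBK (h : E -> R) : measurable_fun K h -> measurable_fun B h.
Proof. exact: measurable_funS. Qed.

Definition posg x : E := if 0 < w x then Dw x else 0.

Let flat_continuous d (P : {poly R}) : 0 < d -> continuous (flat d P).
Proof.
move=> d_0 t; apply: differentiable_continuous; apply/derivable1_diffP.
by have := is_derive_flat d_0 P t => -[].
Qed.

Lemma measurable_dsoft d (h : E -> R) (D : set E) : 0 < d -> measurable_fun D h ->
  measurable_fun D (fun x => dsoft d (h x)).
Proof.
move=> d_0 mh; apply: (measurableT_comp _ mh); apply: continuous_measurable_fun.
exact: flat_continuous.
Qed.

(** The approximants are soft d (w_e). The parameters are chosen in order: d by dominated
    convergence, then the truncation level M of |Dw|, and only then e, which may depend on the
    Lipschitz constant of [dsoft d] and on M. *)
Lemma positive_part_approx (eta : R) : 0 < eta ->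
  exists g, [/\ test_function B g,
    (modular p q a B (fun x => Num.max (w x) 0 - g x)%R <= eta%:E)%E &
    forall i, (modular p q a B (fun x => posg x 0 i - 'D_(evec R i) g x)%R <= eta%:E)%E].
Proof.
move=> eta0.
have Boo : (mu B < +oo)%E.
  by apply: le_lt_trans Koo; apply: le_measure => //; rewrite inE.
pose b := fine (mu B); have b0 : 0 <= b by rewrite fine_ge0// measure_ge0.
have bE : mu B = b%:E by rewrite fineK// ge0_fin_numE ?measure_ge0.
pose H x := enorm (Dw x).
have H0 x : 0 <= H x by exact: enorm_ge0.
have wH i x : `|Dw x 0 i| <= H x by exact: coord_le_enorm.
have mH : measurable_fun B H by exact: mBK.
have HB : (modular p q a B H < +oo)%E.
  apply: le_lt_trans Dw_LH; apply: ge0_subset_integral => //.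
    exact: (measurable_phaseE p q mK ma mK KK mDwn).
  by move=> x Kx; rewrite lee_fin phase_ge0// a_ge0.
pose T := 2 `^ q; have T0 : 0 < T by rewrite powR_gt0.
(* Each use of [modularD] costs a factor T. The first summand covers the function, split into two
   pieces of energy s; the second covers the gradient, split into X1, X2, X3 with X2 split again. *)
pose S := 2 * T + T * (1 + T * (2 * T + 1)).
have S0 : 0 < S by rewrite !(addr_gt0, mulr_gt0).
pose s := eta / S; have s0 : 0 < s by rewrite divr_gt0.
have sS : s * S = eta by rewrite divfK// gt_eqF.
(* This cap on d ensures d <= 1 and (1 + A) d b <= s, a bound for the modular of the constant d over
   B, which dominates the error of [soft_max]. *)
pose c0 := Num.min 1 (s / ((1 + A) * (b + 1))).
have cden : 0 < (1 + A) * (b + 1) by rewrite mulr_gt0 ?(ltr_pwDl ltr01)// ltr_wpDl.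
have c00 : 0 < c0 by rewrite lt_min ltr01 divr_gt0.
pose dl (k : nat) := c0 * harmonic k.
have dl0 k : 0 < dl k by rewrite mulr_gt0// harmonic_gt0.
(* The gap between the indicator of w > 0 and [dsoft]; at w <= 0 both vanish exactly, so the set w =
   0 needs no special care. *)
pose c k x := if 0 < w x then 1 - dsoft (dl k) (w x) else 0.
have c01 k x : 0 <= c k x <= 1.
  rewrite /c; case: ifP; rewrite ?lexx ?ler01// => _.
  by rewrite subr_ge0 dsoft_le1//= gerBl dsoft_ge0.
have mwB : measurable_fun B w by exact: mBK.
have mc k : measurable_fun B (c k).
  have m1 : measurable_fun B (fun x => 1 - dsoft (dl k) (w x)).
    by apply: measurable_funB => //; exact: measurable_dsoft.
  have mw0 : measurable_fun B (fun x => 0 < w x) by exact: measurable_fun_ltr.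
  apply: (@measurable_fun_if _ _ _ _ (fun x => 1 - dsoft (dl k) (w x)) (cst (0 : R)) B mB (fun x => 0 < w x)) => //.
  by apply: measurable_funS m1 => // x [].
have cc0 x : B x -> c ^~ x @ \oo --> (0 : R).
  move=> _; rewrite /c; have [wx|wx] := ltP 0 (w x); last exact: cvg_cst.
  have hc : c0 / w x * harmonic k @[k --> \oo] --> (0 : R).
    by rewrite -(mulr0 (c0 / w x)); apply: cvgMr; exact: cvg_harmonic.
  apply: squeeze_cvgr hc; last exact: cvg_cst.
  apply: nearW => k; rewrite subr_ge0 dsoft_le1//=.
  by rewrite mulrAC; exact: dsoft_near1.
have [k Hk] := modular_dct p_gt1 p_le_q mK ma a_ge0 mB BK mH HB mc (fun k x _ => c01 k x) cc0 s0.
pose d := dl k; have d_0 : 0 < d by exact: dl0.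
have dc : d <= c0 by rewrite /d /dl ler_piMr ?(ltW c00)// /harmonic invf_le1// ler1n.
have d1 : d <= 1 by rewrite (le_trans dc)// ge_min lexx.
have ds : (1 + A) * d * b <= s.
  have : d <= s / ((1 + A) * (b + 1)) by rewrite (le_trans dc)// ge_min lexx orbT.
  rewrite ler_pdivlMr// => /(le_trans _); apply.
  rewrite mulrAC mulrC; apply: ler_wpM2l; first exact: ltW.
  by apply: ler_wpM2l; rewrite ?lerDl ?addr_ge0.
(* dsoft(w_e) - dsoft(w) is bounded by 1 but small only in L^1, and it multiplies the unbounded Dw.
   Against the tail of |Dw| the bound 1 is enough; against the bounded part L^1 smallness is. *)
have [M [t [M0 mt tH bM ts]]] := modular_truncate p_gt1 p_le_q mK ma a_ge0 mB BK mH HB s0.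
pose r x : R := H x - t x.
have {}bM x : `|r x| <= M by exact: bM.
have mr : measurable_fun B r by exact: measurable_funB.
have [C C0 HC] := flat_lipschitz d_0 (1 + d *: 'X).
pose P := M `^ (p - 1) + A * M `^ (q - 1).
have P0 : 0 <= P by rewrite addr_ge0 ?mulr_ge0 ?powR_ge0.
have Q0 : 0 <= P * (C * M) by rewrite !mulr_ge0.
(* C M |w_e - w| dominates the bounded part of X2, and P converts its L^1 norm into a modular. *)
have s' : 0 < s / (1 + P * (C * M)) by rewrite divr_gt0// ltr_pwDl.
have [d1' d1'0 L1] := conv_L1 n_gt0 mK cK mB BK Koo iw d00 BdK s'.
have [d2 d20 L2] := conv_LH n_gt0 p_gt1 p_le_q pq_bound mK ma a_ge0 L_ge0 a_lip cK Koo A0 aA mB BK d00 BdK mw w_LH s0.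
have [d3 d30 L3] := common_radius (fun i => conv_LH n_gt0 p_gt1 p_le_q pq_bound mK ma a_ge0 L_ge0 a_lip cK Koo A0 aA mB BK d00 BdK (mDw i) (Dw_LHi i) s0).
pose e := Num.min d0 (Num.min d1' (Num.min d2 d3)) / 2.
have min0 : 0 < Num.min d0 (Num.min d1' (Num.min d2 d3)) by rewrite !lt_min d00 d1'0 d20 d30.
have e0 : 0 < e by rewrite divr_gt0.
have : e < Num.min d0 (Num.min d1' (Num.min d2 d3)) by rewrite /e; lra.
rewrite !lt_min => /and4P[ed0 ed1 ed2 ed3].
have {}L1 := L1 e e0 ed1; have {}L2 := L2 e e0 ed2; have {}L3 := L3 e e0 ed3.
pose we := convol K w (moll e).
pose hi i : E -> R := convol K (fun y => Dw y 0 i) (moll e).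
have mconv h : mu.-integrable K (EFin \o h) -> measurable_fun B (convol K h (moll e)).
  exact: measurable_conv_moll.
have mwe : measurable_fun B we by exact: mconv.
have mhi i : measurable_fun B (hi i) by exact: mconv (iDw i).
have mhB i : measurable_fun B (fun x => Dw x 0 i) by exact: mBK.
have msoft h : measurable_fun B h -> measurable_fun B (fun x => soft d (h x)).
  move=> mh; apply: measurable_funM => //.
  by apply: (measurableT_comp _ mh); apply: continuous_measurable_fun; exact: flat_continuous.
have modD := modularD p_gt1 p_le_q mK ma a_ge0 mB BK.
have modle := modular_le p_gt1 p_le_q mK ma a_ge0 mB BK.
have mmax : measurable_fun B (fun x => Num.max (w x) 0) by exact: measurable_maxr.
have Ts : 0 < T * s by rewrite mulr_gt0.
have TTs : 0 < T * (T * s) by rewrite mulr_gt0.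
have TTTs : 0 < T * (T * (T * s)) by rewrite mulr_gt0.
have sSE : eta = 3 * (T * s) + T * (T * s) + 2 * (T * (T * (T * s))).
  by rewrite -sS /S; ring.
exists (fun x => soft d (we x)); split; first exact: test_function_soft.
  pose f1 x := Num.max (w x) 0 - soft d (w x); pose f2 x := soft d (w x) - soft d (we x).
  have mf1 : measurable_fun B f1 by apply: measurable_funB => //; exact: msoft.
  have mf2 : measurable_fun B f2 by apply: measurable_funB; exact: msoft.
  rewrite (_ : (fun x => Num.max (w x) 0 - _) = (fun x => f1 x + f2 x)); last first.
    by apply/funext => x; rewrite /f1 /f2; ring.
  apply: le_trans (modD _ _ mf1 mf2) _.
  have M1 : (modular p q a B f1 <= s%:E)%E.
    have f1d x : `|f1 x| <= d by exact: soft_max.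
    apply: (@le_trans _ _ (modular p q a B (cst d))).
      by apply: modle => // x _; rewrite (gtr0_norm d_0).
    apply: le_trans (modular_bounded p_gt1 p_le_q mK ma a_ge0 mB BK (A := A) (M := 1) _ _ _ ler01 A0) _ => //.
    - by move=> x /BK; exact: aA.
    - by move=> x _; rewrite /= (gtr0_norm d_0).
    rewrite !powR1 mulr1 (_ : (\int[mu]_(x in B) `|cst d x|%:E = (d * b)%:E)%E).
      by rewrite -EFinM lee_fin mulrA.
    under eq_integral do rewrite /= (gtr0_norm d_0).
    by rewrite integral_cst// [X in (_ * X = _)%E](_ : _ = b%:E).
  have M2 : (modular p q a B f2 <= s%:E)%E.
    apply: le_trans (ltW L2); apply: modle => //; first exact: measurable_funB.
    by move=> x _; rewrite [leRHS]distrC; exact: soft_lipschitz.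
  apply: (@le_trans _ _ (T%:E * (s + s)%:E)%E).
    by rewrite EFinD; apply: lee_wpmul2l; [rewrite lee_fin ltW|exact: leeD M1 M2].
  by rewrite -EFinM lee_fin sSE mulrDr; lra.
move=> i.
pose h : E -> R := fun x => Dw x 0 i.
have mh : measurable_fun B h by exact: mhB.
(* Telescoping of the gradient error: X1 replaces the indicator of w > 0 by dsoft(w), X2 replaces w
   by w_e inside [dsoft], and X3 replaces Dw by its mollification. *)
pose X1 x : R := c k x * h x.
pose X2 x := (dsoft d (w x) - dsoft d (we x)) * h x.
pose X3 x := dsoft d (we x) * (h x - hi i x).
have mds f : measurable_fun B f -> measurable_fun B (fun x => dsoft d (f x)) by exact: measurable_dsoft.
have mX1 : measurable_fun B X1 by exact: measurable_funM.
have mX2 : measurable_fun B X2 by apply: measurable_funM => //; apply: measurable_funB; exact: mds.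
have mX3 : measurable_fun B X3 by apply: measurable_funM; [exact: mds|exact: measurable_funB].
have -> : modular p q a B (fun x => posg x 0 i - 'D_(evec R i) (fun x => soft d (we x)) x) =
    modular p q a B (fun x => X1 x + (X2 x + X3 x)).
  apply: eq_integral => x /set_mem Bx; congr (phase _ _ _ _ _)%:E.
  have := hasgradE (hasgrad_comp (smooth_grad x (smooth_we e0)) (is_derive_soft d_0 _)) i.
  rewrite -/we => ->; rewrite !mxE conv_weak// -/(hi i x) /X1 /X2 /X3 /c -/d /posg.
  rewrite -/(we x) -/(h x); case: ifPn => [wx|]; first by rewrite -/(h x); ring.
  by rewrite -leNgt => wx; rewrite mxE (dsoft_le0 d wx); ring.
have M1 : (modular p q a B X1 <= s%:E)%E.
  apply: le_trans (ltW Hk); apply: modle => //; first exact: measurable_funM.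
  by move=> x _; rewrite /X1 !normrM ler_wpM2l// (ger0_norm (H0 x)); exact: wH.
have M3 : (modular p q a B X3 <= s%:E)%E.
  have mhi' : measurable_fun B (fun x => hi i x - h x) by exact: measurable_funB.
  apply: le_trans (ltW (L3 i)); apply: (modle _ _ mX3 mhi') => x _; rewrite /X3 normrM [leRHS]distrC ler_piMl//.
  by rewrite ger0_norm ?dsoft_ge0// dsoft_le1.
pose g x : R := `|dsoft d (w x) - dsoft d (we x)|.
have mg : measurable_fun B g.
  by apply: measurableT_comp => //; apply: measurable_funB; exact: mds.
have g0 x : 0 <= g x by exact: normr_ge0.
have g1 x : g x <= 1.
  have ds01 u : 0 <= dsoft d u <= 1 by rewrite dsoft_ge0//= dsoft_le1.
  by rewrite /g ler_norml; have := ds01 (w x); have := ds01 (we x); lra.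
pose gr x : R := g x * r x.
have mgr : measurable_fun B gr by exact: measurable_funM.
have grM x : `|gr x| <= M.
  by rewrite /gr normrM (ger0_norm (g0 x)) -[leRHS]mul1r ler_pM.
have M2 : (modular p q a B X2 <= (T * (s + s))%:E)%E.
  have mtr : measurable_fun B (fun x => `|t x| + `|gr x|).
    by apply: measurable_funD; exact: measurableT_comp.
  apply: (@le_trans _ _ (modular p q a B (fun x => (`|t x| + `|gr x|)%R))).
    apply: modle => // x _; rewrite [leRHS]ger0_norm ?addr_ge0// /X2 normrM -/(g x).
    apply: (@le_trans _ _ (g x * `|t x + r x|)).
      by apply: ler_wpM2l => //; rewrite /r addrC subrK (ger0_norm (H0 x)); exact: wH.
    rewrite (le_trans (ler_wpM2l _ (ler_normD _ _)))// mulrDr lerD//.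
      by rewrite ler_piMl.
    by rewrite /gr normrM (ger0_norm (g0 x)).
  have mt' : measurable_fun B (fun x => `|t x|) by exact: measurableT_comp.
  have mgr' : measurable_fun B (fun x => `|gr x|) by exact: measurableT_comp.
  apply: le_trans (modD _ _ mt' mgr') _.
  rewrite (EFinM T) EFinD; apply: lee_wpmul2l; first by rewrite lee_fin ltW.
  apply: leeD.
    by apply: le_trans (ltW ts); apply: modle => // x _; rewrite normr_id.
  apply: le_trans (modular_bounded p_gt1 p_le_q mK ma a_ge0 mB BK (A := A) (M := M) _ _ _ M0 A0) _ => //.
  - by move=> x /BK; exact: aA.
  - by move=> x _; rewrite normr_id.
  rewrite -/P; apply: (@le_trans _ _ (P%:E * ((C * M)%:E * (s / (1 + P * (C * M)))%:E))%E); last first.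
    by rewrite -!EFinM lee_fin mulrA mulrCA ler_piMr ?(ltW s0)// ler_pdivrMr ?ltr_pwDl// mul1r lerDr.
  apply: lee_wpmul2l; first by rewrite lee_fin.
  apply: (@le_trans _ _ ((C * M)%:E * \int[mu]_(x in B) `|we x - w x|%:E)%E); last first.
    by apply: lee_wpmul2l; [rewrite lee_fin mulr_ge0|exact: ltW].
  have mwd : measurable_fun B (fun x => `|we x - w x|%:E).
    by apply/measurable_EFinP; apply: measurableT_comp => //; exact: measurable_funB.
  rewrite -ge0_integralZl//; last by rewrite lee_fin mulr_ge0.
  apply: ge0_le_integral => //.
  - by apply/measurable_EFinP; exact: measurableT_comp.
  - exact: measurable_funeM.
  - move=> x _; rewrite -EFinM lee_fin normr_id /gr normrM (ger0_norm (g0 x)) mulrAC.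
    apply: ler_pM => //; rewrite distrC; exact: HC.
have mX23 : measurable_fun B (fun x => X2 x + X3 x) by exact: measurable_funD.
apply: le_trans (modD _ _ mX1 mX23) _.
have M23 : (modular p q a B (fun x => (X2 x + X3 x)%R) <= (T * (T * (s + s) + s))%:E)%E.
  apply: le_trans (modD _ _ mX2 mX3) _.
  by rewrite (EFinM T) (EFinD (T * _)); apply: lee_wpmul2l; [rewrite lee_fin ltW|exact: leeD M2 M3].
apply: (@le_trans _ _ (T%:E * (s + T * (T * (s + s) + s))%:E)%E).
  by rewrite (EFinD s); apply: lee_wpmul2l; [rewrite lee_fin ltW|exact: leeD M1 M23].
rewrite -EFinM lee_fin sSE.
have -> : T * (s + T * (T * (s + s) + s)) = T * s + T * (T * s) + 2 * (T * (T * (T * s))) by ring.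
lra.
Qed.

Let Boo : (mu B < +oo)%E.
Proof. by apply: le_lt_trans Koo; apply: le_measure => //; rewrite inE. Qed.

Let mwp : measurable_fun B (fun x => Num.max (w x) 0).
Proof. by apply: measurable_maxr => //; exact: mBK. Qed.

Let mposg i : measurable_fun B (fun x => posg x 0 i).
Proof.
rewrite (_ : (fun x => _) = (fun x => if 0 < w x then Dw x 0 i else 0)); last first.
  by apply/funext => x; rewrite /posg; case: ifP => // _; rewrite mxE.
have mw0 : measurable_fun B (fun x => 0 < w x) by apply: measurable_fun_ltr => //; exact: mBK.
apply: (@measurable_fun_if _ _ _ _ (fun x => Dw x 0 i) (cst (0 : R)) B mB (fun x => 0 < w x)) => //.
by apply: measurable_funS (mBK (mDw i)) => // x [].
Qed.

Let wp_LH : (modular p q a B (fun x => Num.max (w x) 0)%R < +oo)%E.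
Proof.
apply: (@le_lt_trans _ _ (modular p q a B w)).
  apply: (modular_le p_gt1 p_le_q mK ma a_ge0 mB BK) => //; first exact: mBK.
  move=> x _; rewrite ger0_norm ?le_max ?lexx ?orbT// ge_max ler_norm.
  by rewrite normr_ge0.
apply: le_lt_trans w_LH; apply: ge0_subset_integral => //.
  exact: (measurable_phaseE p q mK ma mK KK mw).
by move=> x Kx; rewrite lee_fin phase_ge0// a_ge0.
Qed.

Let posg_LH : (modular p q a B (fun x => enorm (posg x)) < +oo)%E.
Proof.
apply: (@le_lt_trans _ _ (modular p q a B (fun x => enorm (Dw x)))).
  apply: (modular_le p_gt1 p_le_q mK ma a_ge0 mB BK); [exact: measurable_enorm|exact: mBK|].
  move=> x _; rewrite /posg; case: ifP => // _.
  by rewrite /enorm (_ : dotv 0 0 = 0) ?sqrtr0 ?normr0// /dotv big1// => i _; rewrite mxE mul0r.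
apply: le_lt_trans Dw_LH; apply: ge0_subset_integral => //.
  exact: (measurable_phaseE p q mK ma mK KK mDwn).
by move=> x Kx; rewrite lee_fin phase_ge0// a_ge0.
Qed.

Let iwp : mu.-integrable B (EFin \o (fun x => Num.max (w x) 0)).
Proof. exact: (modular_integrable1 p_gt1 mK ma a_ge0 mB BK Boo mwp wp_LH). Qed.

Let iposg i : mu.-integrable B (EFin \o (fun x => posg x 0 i)).
Proof. exact: (integrable_coord p_gt1 p_le_q mK ma a_ge0 mB BK Boo i mposg posg_LH). Qed.

(** For the approximating test function g the identity is classical. The defect for w_+ is linear in
    w_+ - g and its gradient, both small in L^1 by their modulars. *)
Lemma positive_part_weak : weak_gradient B (fun x => Num.max (w x) 0) posg.
Proof.
have loc := integrable_locally_on mB; split; [exact: (loc _ iwp)|by move=> i; exact: (loc _ (iposg i))|move=> phi tphi i].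
have tDphi := test_function_partial i tphi.
have [C1 C10 HC1] := test_function_bounded tphi.
have [C2 C20 HC2] := test_function_bounded tDphi.
have mphi := test_function_measurable (D := B) tphi.
have mDphi := test_function_measurable (D := B) tDphi.
pose b := fine (mu B); have b0 : 0 <= b by rewrite fine_ge0// measure_ge0.
apply/eqP; rewrite -subr_eq0 opprK; apply/eqP.
set D := _ + _; apply: (@eq_small0 _ _ ((C2 + C1) * (b + 1))).
move=> lam l0 l1.
(* A modular at most lam^q gives a modular at most 1 after division by lam, hence an L^1 norm of
   order lam. *)
have [|g [tg Hg HDg]] := @positive_part_approx (lam `^ q); first exact: powR_gt0.
have [sg _] := tg.
have tDg := test_function_partial i tg.
have cDg := test_function_continuous tDg.
have ig := test_function_integrable mB tg.
have iDg := test_function_integrable mB tDg.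
have igd : mu.-integrable B (EFin \o (fun x => Num.max (w x) 0 - g x)) by exact: integrable_rB.
have iDgd : mu.-integrable B (EFin \o (fun x => posg x 0 i - 'D_(evec R i) g x)).
  exact: integrable_rB.
have parts := test_function_by_parts mB (fun x _ => smooth_grad x sg)
  (fun x _ => erefl) (fun x _ => cDg x) tphi.
have DE : D = \int[mu]_(x in B) ((Num.max (w x) 0 - g x) * 'D_(evec R i) phi x) +
              \int[mu]_(x in B) ((posg x 0 i - 'D_(evec R i) g x) * phi x).
  have i1 := integrable_mul_bounded mB iwp mDphi (fun x _ => HC2 x).
  have i2 := integrable_mul_bounded mB ig mDphi (fun x _ => HC2 x).
  have i3 := integrable_mul_bounded mB (iposg i) mphi (fun x _ => HC1 x).
  have i4 := integrable_mul_bounded mB iDg mphi (fun x _ => HC1 x).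
  under [in RHS]eq_Rintegral do rewrite mulrBl.
  under [X in _ = _ + X]eq_Rintegral do rewrite mulrBl.
  by rewrite !RintegralB// parts opprK addrACA subrr addr0.
have L1 f : measurable_fun B f -> (modular p q a B f <= (lam `^ q)%:E)%E ->
    (\int[mu]_(x in B) `|f x|%:E <= (lam * (b + 1))%:E)%E.
  move=> mf Hf; apply: (L1_le_modular p_gt1 mK ma a_ge0 mB BK Boo l0 mf).
  exact: (modular_scale p_le_q mK ma a_ge0 mB BK l0 l1 mf Hf).
rewrite DE (le_trans (ler_normD _ _))// [leRHS](_ : _ = C2 * (lam * (b + 1)) + C1 * (lam * (b + 1))); last by ring.
have m1 : measurable_fun B (fun x => Num.max (w x) 0 - g x).
  by apply/measurable_EFinP; exact: measurable_int igd.
have m2 : measurable_fun B (fun x => posg x 0 i - 'D_(evec R i) g x).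
  by apply/measurable_EFinP; exact: measurable_int iDgd.
apply: lerD.
  have X := Rintegral_mul_le mB igd mDphi (fun x _ => HC2 x) C20.
  exact: (X _ (L1 _ m1 Hg)).
have X := Rintegral_mul_le mB iDgd mphi (fun x _ => HC1 x) C10.
exact: (X _ (L1 _ m2 (HDg i))).
Qed.

Lemma positive_part_W1H0 : W1H0_with p q a B (fun x => Num.max (w x) 0) posg.
Proof.
split.
  split; [by split|exact: positive_part_weak|].
  by split=> //; exact: measurable_enorm.
move=> e e0.
pose lam := Num.min 1 (e / 3).
have l0 : 0 < lam by rewrite lt_min ltr01 divr_gt0.
have l1 : lam <= 1 by rewrite ge_min lexx.
(* Compensates the loss n^q n in passing from the coordinates of the gradient to its Euclidean norm.
   The two norms then add up to at most 2 lam <= 2 e / 3. *)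
pose c := 1 + n%:R `^ q * n%:R : R.
have c1 : 1 <= c by rewrite lerDl mulr_ge0 ?powR_ge0.
have c0 : 0 < c by rewrite (lt_le_trans ltr01).
have [|g [tg Hg HDg]] := @positive_part_approx (lam `^ q / c); first by rewrite divr_gt0 ?powR_gt0.
exists g => //.
have mg := test_function_measurable (D := B) tg.
have mDg i := test_function_measurable (D := B) (test_function_partial i tg).
have mgd i : measurable_fun B (fun x => (posg x - grad g x) 0 i).
  rewrite (_ : (fun x => _) = (fun x => posg x 0 i - 'D_(evec R i) g x)).
    exact: measurable_funB.
  by apply/funext => x; rewrite !mxE.
have lc : lam `^ q / c <= lam `^ q.
  by rewrite ler_pdivrMr// ler_peMr// powR_ge0.
have N1 : (LH_norm p q a B ((fun x => Num.max (w x) 0) \- g)%R <= lam%:E)%E.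
  apply: (LH_norm_le p_le_q mK ma a_ge0 mB BK l0 l1).
    exact: measurable_funB.
  by apply: le_trans Hg _; rewrite lee_fin.
have N2 : (LH_norm p q a B (fun x => enorm (posg x - grad g x))%R <= lam%:E)%E.
  apply: (LH_norm_le p_le_q mK ma a_ge0 mB BK l0 l1); first exact: measurable_enorm.
  apply: le_trans (modular_enorm p_gt1 p_le_q mK ma a_ge0 mB BK (s := lam `^ q / c) n_gt0 mgd _) _.
    move=> i; rewrite (_ : (fun x => _) = (fun x => posg x 0 i - 'D_(evec R i) g x)) ?HDg//.
    by apply/funext => x; rewrite !mxE.
  rewrite lee_fin [leLHS](_ : _ = lam `^ q * ((n%:R `^ q * n%:R) / c)); last by ring.
  by rewrite ler_piMr ?powR_ge0// ler_pdivrMr// mul1r lerDr.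
apply: (@le_lt_trans _ _ (lam%:E + lam%:E)%E); first exact: leeD N1 N2.
rewrite -EFinD lte_fin; have : lam <= e / 3 by rewrite ge_min lexx orbT.
by move=> H; lra.
Qed.

End positive_part.

(** The square root is absorbed in the exponent, so the chain rule applies to a power of a quadratic
    form that is positive away from 0. *)
Lemma enorm_powR (R : realType) n (xi : 'rV[R]_n) (r : R) :
  enorm xi `^ r = dotv xi xi `^ (2^-1 * r).
Proof. by rewrite /enorm -powR12_sqrt ?dotv_ge0// -powRrM. Qed.

Lemma dotv_gt0 (R : realType) n (xi : 'rV[R]_n) : xi != 0 -> 0 < dotv xi xi.
Proof.
move=> xi0; rewrite lt_neqAle dotv_ge0 andbT eq_sym; apply: contra xi0 => /eqP d0.
have : enorm xi = 0 by rewrite /enorm d0 sqrtr0.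
move=> e0; rewrite -normr_le0; have := norm_le_enorm xi.
by rewrite e0.
Qed.

(** * Classical subsolutions *)

Section flux_gradient.
Context (R : realType) (n : nat).
Local Notation E := 'rV[R]_n.
Implicit Types (x y : E) (G : E -> E) (X : 'M[R]_n).

Lemma hasgrad_enorm_powR G X x (r : R) : G x != 0 ->
  (forall i, hasgrad (fun y => G y 0 i) x (row i X)) ->
  hasgrad (fun y => enorm (G y) `^ r) x
    ((r * enorm (G x) `^ r / dotv (G x) (G x)) *: (G x *m X)).
Proof.
move=> Gx HG.
have s0 : 0 < dotv (G x) (G x) by exact: dotv_gt0.
have Hs : hasgrad (fun y => dotv (G y) (G y)) x (2 *: (G x *m X)).
  have H := hasgrad_sum (index_enum 'I_n) (fun i => hasgradM (HG i) (HG i)).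
  rewrite (_ : 2 *: _ = \sum_i (G x 0 i *: row i X + G x 0 i *: row i X)) //.
  rewrite mulmx_sum_row scaler_sumr; apply: eq_bigr => i _.
  by rewrite scaler_nat mulr2n.
have := hasgrad_comp Hs (is_derive1_powR (2^-1 * r) s0).
move=> /(hasgrad_ext (fun y => esym (enorm_powR (G y) r))).
rewrite scalerA enorm_powR powRB ?(gt_eqF s0) ?implybT// powRr1 ?(ltW s0)//.
by congr (hasgrad _ _ (_ *: _)); field; rewrite gt_eqF.
Qed.

End flux_gradient.

Lemma open_continuous_measurable (R : realType) n (B : set 'rV[R]_n) (g : 'rV[R]_n -> R) :
  open B -> (forall x, B x -> {for x, continuous g}) -> measurable_fun B g.
Proof.
move=> oB cg; apply: (measurability _ (RGenOInfty.measurableE R)).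
move=> _ [_ [c ->] <-]; apply: measurable_rV_open.
rewrite openE => x [Bx gx]; apply: filterI; first exact: open_nbhs_nbhs.
by apply: (cg x Bx); apply: open_nbhs_nbhs; split => //; exact: interval_open.
Qed.

Lemma le_Rintegral_ae d (T : measurableType d) (R : realType) (mu : {measure set T -> \bar R})
  (B : set T) (F f phi : T -> R) : measurable B ->
  mu.-integrable B (EFin \o (fun x => F x * phi x)) ->
  mu.-integrable B (EFin \o (fun x => f x * phi x)) ->
  (forall x, B x -> F x <= f x) -> {ae mu, forall x, B x -> 0 <= phi x} ->
  \int[mu]_(x in B) (F x * phi x) <= \int[mu]_(x in B) (f x * phi x).
Proof.
move=> mB iF jf Ff phi0; rewrite -subr_ge0 -RintegralB//.
pose h x := f x * phi x - F x * phi x.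
have jh : mu.-integrable B (EFin \o h) by exact: integrable_rB.
have mh : measurable_fun B h by apply/measurable_EFinP; exact: measurable_int jh.
(* phi is nonnegative only almost everywhere; the integrand may be replaced by its positive part,
   which is nonnegative at every point. *)
rewrite /Rintegral (_ : (\int[mu]_(x in B) _ = \int[mu]_(x in B) (Num.max (h x) 0)%:E)%E).
  by apply: fine_ge0; apply: integral_ge0 => x _; rewrite lee_fin le_max lexx orbT.
apply: ae_eq_integral => //; first exact/measurable_EFinP.
  by apply/measurable_EFinP; exact: measurable_maxr.
apply: filterS phi0 => x + Bx => /(_ Bx) phix; congr EFin.
by rewrite max_l// /h -mulrBl mulr_ge0// subr_ge0 Ff.
Qed.

Section classical_subsolution.
Context (R : realType) (n : nat) (n_gt0 : (0 < n)%N).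
Local Notation E := 'rV[R]_n.
Local Notation mu := (lebesgue_rV R n).
Context (p q : R) (p_gt1 : 1 < p) (p_le_q : p <= q) (a : E -> R).
Context (K : set E) (cK : compact K) (ma : measurable_fun K a).
Hypothesis a_ge0 : forall x, K x -> 0 <= a x.
Hypothesis a_diff : forall x, K x -> differentiable a x.
Hypothesis a_C1 : forall x, K x -> {for x, continuous (grad a)}.
Context (B : set E) (oB : open B) (BK : B `<=` K).
Context (v : E -> R) (Dv : E -> E) (X : 'M[R]_n) (XT : X^T = X).
Hypothesis v_grad : forall x, hasgrad v x (Dv x).
Hypothesis Dv_grad : forall i x, hasgrad (fun y => Dv y 0 i) x (row i X).
Hypothesis Dv_neq0 : forall x, K x -> Dv x != 0.
Implicit Types (x y : E) (i : 'I_n) (r : R).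

Let mK : measurable K.
Proof.
exact: compact_rV_measurable.
Qed.

Let mB : measurable B. Proof. exact: measurable_rV_open. Qed.

Let N r x := enorm (Dv x) `^ r.
Let s x := dotv (Dv x) (Dv x).
Let V i x := flux p q a x (Dv x) 0 i.
(** With D^2 v = X, [dN r i] is the i-th partial derivative of |Dv|^r, and [dV i] below is the i-th
    partial derivative of the i-th component of the flux, so that the sum of the [dV i] is the
    divergence. *)
Let dN r i x := r * N r x / s x * (Dv x *m X) 0 i.
Let dV i x := (dN (p - 2) i x + (a x * dN (q - 2) i x + N (q - 2) x * grad a x 0 i)) * Dv x 0 i
  + (N (p - 2) x + a x * N (q - 2) x) * X i i.

Let N_grad r x : K x -> hasgrad (N r) x ((r * N r x / s x) *: (Dv x *m X)).
Proof. by move=> Kx; apply: hasgrad_enorm_powR => //; exact: Dv_neq0. Qed.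

Let V_grad i x : K x -> exists2 g, hasgrad (V i) x g & g 0 i = dV i x.
Proof.
move=> Kx.
have H := hasgradM (hasgradD (N_grad (p - 2) Kx)
  (hasgradM (differentiable_hasgrad (a_diff Kx)) (N_grad (q - 2) Kx))) (Dv_grad i x).
exists ((N (p - 2) x + a x * N (q - 2) x) *: row i X +
  Dv x 0 i *: ((p - 2) * N (p - 2) x / s x *: (Dv x *m X) +
   (a x *: ((q - 2) * N (q - 2) x / s x *: (Dv x *m X)) + N (q - 2) x *: grad a x))).
  by apply: hasgrad_ext H => y; rewrite /V /flux !mxE mulrDl.
by rewrite /dV /dN !mxE; ring.
Qed.

(** Expanding the divergence gives a trace term, a term in the second derivative along Dv and a term
    with the gradient of [a]: the three parts of the viscosity operator. Division by |Dv| is why Dv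
    must not vanish on K. *)
Let sum_dV x : K x -> - \sum_i dV i x = viscosity_op p q a x (Dv x) X.
Proof.
move=> Kx; rewrite /viscosity_op.
have s0 : 0 < s x by apply: dotv_gt0; exact: Dv_neq0.
have en : enorm (Dv x) != 0 by rewrite gt_eqF// /enorm sqrtr_gt0.
set e := _ *: Dv x; pose Q := dotv (Dv x *m X) (Dv x).
have QE : quad X e e = Q / s x.
  rewrite /quad /e XT -scalemxAl dotvZl dotvZr mulrA -/Q mulrC; congr (_ * _).
  by rewrite -expr2 exprVn sqr_enorm.
rewrite QE -/(N (p - 2) x) -/(N (q - 2) x).
have E1 r : \sum_i dN r i x * Dv x 0 i = r * N r x * (Q / s x).
  rewrite /dN /Q /dotv mulr_suml mulr_sumr; apply: eq_bigr => i _; ring.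
have -> : \sum_i dV i x = \sum_i dN (p - 2) i x * Dv x 0 i
    + a x * (\sum_i dN (q - 2) i x * Dv x 0 i)
    + N (q - 2) x * dotv (Dv x) (grad a x) + (N (p - 2) x + a x * N (q - 2) x) * \tr X.
  rewrite /dotv /mxtrace !mulr_sumr -!big_split/=; apply: eq_bigr => i _.
  by rewrite /dV; ring.
rewrite !E1; ring.
Qed.

Let N_cont r x : K x -> {for x, continuous (N r)}.
Proof. by move=> Kx; apply: hasgrad_continuous (N_grad r Kx). Qed.

Let Dv_cont i x : {for x, continuous (fun y => Dv y 0 i)}.
Proof. exact: hasgrad_continuous (Dv_grad i x). Qed.

Let DvX_cont i x : {for x, continuous (fun y => (Dv y *m X) 0 i)}.
Proof.
rewrite (_ : (fun y => _) = (fun y => \sum_j Dv y 0 j * X j i)).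
  by apply: continuous_at_fsum => j; apply: continuousM; [exact: Dv_cont|exact: cst_continuous].
by apply/funext => y; rewrite mxE.
Qed.

Let s_cont x : {for x, continuous s}.
Proof.
by apply: continuous_at_fsum => j; apply: continuousM; exact: Dv_cont.
Qed.

Let a_cont x : K x -> {for x, continuous a}.
Proof. by move=> Kx; apply: differentiable_continuous; exact: a_diff. Qed.

Let grad_a_cont i x : K x -> {for x, continuous (fun y => grad a y 0 i)}.
Proof.
move=> Kx; apply: (@continuous_comp _ _ _ (grad a) (fun z : E => z 0 i)); first exact: a_C1.
exact: continuous_coord.
Qed.

Let V_cont i x : K x -> {for x, continuous (V i)}.
Proof. by move=> Kx; have [g Hg _] := V_grad i Kx; exact: hasgrad_continuous Hg. Qed.

Let dN_cont r i x : K x -> {for x, continuous (dN r i)}.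
Proof.
move=> Kx; have s0 : s x != 0 by rewrite gt_eqF//; apply: dotv_gt0; exact: Dv_neq0.
apply: continuousM; last exact: DvX_cont.
apply: continuousM; last by apply: continuousV => //; exact: s_cont.
by apply: continuousM; [exact: cst_continuous|exact: N_cont].
Qed.

Let dV_cont i x : K x -> {for x, continuous (dV i)}.
Proof.
move=> Kx; apply: continuousD.
  apply: continuousM; last exact: Dv_cont.
  apply: continuousD; first exact: dN_cont.
  apply: continuousD; first by apply: continuousM; [exact: a_cont|exact: dN_cont].
  by apply: continuousM; [exact: N_cont|exact: grad_a_cont].
apply: continuousM; last exact: cst_continuous.
apply: continuousD; first exact: N_cont.
by apply: continuousM; [exact: a_cont|exact: N_cont].
Qed.

Let F x := - \sum_i dV i x.

Lemma flux_by_parts psi : test_function B psi ->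
  \int[mu]_(x in B) dotv (flux p q a x (Dv x)) (grad psi x) = \int[mu]_(x in B) (F x * psi x).
Proof.
move=> tpsi.
have Vg i x : B x -> hasgrad (V i) x (grad (V i) x).
  by move=> /BK Kx; have [g Hg _] := V_grad i Kx; rewrite (hasgrad_grad Hg).
have dVg i x : B x -> 'D_(evec R i) (V i) x = dV i x.
  by move=> /BK Kx; have [g Hg <-] := V_grad i Kx; rewrite (hasgradE Hg).
have dVc i x : B x -> {for x, continuous (dV i)} by move=> /BK; exact: dV_cont.
have Vc i x : B x -> {for x, continuous (V i)} by move=> /BK; exact: V_cont.
have H i := test_function_by_parts mB (Vg i) (dVg i) (dVc i) tpsi.
transitivity (\sum_i \int[mu]_(x in B) (V i x * 'D_(evec R i) psi x)).
  rewrite -Rintegral_sum//; last first.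
    move=> i; apply: (test_mul_integrable mB (test_function_partial i tpsi)).
  exact: Vc.
  by apply: eq_Rintegral => x _; apply: eq_bigr => i _; rewrite [grad psi x 0 i]mxE.
rewrite (eq_bigr _ (fun i _ => H i)) sumrN -Rintegral_sum//; last first.
  by move=> i; apply: (test_mul_integrable mB tpsi); exact: dVc.
rewrite -mulN1r -RintegralZl//; last first.
  by apply: integrable_fsum => // i; apply: (test_mul_integrable mB tpsi); exact: dVc.
by apply: eq_Rintegral => x _; rewrite /F mulN1r mulNr mulr_suml.
Qed.

Context (Boo : (mu B < +oo)%E).

Let continuous_LH (Om : set E) (g : E -> R) : open Om -> Om `<=` B -> continuous g ->
  LH p q a Om g /\ mu.-integrable Om (EFin \o g).
Proof.
move=> oOm OB cg; have mOm : measurable Om by exact: measurable_rV_open.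
have OK := subset_trans OB BK.
have Ooo : (mu Om < +oo)%E by apply: le_lt_trans Boo; apply: le_measure => //; rewrite inE.
have mg : measurable_fun Om g by exact: continuous_rV_measurable.
have [M M0 HM] := continuous_at_bounded cK (fun x _ => cg x).
have [A A0 HA] := continuous_at_bounded cK a_cont.
have ig : mu.-integrable Om (EFin \o g).
  by apply: (integrable_bounded mOm Ooo mg (C := M)) => x /OK; exact: HM.
split=> //; split=> //.
apply: le_lt_trans (modular_bounded p_gt1 p_le_q mK ma a_ge0 mOm OK (A := A) (M := M) _ mg _ M0 A0) _.
- by move=> x /OK Kx; rewrite (le_trans (ler_norm _))// HA.
- by move=> x /OK; exact: HM.
have [_ foo] := integrableP _ _ _ ig.
apply: lte_mul_pinfty => //; first by rewrite lee_fin addr_ge0 ?mulr_ge0 ?powR_ge0.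
Qed.

Lemma smooth_W1H (Om : set E) : open Om -> Om `<=` B -> W1H_with p q a Om v Dv.
Proof.
move=> oOm OB; have mOm : measurable Om by exact: measurable_rV_open.
have cv : continuous v by move=> x; exact: hasgrad_continuous (v_grad x).
have loc (g : E -> R) : continuous g -> locally_integrable_on Om g.
  by move=> cg; exact: (integrable_locally_on mOm (continuous_LH oOm OB cg).2).
split.
- exact: (continuous_LH oOm OB cv).1.
- split; [exact: loc|by move=> i; apply: loc => x; exact: Dv_cont|].
  move=> phi tphi i; apply: test_function_by_parts tphi => //.
  + by move=> x _; rewrite (hasgrad_grad (v_grad x)).
  + by move=> x _; rewrite (hasgradE (v_grad x)).
- apply: (continuous_LH oOm OB _).1 => x.
  apply: (@continuous_comp _ _ _ s (@Num.sqrt R)); first exact: s_cont.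
  exact: sqrt_continuous.
Qed.

Let F_op x : K x -> F x = viscosity_op p q a x (Dv x) X.
Proof. exact: sum_dV. Qed.

Let F_cont x : K x -> {for x, continuous F}.
Proof.
move=> Kx; apply: continuousN.
by apply: continuous_at_fsum => i; exact: dV_cont.
Qed.

Lemma viscosity_op_continuous x : B x ->
  {for x, continuous (fun y => viscosity_op p q a y (Dv y) X)}.
Proof.
move=> Bx.
have E1 : {near x, F =1 fun y => viscosity_op p q a y (Dv y) X}.
  have : nbhs x B by exact: open_nbhs_nbhs.
  by apply: filterS => y /BK; exact: F_op.
have Fx : F y @[y --> x] --> viscosity_op p q a x (Dv x) X.
  by rewrite -(F_op (BK Bx)); exact: F_cont (BK Bx).
apply: cvg_trans Fx; apply: (@near_eq_cvg _ _ (nbhs x) (nbhs_filter x)).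
by apply: (filterS _ E1) => y ->.
Qed.

(** Density: both sides are continuous for the W^{1,H} norm because the flux components and F are
    bounded on the compact K, and smallness in norm gives smallness in L^1. *)
Lemma flux_by_parts_W1H0 phi Dphi : W1H0_with p q a B phi Dphi ->
  mu.-integrable B (EFin \o (fun x => F x * phi x)) /\
  \int[mu]_(x in B) dotv (flux p q a x (Dv x)) (Dphi x) = \int[mu]_(x in B) (F x * phi x).
Proof.
move=> [[[mphi phioo] [_ locD _] [mDn Dphioo]] Happ].
have mDphi i : measurable_fun B (fun x => Dphi x 0 i) by have [] := locD i.
have iphi : mu.-integrable B (EFin \o phi).
  exact: (modular_integrable1 p_gt1 mK ma a_ge0 mB BK Boo mphi phioo).
have iDphi i := integrable_coord p_gt1 p_le_q mK ma a_ge0 mB BK Boo i mDphi Dphioo.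
have [CF CF0 HCF] := continuous_at_bounded cK F_cont.
have HV i : exists C : R, 0 <= C /\ forall x, K x -> `|V i x| <= C.
  by have [C C0 HC] := continuous_at_bounded cK (@V_cont i); exists C.
pose CV i := sval (cid (HV i)); have CV0 i : 0 <= CV i by exact: (svalP (cid (HV i))).1.
have HCV i x : B x -> `|V i x| <= CV i by move=> /BK; exact: (svalP (cid (HV i))).2.
have {}HCF x : B x -> `|F x| <= CF by move=> /BK; exact: HCF.
have mF : measurable_fun B F by apply: open_continuous_measurable => // x /BK; exact: F_cont.
have mV i : measurable_fun B (V i).
  by apply: open_continuous_measurable => // x /BK; exact: V_cont.
have mulF g : mu.-integrable B (EFin \o g) -> mu.-integrable B (EFin \o (fun x => F x * g x)).
  move=> ig; apply: eq_integrable (integrable_mul_bounded mB ig mF HCF) => // x _ /=.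
  by rewrite mulrC.
have mulV i g : mu.-integrable B (EFin \o g) -> mu.-integrable B (EFin \o (fun x => V i x * g x)).
  move=> ig; apply: eq_integrable (integrable_mul_bounded mB ig (mV i) (@HCV i)) => // x _ /=.
  by rewrite mulrC.
split; first exact: mulF.
apply/eqP; rewrite -subr_eq0; apply/eqP; set D := _ - _.
pose b := fine (mu B).
apply: (@eq_small0 _ _ ((\sum_i CV i + CF) * (b + 1))) => e e0 e1.
have [psi tpsi Hpsi] := Happ e e0.
have ipsi := test_function_integrable mB tpsi.
have iDpsi i := test_function_integrable mB (test_function_partial i tpsi).
have idif : mu.-integrable B (EFin \o (fun x => phi x - psi x)) by exact: integrable_rB.
have iDdif i : mu.-integrable B (EFin \o (fun x => Dphi x 0 i - 'D_(evec R i) psi x)).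
  exact: integrable_rB.
have dotE (G : E -> E) : (forall i, mu.-integrable B (EFin \o (fun x => G x 0 i))) ->
    \int[mu]_(x in B) dotv (flux p q a x (Dv x)) (G x) = \sum_i \int[mu]_(x in B) (V i x * G x 0 i).
  by move=> iG; rewrite -Rintegral_sum// => i; exact: mulV.
have DE : D = \sum_i \int[mu]_(x in B) ((Dphi x 0 i - 'D_(evec R i) psi x) * V i x)
              - \int[mu]_(x in B) ((phi x - psi x) * F x).
  have E1 i : \int[mu]_(x in B) ((Dphi x 0 i - 'D_(evec R i) psi x) * V i x) =
      \int[mu]_(x in B) (V i x * Dphi x 0 i) - \int[mu]_(x in B) (V i x * 'D_(evec R i) psi x).
    rewrite -RintegralB//; [|exact: mulV|exact: mulV].
    by apply: eq_Rintegral => x _; rewrite mulrC mulrBr.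
  have E2 : \int[mu]_(x in B) ((phi x - psi x) * F x) =
      \int[mu]_(x in B) (F x * phi x) - \int[mu]_(x in B) (F x * psi x).
    rewrite -RintegralB//; [|exact: mulF|exact: mulF].
    by apply: eq_Rintegral => x _; rewrite mulrC mulrBr.
  have E3 : \sum_i \int[mu]_(x in B) (V i x * 'D_(evec R i) psi x) = \int[mu]_(x in B) (F x * psi x).
    rewrite -(flux_by_parts tpsi) dotE.
      by apply: eq_bigr => i _; apply: eq_Rintegral => x _; rewrite [grad psi x 0 i]mxE.
    move=> i; apply: eq_integrable (iDpsi i) => // x _ /=.
    by rewrite [grad psi x 0 i]mxE.
  rewrite E2 (eq_bigr _ (fun i _ => E1 i)) sumrB E3 /D (dotE _ iDphi).
  by rewrite opprB addrA subrK.
have L1 g : measurable_fun B g -> (LH_norm p q a B g < e%:E)%E ->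
    (\int[mu]_(x in B) `|g x|%:E <= (e * (b + 1))%:E)%E.
  move=> mg /LH_norm_lt[lam [l0 le Hlam]].
  apply: le_trans (L1_le_modular p_gt1 mK ma a_ge0 mB BK Boo l0 mg Hlam) _.
  by rewrite lee_fin ler_wpM2r ?(ltW le)// addr_ge0// fine_ge0.
have mdif : measurable_fun B (phi \- psi).
  by apply/measurable_EFinP; exact: measurable_int idif.
have mDdif i : measurable_fun B (fun x => (Dphi x - grad psi x) 0 i).
  rewrite (_ : (fun x => _) = (fun x => Dphi x 0 i - 'D_(evec R i) psi x)).
    by apply/measurable_EFinP; exact: measurable_int (iDdif i).
  by apply/funext => x; rewrite !mxE.
have n0 := LH_norm_ge0 p q a B.
have N1 : (LH_norm p q a B (phi \- psi)%R < e%:E)%E.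
  by apply: le_lt_trans Hpsi; rewrite /W1H_norm leeDl.
have N2 : (LH_norm p q a B (fun x => enorm (Dphi x - grad psi x))%R < e%:E)%E.
  by apply: le_lt_trans Hpsi; rewrite /W1H_norm leeDr.
have mDe := measurable_enorm mDdif.
have I2 i : (\int[mu]_(x in B) `|Dphi x 0 i - 'D_(evec R i) psi x|%:E <= (e * (b + 1))%:E)%E.
  apply: le_trans (L1 _ mDe N2); apply: ge0_le_integral => //.
  - by apply/measurable_EFinP; apply: measurableT_comp => //; apply/measurable_EFinP; exact: measurable_int (iDdif i).
  - by apply/measurable_EFinP; exact: measurableT_comp.
  - move=> x _; rewrite lee_fin (ger0_norm (enorm_ge0 _)).
    by have := coord_le_enorm (Dphi x - grad psi x) i; rewrite !mxE.
have B1 i : `|\int[mu]_(x in B) ((Dphi x 0 i - 'D_(evec R i) psi x) * V i x)| <= CV i * (e * (b + 1)).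
  have H := Rintegral_mul_le mB (iDdif i) (mV i) (@HCV i) (CV0 i).
  exact: (H _ (I2 i)).
have B2 : `|\int[mu]_(x in B) ((phi x - psi x) * F x)| <= CF * (e * (b + 1)).
  have H := Rintegral_mul_le mB idif mF HCF CF0.
  exact: (H _ (L1 _ mdif N1)).
rewrite DE (le_trans (ler_normB _ _))//.
rewrite [leRHS](_ : _ = \sum_i (CV i * (e * (b + 1))) + CF * (e * (b + 1))); last first.
  by rewrite -mulr_suml; ring.
apply: lerD => //; apply: le_trans (ler_norm_sum _ _ _) _.
by apply: ler_sum => i _.
Qed.

(** After integration by parts the claim is the pointwise inequality multiplied by phi >= 0. *)
Lemma classical_weak_subsolution (f : E -> R -> E -> R) :
  (forall x, B x -> viscosity_op p q a x (Dv x) X <= f x (v x) (Dv x)) ->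
  weak_subsolution p q a f B v.
Proof.
move=> Ff; split.
  move=> Om [oOm _ _] [_ clO]; exists Dv; apply: smooth_W1H => //.
  by apply: subset_trans clO; exact: subset_closure.
exists Dv; first by have [] := smooth_W1H oB (@subset_refl _ B).
move=> phi Dphi Hphi phi0 _ ifphi.
have [iF ->] := flux_by_parts_W1H0 Hphi.
apply: le_Rintegral_ae => // x Bx.
by rewrite F_op ?Ff//; exact: BK.
Qed.

End classical_subsolution.

(** * Comparison on a small cube *)

Section cubes.
Context (R : realType) (n : nat).
Local Notation E := 'rV[R]_n.
Implicit Types (x y : E) (r : R).

Lemma in_ballP x r y : ball x r y <-> `|x - y| < r.
Proof. by rewrite -ball_normE. Qed.

Lemma closure_ball_cball x r : closure (ball x r) `<=` [set y | `|x - y| <= r].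
Proof.
by apply: (closure_sub_compact (@compact_cball _ _ x r) _).2 => y /in_ballP /ltW.
Qed.

Lemma line_continuous x v : continuous (fun t : R => x + t *: v).
Proof.
apply: rV_continuous => i t.
rewrite (_ : (fun t => _) = (fun t : R => x 0 i + t * v 0 i)).
  by apply: cvgD; [exact: cvg_cst|apply: cvgMl; exact: cvg_id].
by apply/funext => s; rewrite !mxE.
Qed.

(** Connectedness holds because the cube is the union of segments issuing from its centre. *)
Lemma ball_domain x r : 0 < r -> domain (ball x r).
Proof.
move=> r0; split; [exact: ball_open| |by exists x; exact: ballxx].
pose A y : set E := (fun t : R => x + t *: (y - x)) @` `[0, 1].
have -> : ball x r = \bigcup_(y in ball x r) A y.
  apply/seteqP; split=> [y By|_ [y By [t /= t01 <-]]].
    by exists y => //; exists 1; rewrite /= ?in_itv/= ?ler01 ?lexx// scale1r addrC subrK.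
  move: By t01; rewrite in_itv/= => /in_ballP By /andP[t0 t1]; apply/in_ballP.
  rewrite opprD addNKr -scalerN opprB normrZ (ger0_norm t0).
  by apply: le_lt_trans By; rewrite ler_piMl.
apply: bigcup_connected.
  by exists x => y _; exists 0; rewrite /= ?in_itv/= ?lexx ?ler01// scale0r addr0.
move=> y _; apply: connected_continuous_connected; first exact: segment_connected.
by apply: continuous_subspaceT; exact: line_continuous.
Qed.

Lemma cball_segment x r y z (t : R) : `|x - y| <= r -> `|x - z| <= r -> 0 <= t -> t <= 1 ->
  `|x - (y + t *: (z - y))| <= r.
Proof.
move=> yr zr t0 t1.
have -> : x - (y + t *: (z - y)) = (1 - t) *: (x - y) + t *: (x - z).
  by apply/rowP => i; rewrite !mxE; ring.
have u0 : 0 <= 1 - t by rewrite subr_ge0.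
rewrite (le_trans (ler_normD _ _))// !normrZ (ger0_norm t0) (ger0_norm u0).
have -> : r = (1 - t) * r + t * r by ring.
by rewrite lerD// ler_wpM2l.
Qed.

(** Convexity keeps the segment between two points inside the compact cube, where the gradient of
    [a] is bounded; the mean value theorem does the rest. *)
Lemma cball_lipschitz (a : E -> R) x r :
  (forall y, `|x - y| <= r -> differentiable a y /\ {for y, continuous (grad a)}) ->
  exists2 L : R, 0 <= L & forall y z, `|x - y| <= r -> `|x - z| <= r ->
    `|a y - a z| <= L * `|y - z|.
Proof.
move=> aC; pose K := [set y | `|x - y| <= r].
have cK : compact K by exact: compact_cball.
have gc i y : K y -> {for y, continuous (fun z => grad a z 0 i)}.
  move=> Ky; apply: (@continuous_comp _ _ _ (grad a) (fun z : E => z 0 i)).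
    exact: (aC y Ky).2.
  exact: continuous_coord.
have HC i : exists C : R, 0 <= C /\ forall y, K y -> `|grad a y 0 i| <= C.
  by have [C C0 HC] := continuous_at_bounded cK (gc i); exists C.
pose C i := sval (cid (HC i)).
have C0 i : 0 <= C i by exact: (svalP (cid (HC i))).1.
have CP i y : K y -> `|grad a y 0 i| <= C i by exact: (svalP (cid (HC i))).2.
exists (\sum_i C i); first exact: sumr_ge0.
move=> z y Kz Ky.
have seg t : 0 <= t -> t <= 1 -> K (y + t *: (z - y)) by exact: cball_segment.
have dl (t : R) : 0 <= t -> t <= 1 ->
    is_derive t 1 (fun s : R => a (y + s *: (z - y))) (dotv (grad a (y + t *: (z - y))) (z - y)).
  move=> t0 t1; apply: is_derive_line; apply: differentiable_hasgrad.
  by have [] := aC _ (seg t t0 t1).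
have [t||c] := @MVT_segment R (fun s : R => a (y + s *: (z - y)))
  (fun t => dotv (grad a (y + t *: (z - y))) (z - y)) 0 1 ler01.
- by rewrite in_itv/= => /andP[/ltW t0 /ltW t1]; exact: dl.
- apply: derivable_within_continuous => t; rewrite in_itv/= => /andP[t0 t1].
  by have [] := dl t t0 t1.
rewrite in_itv/= => /andP[c0 c1]; rewrite scale1r scale0r addr0 subr0 mulr1.
rewrite [y + (z - y)]addrC subrK => ->; rewrite (le_trans (normr_dotv_le _ _))//.
by rewrite ler_wpM2r//; apply: ler_sum => i _; apply: CP; exact: seg.
Qed.

End cubes.

Section quadratic.
Context (R : realType) (n : nat).
Local Notation E := 'rV[R]_n.
Context (x0 eta : E) (X : 'M[R]_n) (XT : X^T = X) (c : R).
Implicit Types (x y : E).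

Lemma mulmx_sym_dotv x i : (x *m X) 0 i = dotv (row i X) x.
Proof.
rewrite mxE; apply: eq_bigr => j _; rewrite !mxE mulrC; congr (_ * _).
by rewrite -[in LHS]XT mxE.
Qed.

Lemma hasgrad_mulmx i x : hasgrad (fun y => ((y - x0) *m X) 0 i) x (row i X).
Proof.
have := hasgradB (hasgrad_dotv (row i X) x) (hasgrad_cst (dotv (row i X) x0) x).
rewrite subr0; apply: hasgrad_ext => y.
by rewrite mulmx_sym_dotv dotvBr.
Qed.

Lemma hasgrad_affine i x : hasgrad (fun y => (eta + (y - x0) *m X) 0 i) x (row i X).
Proof.
have := hasgradD (hasgrad_cst (eta 0 i) x) (hasgrad_mulmx i x).
by rewrite add0r; apply: hasgrad_ext => y; rewrite [RHS]mxE.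
Qed.

Lemma hasgrad_quadratic x :
  hasgrad (fun y => c + dotv eta (y - x0) + 2^-1 * quad X (y - x0) (y - x0)) x
    (eta + (x - x0) *m X).
Proof.
have hq : hasgrad (fun y => quad X (y - x0) (y - x0)) x (2 *: ((x - x0) *m X)).
  have hc i : hasgrad (fun y => (y - x0) 0 i) x (evec R i).
    have := hasgradB (hasgrad_coord i x) (hasgrad_cst (x0 0 i) x).
    by rewrite subr0; apply: hasgrad_ext => y; rewrite !mxE.
  have H := hasgrad_sum (index_enum 'I_n) (fun i => hasgradM (hasgrad_mulmx i x) (hc i)).
  rewrite (_ : 2 *: _ = \sum_i (((x - x0) *m X) 0 i *: evec R i + (x - x0) 0 i *: row i X)).
    by apply: hasgrad_ext H => y; rewrite /quad XT.
  rewrite big_split/= -mulmx_sum_row scaler_nat mulr2n; congr (_ + _).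
  exact: row_sum_delta.
have hl : hasgrad (fun y => dotv eta (y - x0)) x eta.
  have := hasgradB (hasgrad_dotv eta x) (hasgrad_cst (dotv eta x0) x).
  by rewrite subr0; apply: hasgrad_ext => y; rewrite dotvBr.
have := hasgradD (hasgradD (hasgrad_cst c x) hl) (hasgradZ 2^-1 hq).
by rewrite add0r scalerA mulVf// scale1r.
Qed.

End quadratic.

Lemma quad_subZ (R : realType) n (X : 'M[R]_n) (t : R) h :
  quad (X - t%:M) h h = quad X h h - t * dotv h h.
Proof.
rewrite /quad linearB/= tr_scalar_mx mulmxBr mul_mx_scalar.
by rewrite dotvC dotvBr !(dotvC h) dotvZl.
Qed.

(** The operator is affine in the matrix, with c independent of t: a small multiple of the identity
    cannot destroy a strict inequality. *)
Lemma viscosity_op_shift (R : realType) n (p q : R) (a : 'rV[R]_n -> R) x xi (X : 'M[R]_n) :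
  exists c : R, forall t, viscosity_op p q a x xi (X - t%:M) = viscosity_op p q a x xi X + t * c.
Proof.
pose e := (enorm xi)^-1 *: xi.
pose c := enorm xi `^ (p - 2) * (n%:R + (p - 2) * dotv e e)
  + a x * enorm xi `^ (q - 2) * (n%:R + (q - 2) * dotv e e).
exists c => t; rewrite /viscosity_op -/e.
rewrite quad_subZ.
have -> : \tr (X - t%:M) = \tr X - t * n%:R by rewrite linearB/= mxtrace_scalar mulr_natr.
rewrite /c; ring.
Qed.

Lemma ess_liminf_ge (R : realType) n (u : 'rV[R]_n -> R) x (r c : R) : 0 < r ->
  {ae lebesgue_rV R n, forall y, ball x r y -> c <= u y} -> (c%:E <= ess_liminf u x)%E.
Proof.
move=> r0 cu; apply: le_trans (ereal_sup_ubound _); last by exists r.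
apply/ess_infP; apply: filterS cu => y cy; rewrite /patch.
case: ifPn => [/set_mem By|_]; last by rewrite leey.
by rewrite lee_fin cy.
Qed.

Section difference.
Context (R : realType) (n : nat) (n_gt0 : (0 < n)%N).
Local Notation E := 'rV[R]_n.
Local Notation mu := (lebesgue_rV R n).
Context (p q : R) (p_gt1 : 1 < p) (p_le_q : p <= q) (a : E -> R).
Context (Om : set E) (mO : measurable Om) (ma : measurable_fun Om a).
Hypothesis a_ge0 : forall x, Om x -> 0 <= a x.

(** The crude factor 2 comes from the parallelogram identity alone; finiteness of the modular
    tolerates any constant. *)
Lemma enormB_le (x y : E) : enorm (x - y) <= 2 * (enorm x + enorm y).
Proof.
have s0 := dotv_ge0 (x + y); have x0 := enorm_ge0 x; have y0 := enorm_ge0 y.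
rewrite -(@ler_pXn2r _ 2)// ?nnegrE ?enorm_ge0 ?mulr_ge0 ?addr_ge0//.
have E1 : dotv (x - y) (x - y) = 2 * dotv x x + 2 * dotv y y - dotv (x + y) (x + y).
  rewrite /dotv !mulr_sumr -big_split -sumrB; apply: eq_bigr => i _.
  by rewrite !mxE /=; ring.
rewrite sqr_enorm E1 -!sqr_enorm; move: s0; rewrite -sqr_enorm => s0.
have xy0 : 0 <= enorm x * enorm y by rewrite mulr_ge0.
have x2 : 0 <= enorm x ^+ 2 by rewrite exprn_ge0.
have y2 : 0 <= enorm y ^+ 2 by rewrite exprn_ge0.
have -> : (2 * (enorm x + enorm y)) ^+ 2 =
    4 * (enorm x ^+ 2 + enorm y ^+ 2 + 2 * (enorm x * enorm y)) by ring.
by lra.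
Qed.

Lemma LH_B (g h : E -> R) : LH p q a Om g -> LH p q a Om h -> LH p q a Om (g \- h).
Proof.
move=> [mg goo] [mh hoo]; split; first exact: measurable_funB.
have mNh : measurable_fun Om (fun x => - h x) by exact: measurableT_comp.
have Nhoo : (modular p q a Om (fun x => - h x)%R < +oo)%E.
  by rewrite /modular; under eq_integral do rewrite phaseN.
apply: le_lt_trans (modularD p_gt1 p_le_q mO ma a_ge0 mO (@subset_refl _ Om) mg mNh) _.
by apply: lte_mul_pinfty; [rewrite lee_fin powR_ge0|by []|exact: lte_add_pinfty goo Nhoo].
Qed.

(** The gradient of the difference is controlled through the doubling property of H, as (g - h) must
    again have finite energy. *)
Lemma W1H_withB (g h : E -> R) (Dg Dh : E -> E) : (mu Om < +oo)%E -> W1H_with p q a Om g Dg ->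
  W1H_with p q a Om h Dh -> W1H_with p q a Om (g \- h) (Dg \- Dh).
Proof.
move=> Ooo [LHg [[mg lg] lDg wg] [mDg Dgoo]] [LHh [[mh lh] lDh wh] [mDh Dhoo]].
have mgi i : measurable_fun Om (fun x => Dg x 0 i) by have [] := lDg i.
have mhi i : measurable_fun Om (fun x => Dh x 0 i) by have [] := lDh i.
have DE i : (fun x => (Dg \- Dh) x 0 i) = (fun x => Dg x 0 i - Dh x 0 i).
  by apply/funext => x; rewrite !mxE.
have OO := @subset_refl _ Om.
have ig := modular_integrable1 p_gt1 mO ma a_ge0 mO OO Ooo mg LHg.2.
have ih := modular_integrable1 p_gt1 mO ma a_ge0 mO OO Ooo mh LHh.2.
have iDg i := integrable_coord p_gt1 p_le_q mO ma a_ge0 mO OO Ooo i mgi Dgoo.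
have iDh i := integrable_coord p_gt1 p_le_q mO ma a_ge0 mO OO Ooo i mhi Dhoo.
split; first exact: LH_B.
  split; [|move=> i; rewrite DE|move=> phi tphi i].
  - by apply: (integrable_locally_on mO); exact: integrable_rB.
  - by apply: (integrable_locally_on mO); exact: integrable_rB.
  - have tDphi := test_function_partial i tphi.
    have [C1 C10 HC1] := test_function_bounded tphi.
    have [C2 C20 HC2] := test_function_bounded tDphi.
    have mphi := test_function_measurable (D := Om) tphi.
    have mDphi := test_function_measurable (D := Om) tDphi.
    have i1 := integrable_mul_bounded mO ig mDphi (fun x _ => HC2 x).
    have i2 := integrable_mul_bounded mO ih mDphi (fun x _ => HC2 x).
    have i3 := integrable_mul_bounded mO (iDg i) mphi (fun x _ => HC1 x).
    have i4 := integrable_mul_bounded mO (iDh i) mphi (fun x _ => HC1 x).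
    under eq_Rintegral do rewrite mulrBl.
    under [in RHS]eq_Rintegral do rewrite [_ 0 i](congr1 (fun F => F _) (DE i)) mulrBl.
    by rewrite !RintegralB// wg// wh// opprB opprK addrC.
split; first by apply: measurable_enorm => i; rewrite DE; exact: measurable_funB.
have m1 : measurable_fun Om (fun x => enorm ((Dg \- Dh) x)).
  by apply: measurable_enorm => i; rewrite DE; exact: measurable_funB.
have m2 : measurable_fun Om (fun x => enorm (Dg x) + enorm (Dh x)) by exact: measurable_funD.
have m3 : measurable_fun Om (fun x => 2 * (enorm (Dg x) + enorm (Dh x))) by exact: measurable_funM.
apply: le_lt_trans (modular_le p_gt1 p_le_q mO ma a_ge0 mO OO m1 m3 _) _.
  move=> x _; rewrite !ger0_norm ?mulr_ge0 ?addr_ge0 ?enorm_ge0//.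
  exact: enormB_le.
apply: le_lt_trans (modularM p_le_q mO ma a_ge0 mO OO _ m2) _; first by rewrite ler1n.
apply: lte_mul_pinfty; [by rewrite lee_fin powR_ge0|by []|].
apply: le_lt_trans (modularD p_gt1 p_le_q mO ma a_ge0 mO OO mDg mDh) _.
by apply: lte_mul_pinfty; [rewrite lee_fin powR_ge0|by []|exact: lte_add_pinfty Dgoo Dhoo].
Qed.

End difference.

Lemma continuous_at_enorm (R : realType) n (G : 'rV[R]_n -> 'rV[R]_n) x :
  (forall i, {for x, continuous (fun y => G y 0 i)}) -> {for x, continuous (fun y => enorm (G y))}.
Proof.
move=> cG; have cs : {for x, continuous (fun y => dotv (G y) (G y))}.
  by apply: continuous_at_fsum => i; apply: continuousM.
by apply: (@continuous_comp _ _ _ (fun y => dotv (G y) (G y)) (@Num.sqrt R)) => //; exact: sqrt_continuous.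
Qed.

Lemma near_lt (R : realType) n (g : 'rV[R]_n -> R) x (c : R) :
  {for x, continuous g} -> g x < c -> \forall y \near x, g y < c.
Proof.
move=> cg gxc; apply: (cg [set t | t < c]).
by apply: open_nbhs_nbhs; split=> //; exact: open_lt.
Qed.

Section comparison.
Context (R : realType) (n : nat) (n_gt0 : (0 < n)%N).
Local Notation E := 'rV[R]_n.
Local Notation mu := (lebesgue_rV R n).
Context (p q : R) (p_gt1 : 1 < p) (p_le_q : p <= q).
Hypothesis pq_bound : q / p <= 1 + n%:R^-1.
Context (a : E -> R) (f : E -> R -> E -> R) (Om : set E) (u : E -> R).
Hypothesis a_ge0 : forall x, Om x -> 0 <= a x.
Hypothesis a_C1 : C1_on Om a.
Hypothesis u_W1H : W1H_loc p q a Om u.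
Hypothesis u_comparison : forall Om', domain Om' -> Om' `<=` Om ->
  comparison_property p q a f Om' u.
Context (x0 : E) (r : R) (r0 : 0 < r).
Hypothesis cball_Om : forall y, `|x0 - y| <= 4 * r -> Om y.
Context (v : E -> R) (Dv : E -> E) (X : 'M[R]_n) (XT : X^T = X).
Hypothesis v_grad : forall x, hasgrad v x (Dv x).
Hypothesis Dv_grad : forall i x, hasgrad (fun y => Dv y 0 i) x (row i X).
Hypothesis Dv_neq0 : forall x, `|x0 - x| <= 4 * r -> Dv x != 0.
Hypothesis v_sub : forall x, `|x0 - x| <= 4 * r ->
  viscosity_op p q a x (Dv x) X <= f x (v x) (Dv x).
Hypothesis v_le_u : forall x, r / 2 <= `|x0 - x| -> `|x0 - x| <= 4 * r -> v x <= u x.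

(** Nested cubes about x0: the comparison takes place on radius r, mollification integrates over the
    closed cube of radius 2 r, and the Sobolev data of u live on the open cube of radius 3 r, which
    is compactly contained in [Om]. *)
Lemma comparison_cube : {ae mu, forall x, ball x0 r x -> v x <= u x}.
Proof.
pose cb s : set E := [set y | `|x0 - y| <= s].
have cbS s t : s <= t -> cb s `<=` cb t by move=> st y /le_trans; apply.
have bcb s : ball x0 s `<=` cb s by move=> y /in_ballP /ltW.
have cbb s t : s < t -> cb s `<=` ball x0 t by move=> st y ys; apply/in_ballP; exact: le_lt_trans st.
have bfin s : (mu (ball x0 s) < +oo)%E by exact: lebesgue_ball_lty.
have mb s : measurable (ball x0 s) by apply: measurable_rV_open; exact: ball_open.
have r12 : r <= 2 * r by move: r0; lra.
have r23 : 2 * r < 3 * r by move: r0; lra.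
have r34 : 3 * r < 4 * r by move: r0; lra.
have r24 : 2 * r <= 4 * r by move: r0; lra.
have r14 : r <= 4 * r by move: r0; lra.
have a_diff x : cb (4 * r) x -> differentiable a x by move=> /cball_Om /a_C1 [].
have a_dcont x : cb (4 * r) x -> {for x, continuous (grad a)} by move=> /cball_Om /a_C1 [].
have a_pos x : cb (4 * r) x -> 0 <= a x by move=> /cball_Om; exact: a_ge0.
have a_cont x : cb (4 * r) x -> {for x, continuous a}.
  by move=> /a_diff; exact: differentiable_continuous.
have ck s : compact (cb s) by exact: compact_cball.
have mk s : measurable (cb s) by exact: measurable_cball.
have ma4 : measurable_fun (ball x0 (4 * r)) a.
  by apply: open_continuous_measurable => [|x /bcb]; [exact: ball_open|exact: a_cont].
have ma3 : measurable_fun (cb (3 * r)) a by apply: measurable_funS ma4 => //; exact: cbb.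
have ma2 : measurable_fun (cb (2 * r)) a.
  by apply: measurable_funS ma3 => //; apply: cbS; exact: ltW.
have cb34 := cbS _ _ (ltW r34).
have cb23 := cbS _ _ (ltW r23).
pose O3 : set E := ball x0 (3 * r).
have dO3 : domain O3 by apply: ball_domain; rewrite mulr_gt0.
have O3cpt : cpt_contained O3 Om.
  have S3 := @closure_ball_cball R n x0 (3 * r); split.
    by apply: subclosed_compact (ck (3 * r)) S3; exact: closed_closure.
  by move=> y /S3 /cb34 /cball_Om.
have [Du Hu] := u_W1H dO3 O3cpt.
have Hv : W1H_with p q a O3 v Dv.
  apply: (smooth_W1H p_gt1 p_le_q (ck (3 * r)) ma3 _ _ (ball_open _ _) (bcb _) v_grad Dv_grad (bfin _)).
  - by move=> x /cb34; exact: a_pos.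
  - by move=> x /cb34; exact: a_diff.
  - exact: ball_open.
  - by [].
have ma3' : measurable_fun O3 a by apply: measurable_funS ma3 => //; exact: bcb.
have a_pos3 x : O3 x -> 0 <= a x by move=> /bcb /cb34; exact: a_pos.
have [[mw woo] ww [mDw Dwoo]] := W1H_withB p_gt1 p_le_q (mb (3 * r)) ma3' a_pos3 (bfin (3 * r)) Hv Hu.
have K2O : cb (2 * r) `<=` O3 by exact: cbb.
have mwi i : measurable_fun O3 (fun x => (Dv \- Du) x 0 i) by have [_ /(_ i)[]] := ww.
have [L L0 aL] := @cball_lipschitz R n a x0 (2 * r) (fun y Hy =>
  conj (a_diff _ (cbS _ _ r24 _ Hy)) (a_dcont _ (cbS _ _ r24 _ Hy))).
have [A A0 HA] := continuous_at_bounded (ck (2 * r)) (fun y Hy => a_cont _ (cbS _ _ r24 _ Hy)).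
have K2oo : (mu (cb (2 * r)%R) < +oo)%E.
  apply: le_lt_trans (bfin (3 * r)); apply: le_measure => //; rewrite inE //.
(* A point outside N has distance more than 3 r / 4 from x0, so its r / 4-neighbours are farther
   than r / 2, where v <= u is known. From the cube of radius r the same step stays within 2 r. *)
pose d0 := r / 4; have d00 : 0 < d0 by rewrite divr_gt0.
pose N : set E := cb (3 * r / 4).
have subK (F : E -> R) : measurable_fun O3 F -> (modular p q a O3 F < +oo)%E ->
    (modular p q a (cb (2 * r)%R) F < +oo)%E.
  move=> mF; apply: le_lt_trans; apply: ge0_subset_integral => //.
  - exact: mb.
  - exact: (measurable_phaseE p q (mb (3 * r)) ma3' (mb (3 * r)) (@subset_refl _ O3) mF).
  - by move=> x /a_pos3 ax; rewrite lee_fin phase_ge0.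
have W : W1H0_with p q a (ball x0 r) (fun x => Num.max ((v \- u) x) 0) (posg (v \- u) (Dv \- Du)).
  apply: (@positive_part_W1H0 _ _ n_gt0 _ _ p_gt1 p_le_q pq_bound a (cb (2 * r)) (mk _) ma2 _
    L L0 aL (ck _) K2oo A A0 _ _ (ball_open _ _) _ d0 d00 _ N (ck _) _ _ _ O3 K2O ww).
  - by move=> x /(cbS _ _ r24); exact: a_pos.
  - by move=> x /HA; apply: le_trans; exact: ler_norm.
  - by move=> x /bcb; exact: cbS.
  - move=> x y /in_ballP xr xy; rewrite /cb /= (_ : x0 - y = (x0 - x) + (x - y)); last first.
      by rewrite addrA subrK.
    by rewrite (le_trans (ler_normD _ _))//; move: xy r0; rewrite /d0; lra.
  - by apply: cbb; move: r0; lra.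
  - exact: measurable_funS mw.
  - by move=> i; exact: (measurable_funS (mb _) K2O (mwi i)).
  - exact: (subK _ mw woo).
  - exact: (subK _ mDw Dwoo).
  - move=> x y /negP; rewrite /N /cb /= -ltNge => xN yK xy; rewrite subr_le0.
    apply: v_le_u; last exact: cbS yK.
    have : `|x0 - x| <= `|x0 - y| + `|x - y|.
      by rewrite (le_trans _ (ler_normB _ _))// opprB addrA subrK.
    by move: xy r0; rewrite /d0; lra.
have dB := @ball_domain R n x0 r r0.
have BO : ball x0 r `<=` Om by move=> y /bcb /(cbS _ _ r14) /cball_Om.
apply: (u_comparison dB BO); last by exists (posg (v \- u) (Dv \- Du)).
apply: (classical_weak_subsolution p_gt1 p_le_q (ck (2 * r)) ma2 _ _ _ (ball_open _ _) _ XT v_grad Dv_grad _ (bfin _)).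
- by move=> x /(cbS _ _ r24); exact: a_pos.
- by move=> x /(cbS _ _ r24); exact: a_diff.
- by move=> x /(cbS _ _ r24); exact: a_dcont.
- by move=> x /bcb; exact: cbS.
- by move=> x /(cbS _ _ r24); exact: Dv_neq0.
- by move=> x /bcb /(cbS _ _ r14); exact: v_sub.
Qed.

End comparison.

Lemma dotvx0 (R : realType) n (x : 'rV[R]_n) : dotv x 0 = 0.
Proof. by rewrite /dotv big1// => i _; rewrite mxE mulr0. Qed.

Lemma enorm0 (R : realType) n : enorm (0 : 'rV[R]_n) = 0.
Proof. by rewrite /enorm dotvx0 sqrtr0. Qed.

(** * From a violated inequality at a point to a contradiction *)

Unset Implicit Arguments.

Theorem theorem1p4 (R : realType) (n : nat) (Omega : set 'rV[R]_n)
  (p q alpha : R) (a : 'rV[R]_n -> R) (f : 'rV[R]_n -> R -> 'rV[R]_n -> R)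
  (u : 'rV[R]_n -> R)
  (n_ge2 : (2 <= n)%N)
  (Omega_domain : domain Omega) (Omega_bounded : bounded_set Omega)
  (p_gt1 : 1 < p) (p_le_q : p <= q)
  (a_ge0 : forall x, Omega x -> 0 <= a x) (a_C1 : C1_on Omega a)
  (alpha_gt0 : 0 < alpha) (alpha_le1 : alpha <= 1)
  (a_holder : holder_on alpha Omega a)
  (pq_bound : q / p <= 1 + alpha / n%:R)
  (f_unif_cont : uniformly_continuous_on Omega f)
  (u_lsc : lsc_on Omega u)
  (u_lsc_repr : forall x, Omega x -> (u x)%:E = ess_liminf u x)
  (u_supersolution : weak_supersolution p q a f Omega u)
  (u_comparison : forall Omega', domain Omega' -> Omega' `<=` Omega ->
     comparison_property p q a f Omega' u) :
  viscosity_supersolution p q a f Omega u.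
Proof.
split=> // x0 eta X Ox0 eta0 [/= XT sub]; rewrite leNgt; apply/negP => op_lt.
have n_gt0 : (0 < n)%N by exact: ltnW.
(* On interior cubes [a] is Lipschitz, so mollification is run with exponent 1; the matching bound
   follows from alpha <= 1. *)
have pq' : q / p <= 1 + n%:R^-1.
  by rewrite (le_trans pq_bound)// lerD2l ler_piMl ?invr_ge0.
have [c hc] := viscosity_op_shift p q a x0 eta X.
set f0 := f x0 (u x0) eta in op_lt; set op0 := viscosity_op _ _ _ _ _ _ in op_lt hc.
(* The matrix will be shifted by 4 e, which raises the operator by 4 e c, at most a quarter of the
   gap f0 - op0. *)
pose e := (f0 - op0) / (16 * (1 + `|c|)).
have gap0 : 0 < f0 - op0 by rewrite subr_gt0.
have c1 : 0 < 1 + `|c| by rewrite ltr_pwDl.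
have e0 : 0 < e by rewrite divr_gt0// mulr_gt0.
have ec : 4 * e * c <= (f0 - op0) / 4.
  apply: (@le_trans _ _ (4 * e * (1 + `|c|))).
    apply: ler_wpM2l; first by rewrite mulr_ge0// ltW.
    by rewrite (le_trans (ler_norm _))// lerDr.
  by rewrite /e le_eqVlt; apply/orP; left; apply/eqP; field; rewrite gt_eqF.
(* This lowers the paraboloid by 2 e |y - x0|^2. The subjet costs e |y - x0|^2, so near x0 the new
   paraboloid satisfies phi + e |y - x0|^2 <= u. *)
pose X' := X - (4 * e)%:M.
have X'T : X'^T = X' by rewrite /X' linearB/= XT tr_scalar_mx.
pose Dv y := eta + (y - x0) *m X'.
pose phi y := u x0 + dotv eta (y - x0) + 2^-1 * quad X' (y - x0) (y - x0).
have Dv_grad i x : hasgrad (fun y => Dv y 0 i) x (row i X') by exact: hasgrad_affine.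
have Dvx0 : Dv x0 = eta by rewrite /Dv subrr mul0mx addr0.
have phix0 : phi x0 = u x0.
  by rewrite /phi subrr /quad !dotvx0 mulr0 !addr0.
have phi_le y : u x0 + dotv eta (y - x0) + 2^-1 * quad X (y - x0) (y - x0)
    - e * enorm (y - x0) ^+ 2 = phi y + e * enorm (y - x0) ^+ 2.
  rewrite /phi (_ : quad X' (y - x0) (y - x0) = quad X (y - x0) (y - x0) - 4 * e * enorm (y - x0) ^+ 2).
    by field.
  by rewrite quad_subZ sqr_enorm.
have eta_gt0 : 0 < enorm eta by rewrite /enorm sqrtr_gt0 dotv_gt0.
have [d d0 fd] := f_unif_cont _ (divr_gt0 gap0 (ltr0n _ 2)).
have near_Om : \forall y \near x0, Omega y.
  by have [oO _ _] := Omega_domain; exact: open_nbhs_nbhs.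
have near_x : \forall y \near x0, enorm (x0 - y) < d.
  apply: near_lt; last by rewrite subrr enorm0.
  apply: continuous_at_enorm => i.
  have := hasgradB (hasgrad_cst (x0 0 i) x0) (hasgrad_coord i x0).
  by move/(hasgrad_ext (w := fun y => (x0 - y) 0 i)) => H; apply: hasgrad_continuous (H _) => y; rewrite !mxE.
have near_phi (s : R) : 0 < s -> \forall y \near x0, `|u x0 - phi y| < s.
  move=> s0; have cphi := hasgrad_continuous (hasgrad_quadratic x0 eta X'T (u x0) x0).
  apply: near_lt; last by rewrite phix0 subrr normr0.
  apply: continuous_comp; last exact: norm_continuous.
  by apply: continuousB => //; exact: cst_continuous.
have near_Dv (s : R) : 0 < s -> \forall y \near x0, enorm (eta - Dv y) < s.
  move=> s0; apply: near_lt.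
    apply: continuous_at_enorm => i.
    have := hasgradB (hasgrad_cst (eta 0 i) x0) (Dv_grad i x0).
    by move/(hasgrad_ext (w := fun y => (eta - Dv y) 0 i)) => H; apply: hasgrad_continuous (H _) => y; rewrite [RHS]mxE [(- Dv y) _ _]mxE.
  by rewrite Dvx0 subrr enorm0.
have radius (P : set 'rV[R]_n) : nbhs x0 P -> exists2 s : R, 0 < s & forall y, `|x0 - y| < s -> P y.
  by move=> /nbhs_ballP[s /= s0 sP]; exists s => // y ys; apply: sP; apply/in_ballP.
(* Where Dv differs from eta by less than |eta| it cannot vanish. *)
have [s1 s10 Hs1] := radius _ (filterI near_Om (near_Dv _ eta_gt0)).
pose K := [set y | `|x0 - y| <= s1 / 2].
have K1 y : K y -> Omega y /\ Dv y != 0.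
  move=> Ky; have [Oy etaDv] : Omega y /\ enorm (eta - Dv y) < enorm eta.
    by apply: Hs1; apply: le_lt_trans Ky _; lra.
  by split=> //; apply/eqP => Dv0; move: etaDv; rewrite Dv0 subr0 ltxx.
have op_cont : {for x0, continuous (fun y => viscosity_op p q a y (Dv y) X')}.
  apply: (@viscosity_op_continuous _ _ _ _ _ K _ _ (ball x0 (s1 / 2)) (ball_open _ _)) => //.
  - by move=> y /K1[/a_C1[]].
  - by move=> y /K1[/a_C1[]].
  - by move=> y /in_ballP /ltW.
  - by move=> y /K1[].
  - by apply: ballxx; rewrite divr_gt0.
(* At x0 the operator is op0 + 4 e c, at most op0 plus a quarter of the gap. Half of the gap is thus
   left for the oscillation of f, which [fd] keeps below that half. *)
have near_op : \forall y \near x0, viscosity_op p q a y (Dv y) X' < f0 - (f0 - op0) / 2.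
  apply: near_lt => //; rewrite Dvx0 hc; lra.
have d2 : 0 < d / 2 by rewrite divr_gt0.
have [s2 s20 Hs2] := radius _ (filterI (filterI near_x (near_phi _ d2))
  (filterI (near_Dv _ d0) (filterI near_op (sub e e0)))).
pose s := Num.min (s1 / 2) s2.
have s0 : 0 < s by rewrite lt_min divr_gt0.
have ss1 : s <= s1 / 2 by rewrite ge_min lexx.
have ss2 : s <= s2 by rewrite ge_min lexx orbT.
pose r := s / 8; have r0 : 0 < r by rewrite divr_gt0.
have r4 : 4 * r < s by rewrite /r; lra.
(* d / 4 keeps v within d of [u x0], as continuity of f requires; e (r / 2)^2 keeps phi + m below u
   wherever |x0 - y| >= r / 2. *)
pose m := Num.min (d / 4) (e * (r / 2) ^+ 2).
have m0 : 0 < m by rewrite lt_min divr_gt0//= mulr_gt0// exprn_gt0// divr_gt0.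
have md : m <= d / 4 by rewrite ge_min lexx.
have me : m <= e * (r / 2) ^+ 2 by rewrite ge_min lexx orbT.
pose v y := (u x0 + m) + dotv eta (y - x0) + 2^-1 * quad X' (y - x0) (y - x0).
have vE y : v y = phi y + m by rewrite /v /phi; ring.
have v_grad x : hasgrad v x (Dv x) by exact: hasgrad_quadratic.
have all_s y : `|x0 - y| <= 4 * r -> K y /\ [/\ enorm (x0 - y) < d, `|u x0 - phi y| < d / 2,
    enorm (eta - Dv y) < d, viscosity_op p q a y (Dv y) X' < f0 - (f0 - op0) / 2 &
    phi y + e * enorm (y - x0) ^+ 2 <= u y].
  move=> yr; split; first by rewrite /K /=; lra.
  have [[h1 h2] [h3 [h4 h5]]] : _ := Hs2 y (lt_le_trans (le_lt_trans yr r4) ss2).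
  by split=> //; rewrite -phi_le.
have v_le_u y : r / 2 <= `|x0 - y| -> `|x0 - y| <= 4 * r -> v y <= u y.
  move=> ry /all_s[_ [_ _ _ _ uy]]; rewrite vE (le_trans _ uy)// lerD2l (le_trans me)//.
  rewrite ler_wpM2l ?(ltW e0)// ler_sqr ?nnegrE ?enorm_ge0//; last by rewrite divr_ge0 ?(ltW r0).
  by rewrite (le_trans ry)// distrC norm_le_enorm.
have v_sub y : `|x0 - y| <= 4 * r -> viscosity_op p q a y (Dv y) X' <= f y (v y) (Dv y).
  move=> /all_s[/K1[Oy _] [h1 h2 h3 h4 _]].
  have uv : `|u x0 - v y| < d.
    rewrite vE opprD addrA (le_lt_trans (ler_normB _ _))// (gtr0_norm m0).
    by move: h2 md d0; lra.
  have := fd _ _ _ _ _ _ Ox0 Oy h1 uv h3; rewrite -/f0 ltr_norml => /andP[_ h].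
  by move: h h4; lra.
have comparison : {ae lebesgue_rV R n, forall y, ball x0 r y -> v y <= u y}.
  apply: (comparison_cube n_gt0 p_gt1 p_le_q pq' a_ge0 a_C1 u_supersolution.1 u_comparison
    r0 _ X'T v_grad Dv_grad _ v_sub v_le_u).
  - by move=> y /all_s[/K1[]].
  - by move=> y /all_s[/K1[]].
have m2 : 0 < m / 2 by rewrite divr_gt0.
(* Here phi > u x0 - m / 2, hence v = phi + m > u x0 + m / 2. As v <= u holds only almost
   everywhere, the conclusion is drawn at x0 through the essential lower limit. *)
have [s3 s30 Hs3] := radius _ (near_phi _ m2).
have : ((u x0 + m / 2)%:E <= ess_liminf u x0)%E.
  have rs3 : 0 < Num.min r s3 by rewrite lt_min r0.
  apply: (ess_liminf_ge rs3); apply: filterS comparison => y vu.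
  move=> /in_ballP; rewrite lt_min => /andP[yr /Hs3].
  have := vu (iffRL (in_ballP _ _ _) yr); rewrite vE ltr_norml => H /andP[_ H2].
  by lra.
by rewrite -u_lsc_repr// lee_fin gerDl leNgt m2.
Qed.
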